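(* Let $n\geq1$ and $s>1/2$, and let $a(\xi)$ be a polynomial on $\mathbb{R}^n$ with real coefficients. Then there exists a constant $C>0$ such that for all $\varphi\in L^2(\mathbb{R}^n)$, \[ \left\|\langle x\rangle^{-s}|\nabla a(D_x)|^{1/2}e^{ita(D_x)}\varphi(x)\right\|_{L^2(\mathbb{R}_t\times\mathbb{R}^n_x)}\leq C\|\varphi\|_{L^2(\mathbb{R}^n_x)}. \]
   Context: $\langle x\rangle=(1+|x|^2)^{1/2}$. For a measurable function $p$ on $\mathbb{R}^n$, $p(D_x)$ denotes the Fourier multiplier $p(D_x)\varphi=\mathcal{F}^{-1}[p\,\mathcal{F}\varphi]$; in particular $e^{ita(D_x)}\varphi=\mathcal{F}^{-1}[e^{ita(\xi)}\widehat\varphi]$ and $|\nabla a(D_x)|^{1/2}$ has symbol $|\nabla a(\xi)|^{1/2}$. *)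

(* Defs.v *)
From HB Require Import structures.
From mathcomp Require Import all_boot all_order all_algebra.
From mathcomp Require Import all_classical all_reals all_analysis.
From mathcomp Require Import complex.
From mathcomp Require mpoly.

Set Implicit Arguments.
Unset Strict Implicit.
Unset Printing Implicit Defensive.

Import Order.TTheory GRing.Theory Num.Theory.
Import numFieldNormedType.Exports.
Local Open Scope classical_set_scope.
Local Open Scope ring_scope.
Local Open Scope complex_scope.

Section Defs.
Variables (R : realType) (n : nat).

(* R^n is modelled by n.-tuple R with its product (= Borel) sigma-algebra. *)
Definition Rn := n.-tuple R.

Definition coord (x : Rn) (i : 'I_n) : R := tnth x i.

Definition dotRn (x y : Rn) : R := \sum_(i < n) coord x i * coord y i.
Definition normRn (x : Rn) : R := Num.sqrt (dotRn x x).

Definition ballRn (K : R) : set Rn := [set x | normRn x <= K].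

Definition jbr_pow (s : R) (x : Rn) : R := (1 + dotRn x x) `^ (- (s / 2)).

(* mu is the Lebesgue measure on R^n: the measure of every closed box is the
   product of the side lengths (this determines mu on the Borel sets). *)
Definition is_lebesgue_Rn (mu : {measure set Rn -> \bar R}) : Prop :=
  forall a b : Rn, (forall i, coord a i <= coord b i) ->
    mu [set x | forall i, coord a i <= coord x i <= coord b i] =
    (\prod_(i < n) (coord b i - coord a i))%:E.

Definition cexpi (theta : R) : R[i] := (cos theta) +i* (sin theta).

Definition cnorm2 (z : R[i]) : R := complex.Re z ^+ 2 + complex.Im z ^+ 2.

Definition cintegral {d} {T : measurableType d} (m : {measure set T -> \bar R})
    (A : set T) (f : T -> R[i]) : R[i] :=
  (Rintegral m A (fun x => complex.Re (f x))) +i* (Rintegral m A (fun x => complex.Im (f x))).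

Definition cmeasurable {d} {T : measurableType d} (f : T -> R[i]) : Prop :=
  measurable_fun setT (fun x => complex.Re (f x)) /\ measurable_fun setT (fun x => complex.Im (f x)).

Variable mu : {measure set Rn -> \bar R}.

Definition L2norm2 (f : Rn -> R[i]) : \bar R :=
  (\int[mu]_x (cnorm2 (f x))%:E)%E.

Definition isL2 (f : Rn -> R[i]) : Prop :=
  cmeasurable f /\ (L2norm2 f < +oo)%E.

Definition fourier_trunc (f : Rn -> R[i]) (K : R) (xi : Rn) : R[i] :=
  cintegral mu (ballRn K) (fun x => cexpi (- dotRn x xi) * f x).

Definition is_fourierL2 (f g : Rn -> R[i]) : Prop :=
  isL2 g /\
  ((fun k : nat => L2norm2 (fun xi => fourier_trunc f k%:R xi - g xi)) @ \oo
     --> 0%E).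

Definition peval (a : mpoly.mpoly n R) (xi : Rn) : R := mpoly.meval (coord xi) a.

Definition grad_norm (a : mpoly.mpoly n R) (xi : Rn) : R :=
  Num.sqrt (\sum_(i < n) (peval (mpoly.mderiv i a) xi) ^+ 2).

(* frequency-truncated version of |grad a(D)|^{1/2} e^{i t a(D)} phi, where
   g is the Fourier transform of phi:
   (2 pi)^{-n} \int_{|xi| <= K} e^{i x.xi} |grad a(xi)|^{1/2} e^{i t a(xi)} g(xi) dxi *)
Definition smoothing_trunc (a : mpoly.mpoly n R) (g : Rn -> R[i]) (K : R)
    (t : R) (x : Rn) : R[i] :=
  ((2 * pi) ^- n)%:C *
  cintegral mu (ballRn K) (fun xi =>
    cexpi (dotRn x xi) * (Num.sqrt (grad_norm a xi))%:C *
    cexpi (t * peval a xi) * g xi).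

(* w(t,x) = |grad a(D_x)|^{1/2} e^{i t a(D_x)} phi (x), as a function on
   R_t x R^n_x: the L^2_loc(R x R^n)-limit of the frequency truncations. *)
Definition is_smoothing_op (a : mpoly.mpoly n R) (phi : Rn -> R[i])
    (w : R * Rn -> R[i]) : Prop :=
  exists g, is_fourierL2 phi g /\ cmeasurable w /\
    forall K : nat,
      (fun k : nat =>
         (\int[lebesgue_measure]_(t in `[(- (K%:R : R))%R, (K%:R : R)]%classic)
            \int[mu]_(x in ballRn K%:R)
               (cnorm2 (smoothing_trunc a g k%:R t x - w (t, x)))%:E)%E)
        @ \oo --> 0%E.

Definition weighted_st_norm2 (s : R) (w : R * Rn -> R[i]) : \bar R :=
  (\int[lebesgue_measure]_t \int[mu]_x
     ((jbr_pow s x) ^+ 2 * cnorm2 (w (t, x)))%:E)%E.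

End Defs.

(* Main.v *)
Require Import Defs.
From HB Require Import structures.
From mathcomp Require Import all_boot all_order all_algebra.
From mathcomp Require Import all_classical all_reals all_analysis.
From mathcomp Require Import complex.
From mathcomp Require mpoly.
From mathcomp Require Import ring lra polyrcf measurable_realfun.

(** Truncating frequencies to a bounded set E turns the operator into the
    oscillatory integral with phase [t a(xi) + x.xi] and density
    [sqrt |grad a(xi)| g(xi)].  Since |grad a|^(1/2) = sum_j rho_j |d_j a|^(1/2)
    with 0 <= rho_j <= 1, it suffices to bound, for each j, the oscillatory
    integral with density [sqrt |d_j a| h_j] against the larger weight
    (1 + x_j^2)^(-s).  Put compactly supported cutoffs of scale T in t and in the
    x_i with i <> j, expand the square and integrate in (t, x) first (T T^* method):
    the x_j-integral is bounded because s > 1/2, and the others give a kernel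
    dominated by Lorentz kernels in a(xi) - a(eta) and in xi_i - eta_i, i <> j.
    In Schur's test with respect to |d_j a(eta)| d eta, the substitution
    u = a(eta) along the j-th coordinate, on the boundedly many intervals where a
    is monotone in eta_j, bounds the Schur integral independently of T and E.
    Let T tend to infinity.

    The same argument with phase [- x.xi] bounds the truncated Fourier transforms,
    so neither Plancherel's identity nor Fourier inversion is needed.  The bounds
    apply to differences of truncations as well; completeness of weighted L^2 then
    gives the limits, and the estimates pass to them. *)

Set Implicit Arguments.
Unset Strict Implicit.
Unset Printing Implicit Defensive.

Import Order.TTheory GRing.Theory Num.Theory.
Import numFieldNormedType.Exports.
(* [coord] is the coordinate function of Defs, not that of MathComp's vector.v. *)
Import Defs.
Local Open Scope classical_set_scope.
Local Open Scope ring_scope.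

(** * Cutoffs and Lorentz kernels *)

Section calculus.
Variable R : realType.
Notation leb := (@lebesgue_measure R).

(** For fixed j, the map eta -> (a(eta), eta_i for i <> j) has Jacobian |d_j a(eta)| in absolute
    value. The density sqrt |d_j a| is thus the square root of a Jacobian, and t and the x_i with i
    <> j are dual to the n new quantities. The variable x_j has no partner: its oscillation is
    discarded by absolute values, and only there is the decay of the weight spent. Hence the
    gradient is split over the coordinates before anything is estimated.

    The kernels need a mass bounded in T. The transform of the indicator of [-T, T] decays only like
    1/c, which is not integrable; the parabola [tau] is continuous and vanishes at both ends, so its
    transform decays like 1/c^2. A Lorentz profile has an arctangent as primitive, which makes the
    substitution u = a(eta) an instance of the fundamental theorem of calculus on each interval of
    monotonicity.

    Integrals are real-valued, so each complex exponential is treated as a cosine and a sine. The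
    addition formulas turn products into sums of two terms, and each such sum costs a factor 2: this
    is the source of most powers of 2 in the constants. *)

Lemma ftc_in_itv (F f : R -> R) (a b : R) : a <= b ->
  {in `[a, b], continuous f} ->
  (forall x : R, x \in `[a, b] -> is_derive x 1 F (f x)) ->
  (\int[leb]_(x in `[a, b]) (f x)%:E = (F b - F a)%:E)%E.
Proof.
rewrite le_eqVlt => /predU1P[<-|ab] cf dF.
  by rewrite subrr set_itv1 integral_set1.
have cF x : x \in `[a, b] -> {for x, continuous F}.
  by move=> xab; apply: differentiable_continuous; apply/derivable1_diffP; have := dF x xab => -[].
have aab : a \in `[a, b] by rewrite in_itv/= lexx ltW.
have bab : b \in `[a, b] by rewrite in_itv/= lexx ltW.
rewrite (@continuous_FTC2 _ _ F)//.
- by apply: continuous_in_subspaceT => x; rewrite inE/= => xab; exact: cf.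
- split; [by move=> x /subset_itv_oo_cc xab; have := dF x xab => -[]
    |exact/cvg_at_right_filter/cF|exact/cvg_at_left_filter/cF].
- by move=> x /subset_itv_oo_cc xab; rewrite derive1E; have := dF x xab => -[].
Qed.

Lemma ftc_itv (F f : R -> R) (a b : R) : a <= b -> continuous f ->
  (forall x : R, is_derive x 1 F (f x)) ->
  (\int[leb]_(x in `[a, b]) (f x)%:E = (F b - F a)%:E)%E.
Proof. by move=> ab cf dF; apply: ftc_in_itv => // x _; exact: cf. Qed.

(* The transform of [tau T] is at most 2T and at most 8/(T c^2) at frequency c;
   [lorentz T c] dominates the minimum of the two, and its mass does not depend on T. *)
Definition lorentz (T x : R) : R := 10 * T / (1 + (T * x) ^+ 2).
Definition tau (T t : R) : R := Num.max 0 (1 - (t / T) ^+ 2).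

Lemma lorentz_ge0 T x : 0 <= T -> 0 <= lorentz T x.
Proof.
by move=> T0; rewrite divr_ge0// ?addr_ge0 ?sqr_ge0// mulr_ge0.
Qed.

Lemma lorentzN T x : lorentz T (- x) = lorentz T x.
Proof. by rewrite /lorentz mulrN sqrrN. Qed.

Lemma tau_ge0 T t : 0 <= tau T t.
Proof. by rewrite /tau le_max lexx. Qed.

Lemma tau_le1 T t : tau T t <= 1.
Proof. by rewrite /tau ge_max ler01 gerBl sqr_ge0. Qed.

Lemma measurable_tau T : measurable_fun setT (tau T).
Proof.
apply: measurable_maxr; first exact: measurable_cst.
apply: measurable_funB; first exact: measurable_cst.
apply: measurable_funX; exact: measurable_funM.
Qed.

Lemma tau_out T t : 0 < T -> ~ `[- T, T]%classic t -> tau T t = 0.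
Proof.
move=> T0; rewrite /= in_itv/= => /negP; rewrite -ler_norml -ltNge => Tt.
rewrite /tau; apply/max_idPl; rewrite subr_le0 -(ger0_norm (sqr_ge0 _)) normrX.
rewrite normrM normfV (gtr0_norm T0) exprn_ege1//.
by rewrite ler_pdivlMr// mul1r ltW.
Qed.

Lemma tau_in T t : 0 < T -> `[- T, T]%classic t -> tau T t = 1 - (t / T) ^+ 2.
Proof.
move=> T0; rewrite /= in_itv/= -ler_norml => Tt.
apply/max_idPr; rewrite subr_ge0 -(ger0_norm (sqr_ge0 _)) normrX.
rewrite normrM normfV (gtr0_norm T0) exprn_ile1// ?divr_ge0 ?(ltW T0)//.
by rewrite ler_pdivrMr// mul1r.
Qed.

(** Here 3/4 = 1 - (1/2)^2. This lower bound on the half-size interval is what allows the cutoffs to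
    be divided out at the end. *)
Lemma tau_ge34 T t : 0 < T -> `|t| <= T / 2 -> 3 / 4 <= tau T t.
Proof.
move=> T0 tT; rewrite /tau le_max; apply/orP; right.
have : (t / T) ^+ 2 <= (1 / 2) ^+ 2.
  rewrite -[leLHS]ger0_norm ?sqr_ge0// normrX lerXn2r ?nnegrE//.
  by rewrite normrM normfV (gtr0_norm T0) ler_pdivrMr// mul1r mulrC.
by move=> h; lra.
Qed.

Lemma tau_integral_itv T (g : R -> R) : 0 < T ->
  Rintegral leb setT (fun t => tau T t * g t) =
  Rintegral leb `[- T, T] (fun t => (1 - (t / T) ^+ 2) * g t).
Proof.
move=> T0; rewrite [RHS]Rintegral_mkcond; congr fine; apply: eq_integral => t _.
rewrite patchE; case: ifPn => [|/negP]; rewrite inE => tT.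
  by rewrite tau_in.
by rewrite tau_out// mul0r.
Qed.

Lemma lebesgue_measure_itvNT (T : R) : 0 < T -> (leb `[(- T)%R, T]%classic = (2 * T)%:E)%E.
Proof.
move=> T0; rewrite lebesgue_measure_itv/= lte_fin -subr_gt0 opprK addr_gt0//.
by rewrite -EFinD; congr EFin; ring.
Qed.

Lemma integrable_tau (T : R) : 0 < T -> leb.-integrable setT (EFin \o tau T).
Proof.
move=> T0; apply/integrableP; split.
  apply/measurable_EFinP; exact: measurable_tau.
rewrite (_ : (fun x => _) = ((fun t => (tau T t)%:E) \_ `[- T, T])); last first.
  apply/funext => t /=; rewrite patchE ger0_norm ?tau_ge0//; case: ifPn => // /negP.
  by rewrite inE => h; rewrite tau_out.
rewrite -integral_mkcond.
apply: (@le_lt_trans _ _ (\int[leb]_(t in `[(- T)%R, T]) (cst 1 t)))%E.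
  apply: ge0_le_integral => //= [t _||t _].
  - by rewrite lee_fin tau_ge0.
  - apply/measurable_EFinP; apply: measurable_funTS; exact: measurable_tau.
  - by rewrite lee_fin tau_le1.
by rewrite integral_cst//= mul1e lebesgue_measure_itvNT// ltry.
Qed.

(** Both u - sin u and u + sin u have a nonnegative derivative, hence are nonnegative for u >= 0;
    negative arguments follow by parity. *)
Lemma abs_sin_le (x : R) : `|sin x| <= `|x|.
Proof.
wlog x0 : x / 0 <= x.
  move=> h; have [|/ltW xn] := leP 0 x; first exact: h.
  by rewrite -normrN -sinN -[leRHS]normrN h// oppr_ge0.
have cs (t : R) : is_derive t 1 (fun u => u - sin u : R) (1 - cos t) by apply: is_deriveB.
have cs' (t : R) : is_derive t 1 (fun u => u + sin u : R) (1 + cos t) by apply: is_deriveD.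
have cc : continuous (@cos R) by exact: continuous_cos.
have h1 : (0 <= (x - sin x - (0 - sin 0))%:E)%E.
  rewrite -(@ftc_itv (fun u => u - sin u) (fun t => 1 - cos t))//.
    by apply: integral_ge0 => t _; rewrite lee_fin subr_ge0 cos_le1.
  by move=> t; apply: cvgB; [exact: cvg_cst|exact: cc].
have h2 : (0 <= (x + sin x - (0 + sin 0))%:E)%E.
  rewrite -(@ftc_itv (fun u => u + sin u) (fun t => 1 + cos t))//.
    by apply: integral_ge0 => t _; rewrite lee_fin -lerBlDl sub0r cos_geN1.
  by move=> t; apply: cvgD; [exact: cvg_cst|exact: cc].
move: h1 h2; rewrite !lee_fin sin0 => h1 h2.
by rewrite (ger0_norm x0) ler_norml; apply/andP; split; lra.
Qed.

Lemma is_derive_sinZ (c t : R) : is_derive t 1 (fun u => sin (c * u)) (c * cos (c * t)).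
Proof.
have h := is_derive1_comp (is_derive_sin (c * t)) (is_deriveZ c (is_derive_id t (1 : R))).
by apply: is_derive_eq h _; rewrite mulrC /GRing.scale/= mulr1.
Qed.

Lemma is_derive_cosZ (c t : R) : is_derive t 1 (fun u => cos (c * u)) (- (c * sin (c * t))).
Proof.
have h := is_derive1_comp (is_derive_cos (c * t)) (is_deriveZ c (is_derive_id t (1 : R))).
by apply: is_derive_eq h _; rewrite mulNr mulrC /GRing.scale/= mulr1.
Qed.

Lemma is_derive_sqrD (c d t : R) : is_derive t 1 (fun u => c + d * u ^+ 2) (d * (2 * t)).
Proof.
apply: is_derive_eq; rewrite /GRing.scale/= add0r; ring.
Qed.

Lemma is_deriveMr (f g : R -> R) (x df dg : R) :
  is_derive x 1 f df -> is_derive x 1 g dg ->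
  is_derive x 1 (fun u => f u * g u) (f x * dg + g x * df).
Proof. by move=> hf hg; exact: is_deriveM. Qed.

Lemma is_deriveDr (f g : R -> R) (x df dg : R) :
  is_derive x 1 f df -> is_derive x 1 g dg ->
  is_derive x 1 (fun u => f u + g u) (df + dg).
Proof. by move=> hf hg; exact: is_deriveD. Qed.

Lemma continuous_cosZ (c : R) : continuous (fun t : R => cos (c * t)).
Proof.
move=> t; apply: (@continuous_comp _ _ _ (fun t => c * t) (@cos R)).
  exact: mulrl_continuous.
exact: continuous_cos.
Qed.

Lemma continuous_sinZ (c : R) : continuous (fun t : R => sin (c * t)).
Proof.
move=> t; apply: (@continuous_comp _ _ _ (fun t => c * t) (@sin R)).
  exact: mulrl_continuous.
exact: continuous_sin.
Qed.

Lemma continuous_quad (T : R) : continuous (fun t : R => 1 - (t / T) ^+ 2).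
Proof.
move=> x; apply: cvgB; first exact: cvg_cst.
by apply: (@continuous_comp _ _ _ (fun t : R => t / T) (fun t : R => t ^+ 2));
  [exact: mulrr_continuous|exact: exprn_continuous].
Qed.

Lemma tau_cos_abs_le (T : R) (g : R -> R) : 0 < T -> measurable_fun setT g ->
  (forall t, `|g t| <= 1) -> `|Rintegral leb setT (fun t => tau T t * g t)| <= 2 * T.
Proof.
move=> T0 mg g1.
have itg : leb.-integrable setT (EFin \o (fun t => tau T t * g t)).
  apply: le_integrable (integrable_tau T0) => //.
    apply/measurable_EFinP/measurable_funM => //; exact: measurable_tau.
  move=> t _ /=; rewrite lee_fin normrM ger0_norm ?tau_ge0// -[leRHS]mulr1.
  by rewrite ler_wpM2l ?tau_ge0.
apply: le_trans (le_normr_Rintegral _ itg) _ => //.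
rewrite (_ : Rintegral _ _ _ = Rintegral leb setT (fun t => tau T t * `|g t|)); last first.
  by apply: eq_Rintegral => t _; rewrite normrM ger0_norm ?tau_ge0.
rewrite tau_integral_itv//.
have -> : 2 * T = fine (\int[leb]_(t in `[(- T)%R, T]) (cst 1 t))%E.
  by rewrite integral_cst//= mul1e lebesgue_measure_itvNT.
have h1 : (\int[leb]_(t in `[(- T)%R, T]) ((1 - (t / T) ^+ 2) * `|g t|)%:E
   <= \int[leb]_(t in `[(- T)%R, T]) (cst 1 t))%E.
  apply: ge0_le_integral => //= [t tT||t tT].
  - by rewrite lee_fin mulr_ge0// -tau_in ?tau_ge0.
  - apply/measurable_EFinP; apply: measurable_funTS; apply: measurable_funM.
      by apply: continuous_measurable_fun; exact: continuous_quad.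
    exact: measurableT_comp.
  - by rewrite lee_fin mulr_ile1// -tau_in ?tau_ge0 ?tau_le1.
apply: (fine_le _ _ h1).
- rewrite ge0_fin_numE; last first.
    by apply: integral_ge0 => t tT; rewrite lee_fin mulr_ge0// -tau_in ?tau_ge0.
  apply: le_lt_trans h1 _.
  by rewrite integral_cst//= mul1e lebesgue_measure_itvNT// ltry.
- by rewrite integral_cst//= mul1e lebesgue_measure_itvNT.
Qed.

(** Adding z <= 2T to T^2 c^2 z <= 8T gives z (1 + (T c)^2) <= 10 T; this is the origin of the
    constant 10 in [lorentz]. *)
Lemma min_lorentz T c z : 0 < T -> z <= 2 * T -> (c != 0 -> z <= 8 / (T * c ^+ 2)) ->
  z <= lorentz T c.
Proof.
move=> T0 h1 h2.
rewrite /lorentz ler_pdivlMr; last by rewrite ltr_pwDl// sqr_ge0.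
have [->|c0] := eqVneq c 0.
  by rewrite mulr0 expr0n/= addr0 mulr1; lra.
have := h2 c0; rewrite ler_pdivlMr; last by rewrite mulr_gt0// exprn_even_gt0.
move=> h; have : z * (T * c ^+ 2) * T <= 8 * T by rewrite ler_wpM2r// ltW.
rewrite exprMn; nra.
Qed.

(** Two integrations by parts. The first leaves no boundary term because the parabola vanishes at -T
    and T, so the leading order is c^-2 rather than c^-1. *)
Lemma tau_cosE (T c : R) : 0 < T -> c != 0 ->
  Rintegral leb setT (fun t => tau T t * cos (c * t)) =
  - (4 / (T * c ^+ 2) * cos (c * T)) + 4 / (T ^+ 2 * c ^+ 3) * sin (c * T).
Proof.
move=> T0 c0; rewrite tau_integral_itv// /Rintegral.
(* The primitive found by integrating by parts until the polynomial factor is exhausted; it is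
   written as sums of products so that the derivative lemmas match it literally. *)
pose F (t : R) := (c^-1 + (- (c^-1 / T ^+ 2)) * t ^+ 2) * sin (c * t) +
   ((0 + (- (2 / (T ^+ 2 * c ^+ 2))) * t) * cos (c * t) + (2 / (T ^+ 2 * c ^+ 3)) * sin (c * t)).
have Tn0 : T != 0 by rewrite gt_eqF.
have TT : - T <= T by rewrite -subr_ge0 opprK addr_ge0// ltW.
have cf : continuous (fun t : R => (1 - (t / T) ^+ 2) * cos (c * t)).
  by move=> t; apply: cvgM; [exact: continuous_quad|exact: continuous_cosZ].
suff dF (t : R) : is_derive t 1 F ((1 - (t / T) ^+ 2) * cos (c * t)).
  rewrite (ftc_itv TT cf dF)/= /F mulrN cosN sinN; field.
  by rewrite Tn0 c0.
have d1 := is_deriveMr (is_derive_sqrD c^-1 (- (c^-1 / T ^+ 2)) t) (is_derive_sinZ c t).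
have dl : is_derive t 1 (fun u : R => 0 + (- (2 / (T ^+ 2 * c ^+ 2))) * u) (- (2 / (T ^+ 2 * c ^+ 2))).
  by apply: is_derive_eq; rewrite /GRing.scale/=; ring.
have d2 := is_deriveMr dl (is_derive_cosZ c t).
have d3 := is_deriveZ (2 / (T ^+ 2 * c ^+ 3)) (is_derive_sinZ c t).
apply: is_derive_eq (is_deriveDr d1 (is_deriveDr d2 d3)) _.
rewrite /GRing.scale/=; field.
by rewrite Tn0 c0.
Qed.

Lemma tau_cos_le T c : 0 < T ->
  `|Rintegral leb setT (fun t => tau T t * cos (c * t))| <= lorentz T c.
Proof.
move=> T0; apply: min_lorentz => //.
  apply: tau_cos_abs_le => //; last by move=> t; exact: cos_max.
  by apply: continuous_measurable_fun; exact: continuous_cosZ.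
move=> c0; rewrite tau_cosE//.
apply: le_trans (ler_normD _ _) _; rewrite normrN !normrM.
have c2 : 0 < c ^+ 2 by rewrite exprn_even_gt0.
have cT : 0 < T * c ^+ 2 by rewrite mulr_gt0.
have h1 : `|4 / (T * c ^+ 2)| * `|cos (c * T)| <= 4 / (T * c ^+ 2).
  rewrite ger0_norm ?divr_ge0 ?(ltW cT)// -[leRHS]mulr1 ler_wpM2l ?cos_max//.
  by rewrite divr_ge0 ?(ltW cT).
(* The bound |sin (c T)| <= |c T| trades one power of c for one of T, so the c^-3 term has the size
   of the other one; together they give 4 + 4 = 8. *)
have h2 : `|4 : R| * `|(T ^+ 2 * c ^+ 3)^-1| * `|sin (c * T)| <= 4 / (T * c ^+ 2).
  apply: (@le_trans _ _ (`|4 : R| * `|(T ^+ 2 * c ^+ 3)^-1| * `|c * T|)).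
    by rewrite ler_wpM2l ?mulr_ge0//; exact: abs_sin_le.
  rewrite -!normrM.
  rewrite (_ : 4 / _ * _ = 4 / (T * c ^+ 2)); last first.
    by field; rewrite c0 gt_eqF.
  by rewrite ger0_norm ?divr_ge0 ?(ltW cT).
have -> : 8 / (T * c ^+ 2) = 4 / (T * c ^+ 2) + 4 / (T * c ^+ 2) by field; rewrite c0 gt_eqF.
by rewrite -!normrM in h1 h2 *; exact: lerD.
Qed.

(** The integrand is odd. Instead of a reflection, the proof exhibits an even primitive, which takes
    equal values at -T and T; it divides by c, so c = 0 is treated apart. *)
Lemma tau_sin0 T c : 0 < T ->
  Rintegral leb setT (fun t => tau T t * sin (c * t)) = 0.
Proof.
move=> T0; rewrite tau_integral_itv// /Rintegral.
have [->|c0] := eqVneq c 0.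
  under eq_integral do rewrite mul0r sin0 mulr0.
  by rewrite integral0.
pose F (t : R) := - ((c^-1 + (- (c^-1 / T ^+ 2)) * t ^+ 2) * cos (c * t) +
   (- ((0 + (- (2 / (T ^+ 2 * c ^+ 2))) * t) * sin (c * t)) + (2 / (T ^+ 2 * c ^+ 3)) * cos (c * t))).
have Tn0 : T != 0 by rewrite gt_eqF.
have TT : - T <= T by rewrite -subr_ge0 opprK addr_ge0// ltW.
have cf : continuous (fun t : R => (1 - (t / T) ^+ 2) * sin (c * t)).
  by move=> t; apply: cvgM; [exact: continuous_quad|exact: continuous_sinZ].
suff dF (t : R) : is_derive t 1 F ((1 - (t / T) ^+ 2) * sin (c * t)).
  rewrite (ftc_itv TT cf dF)/= /F mulrN cosN sinN; field.
  by rewrite Tn0 c0.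
have d1 := is_deriveMr (is_derive_sqrD c^-1 (- (c^-1 / T ^+ 2)) t) (is_derive_cosZ c t).
have dl : is_derive t 1 (fun u : R => 0 + (- (2 / (T ^+ 2 * c ^+ 2))) * u) (- (2 / (T ^+ 2 * c ^+ 2))).
  by apply: is_derive_eq; rewrite /GRing.scale/=; ring.
have d2 := is_deriveN (is_deriveMr dl (is_derive_sinZ c t)).
have d3 := is_deriveZ (2 / (T ^+ 2 * c ^+ 3)) (is_derive_cosZ c t).
apply: is_derive_eq (is_deriveN (is_deriveDr d1 (is_deriveDr d2 d3))) _.
rewrite /GRing.scale/=; field.
by rewrite Tn0 c0.
Qed.

(** The one-variable weight [<y>^(-2s)] on a bounded interval. A sharp cutoff is harmless here: only
    the integral of this function will matter, never the decay of its transform. *)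
Definition bracket_cut (s T y : R) : R := (1 + y ^+ 2) `^ (- s) * \1_(`[- T, T]%classic) y.

Lemma bracket_cut_ge0 s T y : 0 <= bracket_cut s T y.
Proof. by rewrite mulr_ge0// powR_ge0. Qed.

Lemma measurable_bracket_cut s T : measurable_fun setT (bracket_cut s T).
Proof.
apply: measurable_funM; last exact: measurable_indic.
apply: (measurableT_comp (measurable_powR _)).
by apply: measurable_funD => //; exact: measurable_funX.
Qed.

Lemma is_derive_powRD (c b y : R) : 0 < c + y ->
  is_derive y 1 (fun u => (c + u) `^ b) (b * (c + y) `^ (b - 1)).
Proof.
move=> y0.
have cy : c + y \in `]0, +oo[ by rewrite in_itv/= y0.
have d : is_derive (c + y) 1 ((@powR R) ^~ b) (b * (c + y) `^ (b - 1)).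
  split; first exact: derivable_powR.
  by rewrite -derive1E powR_derive1.
have h : is_derive y 1 (fun u : R => c + u) (1 : R)
  by rewrite -[X in is_derive _ _ _ X]add0r; apply: is_deriveDr.
by apply: is_derive_eq (is_derive1_comp d h) _; rewrite mulr1.
Qed.

(** Comes from (1 + y)^2 <= 2 (1 + y^2). The right-hand side has an elementary primitive, the
    left-hand side has none for general s. *)
Lemma powR_sqr_le (s y : R) : 0 < s -> 0 <= y ->
  (1 + y ^+ 2) `^ (- s) <= 2 `^ s * (1 + y) `^ (- (2 * s)).
Proof.
move=> s0 y0.
have h1 : 0 < 1 + y ^+ 2 by rewrite ltr_pwDl// sqr_ge0.
have h2 : 0 < 1 + y by rewrite ltr_pwDl.
rewrite !powRN ler_pdivlMr ?powR_gt0// mulrC ler_pdivrMr ?powR_gt0//.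
rewrite -powRM ?(ltW h1)// powRrM powR_mulrn ?(ltW h2)//.
apply: ge0_ler_powR; rewrite ?nnegrE ?exprn_ge0 ?mulr_ge0 ?(ltW s0) ?(ltW h1) ?(ltW h2)//.
by have := sqr_ge0 (1 - y); nra.
Qed.

(** The condition on s enters here: the primitive, a negative multiple of (1 + y)^(1 - 2s), stays
    bounded as y grows, and minus its value at 0 bounds the integral for every T. *)
Lemma bracket_cut_integral_half s (T : R) : 1 / 2 < s -> 0 < T ->
  (\int[leb]_(y in `[0%R, T]) ((1 + y ^+ 2) `^ (- s))%:E <= (2 `^ s / (2 * s - 1))%:E)%E.
Proof.
move=> s12 T0.
have s0 : 0 < s by lra.
have s21 : 0 < 2 * s - 1 by lra.
have m1 : measurable_fun setT (fun y : R => (1 + y ^+ 2) `^ (- s)).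
  apply: (measurableT_comp (measurable_powR _)).
  by apply: measurable_funD => //; exact: measurable_funX.
have m2 : measurable_fun setT (fun y : R => 2 `^ s * (1 + y) `^ (- (2 * s))).
  apply: measurable_funM => //; apply: (measurableT_comp (measurable_powR _)).
  exact: measurable_funD.
apply: (@le_trans _ _ (\int[leb]_(y in `[0%R, T]) (2 `^ s * (1 + y) `^ (- (2 * s)))%:E)%E).
  apply: ge0_le_integral => //=.
  - by move=> y _; rewrite lee_fin powR_ge0.
  - by apply/measurable_EFinP; apply: measurable_funTS.
  - by apply/measurable_EFinP; apply: measurable_funTS.
  - by move=> y; rewrite in_itv/= => /andP[y0 _]; rewrite lee_fin powR_sqr_le.
have dp (b y : R) : y \in `[0%R, T] -> is_derive y 1 (fun u => (1 + u) `^ b) (b * (1 + y) `^ (b - 1)).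
  rewrite in_itv/= => /andP[y0 _]; apply: is_derive_powRD.
  by rewrite ltr_pwDl.
pose F (y : R) := - (2 `^ s / (2 * s - 1)) * (1 + y) `^ (1 - 2 * s).
have dF (y : R) : y \in `[0%R, T] -> is_derive y 1 F (2 `^ s * (1 + y) `^ (- (2 * s))).
  move=> yT; apply: is_derive_eq (is_deriveZ (- (2 `^ s / (2 * s - 1))) (dp (1 - 2 * s) y yT)) _.
  rewrite /GRing.scale/= (_ : 1 - 2 * s - 1 = - (2 * s)); last by ring.
  by field; rewrite gt_eqF.
rewrite (ftc_in_itv (ltW T0) _ dF).
  rewrite lee_fin /F addr0 powR1 mulr1 mulNr opprK addrC gerBl.
  by rewrite mulr_ge0 ?powR_ge0// divr_ge0 ?powR_ge0// ltW.
move=> y yT; apply: differentiable_continuous; apply/derivable1_diffP.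
by apply: derivableZ; have := dp (- (2 * s)) y yT => -[].
Qed.

Lemma bracket_cut_integral s (T : R) : 1 / 2 < s -> 0 < T ->
  (\int[leb]_y (bracket_cut s T y)%:E <= (2 * (2 `^ s / (2 * s - 1)))%:E)%E.
Proof.
move=> s12 T0.
have m1 : measurable_fun setT (fun y : R => (1 + y ^+ 2) `^ (- s)).
  apply: (measurableT_comp (measurable_powR _)).
  by apply: measurable_funD => //; exact: measurable_funX.
have -> : (\int[leb]_y (bracket_cut s T y)%:E = \int[leb]_(y in `[(- T)%R, T]) ((1 + y ^+ 2) `^ (- s))%:E)%E.
  rewrite [RHS]integral_mkcond; apply: eq_integral => y _.
  rewrite patchE /bracket_cut indicE; case: (y \in _) => /=; first by rewrite mulr1.
  by rewrite mulr0.
have -> : `[(- T)%R, T]%classic = `[(- T)%R, 0]%classic `|` `]0%R, T]%classic.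
  by rewrite -itv_bndbnd_setU// bnd_simp ?oppr_le0 ltW.
rewrite ge0_integral_setU//=; last 3 first.
- by apply/measurable_EFinP; apply: measurable_funTS.
- by move=> y _; rewrite lee_fin powR_ge0.
- apply/disj_setPS => y [/=]; rewrite !in_itv/= => /andP[_ y0] /andP[].
  by rewrite ltNge y0.
rewrite integral_itv_obnd_cbnd; last by apply/measurable_EFinP; apply: measurable_funTS.
have := @integration_by_substitution_oppr R (fun y => (1 + y ^+ 2) `^ (- s)) 0 T (ltW T0).
rewrite oppr0 => ->.
  under eq_integral do rewrite /= sqrrN.
  by rewrite mulr2n mulrDl !mul1r EFinD; apply: leeD; exact: bracket_cut_integral_half.
apply: continuous_subspaceT => y.
have h1 : 0 < 1 + y ^+ 2 by rewrite ltr_pwDl// sqr_ge0.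
apply: (@continuous_comp _ _ _ (fun y : R => 1 + y ^+ 2) ((@powR R) ^~ (- s))).
  by apply: cvgD; [exact: cvg_cst|exact: exprn_continuous].
apply: differentiable_continuous; apply/derivable1_diffP; apply: derivable_powR.
by rewrite in_itv/= h1.
Qed.

(** The substitution u = p(x) in primitive form. The arctangent ranges over an interval of length pi
    < 4, so 10 * 4 = 40 serves for all T, A and all endpoints. Both signs are needed since p may
    increase or decrease. *)
Lemma lorentz_poly_FTC (p : {poly R}) (T A a b : R) : 0 < T -> a <= b ->
  (\int[leb]_(x in `[a, b]) (p^`().[x] * lorentz T (A - p.[x]))%:E <= 40%:E)%E /\
  (\int[leb]_(x in `[a, b]) (- p^`().[x] * lorentz T (A - p.[x]))%:E <= 40%:E)%E.
Proof.
move=> T0 ab.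
pose F (x : R) := 10 * atan (T * (p.[x] - A)).
have osc x y : F x - F y <= 40.
  rewrite /F -mulrBr (_ : 40 = 10 * 4)//; last by ring.
  rewrite ler_wpM2l//.
  have := atan_ltpi2 (T * (p.[x] - A)); have := atan_gtNpi2 (T * (p.[y] - A)).
  by have := @pihalf_lt2 R; lra.
have dF (x : R) : is_derive x 1 F (p^`().[x] * lorentz T (A - p.[x])).
  have dp : is_derive x 1 (fun x => p.[x] - A) (p^`().[x]).
    by rewrite -[X in is_derive _ _ _ X]addr0; apply: is_deriveDr.
  have d := @is_derive1_comp R atan (fun x => T * (p.[x] - A)) x _ _ (is_derive1_atan _) (is_deriveZ T dp).
  apply: is_derive_eq (is_deriveZ 10 d) _.
  rewrite /GRing.scale/= -(lorentzN _ (_ - _)) opprB /lorentz; field.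
  by rewrite gt_eqF// ltr_pwDl// sqr_ge0.
have cl : continuous (fun x => lorentz T (A - p.[x])).
  move=> x; apply: cvgM; first exact: cvg_cst.
  apply: cvgV.
    by rewrite gt_eqF// ltr_pwDl// sqr_ge0.
  apply: cvgD; first exact: cvg_cst.
  apply: (@continuous_comp _ _ _ (fun x : R => T * (A - p.[x])) (fun t : R => t ^+ 2)); last exact: exprn_continuous.
  apply: cvgM; first exact: cvg_cst.
  by apply: cvgB; [exact: cvg_cst|exact: continuous_horner].
split.
  rewrite (ftc_itv ab _ dF) ?lee_fin//.
  by move=> x; apply: cvgM; [exact: continuous_horner|exact: cl].
have dNF (x : R) : is_derive x 1 (fun x => - F x) (- p^`().[x] * lorentz T (A - p.[x])).
  by rewrite mulNr; exact: is_deriveN.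
rewrite (ftc_itv ab _ dNF).
  by rewrite lee_fin opprK addrC osc.
by move=> x; apply: cvgM; [apply: cvgN; exact: continuous_horner|exact: cl].
Qed.

Lemma measurable_lorentz T : measurable_fun setT (lorentz T).
Proof.
apply: continuous_measurable_fun => x; apply: cvgM; first exact: cvg_cst.
apply: cvgV.
  by rewrite gt_eqF// ltr_pwDl// sqr_ge0.
apply: cvgD; first exact: cvg_cst.
apply: (@continuous_comp _ _ _ (fun x : R => T * x) (fun t : R => t ^+ 2)); last exact: exprn_continuous.
exact: mulrl_continuous.
Qed.

(* Splitting at the roots of p' leaves intervals of monotonicity, on which
   10 atan (T (p - A)) is, up to sign, a primitive of the integrand. *)
Lemma lorentz_poly_split (p : {poly R}) (T A : R) (s : seq R) : 0 < T ->
  forall a b : R, a <= b ->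
  (forall x, x \in `]a, b[ -> root p^`() x -> x \in s) ->
  (\int[leb]_(x in `[a, b]) (`|p^`().[x]| * lorentz T (A - p.[x]))%:E <= (40 * 2 ^+ size s)%:E)%E.
Proof.
move=> T0; elim: s => [|c s IH] a b ab roots.
  (* Without roots of p' inside the open interval, the intermediate value theorem excludes two
     values of strictly opposite signs, endpoints included. *)
  have sgn x y : x \in `[a, b] -> y \in `[a, b] -> 0 <= p^`().[x] * p^`().[y].
    move=> xab yab; rewrite leNgt; apply/negP => xy0.
    wlog xy : x y xab yab xy0 / x <= y.
      move=> h; have [|/ltW] := leP x y; first exact: h.
      by apply: h => //; rewrite mulrC.
    have [z zxy rz] := poly_ivtoo xy xy0.
    have : z \in `]a, b[.
      move: zxy xab yab; rewrite !in_itv/= => /andP[xz zy] /andP[ax _] /andP[_ yb].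
      by rewrite (le_lt_trans ax)//= (lt_le_trans zy).
    by move=> /roots/(_ rz).
  rewrite expr0 mulr1.
  have [pos|[z zab zpos]] : (forall x, x \in `[a, b] -> 0 <= - p^`().[x]) \/
      exists2 z, z \in `[a, b] & 0 < p^`().[z].
    have [h|/forallNP h] := pselect (exists z, z \in `[a, b] /\ 0 < p^`().[z]).
      by right; have [z [z1 z2]] := h; exists z.
    left => x xab; rewrite oppr_ge0 leNgt; apply/negP => px.
    by apply: (h x); split.
  - rewrite (_ : integral _ _ _ = \int[leb]_(x in `[a, b]) (- p^`().[x] * lorentz T (A - p.[x]))%:E)%E.
      by have [] := lorentz_poly_FTC p A T0 ab.
    apply: eq_integral => x; rewrite inE/= => xab.
    by rewrite -normrN ger0_norm// pos.
  - rewrite (_ : integral _ _ _ = \int[leb]_(x in `[a, b]) (p^`().[x] * lorentz T (A - p.[x]))%:E)%E.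
      by have [] := lorentz_poly_FTC p A T0 ab.
    apply: eq_integral => x; rewrite inE/= => xab.
    by rewrite ger0_norm//; have := sgn _ _ xab zab; rewrite pmulr_lge0.
rewrite /= exprS.
have pow1 : 40 * 2 ^+ size s <= 40 * (2 * 2 ^+ size s) :> R.
  by rewrite ler_wpM2l// mulr_natl mulr2n lerDl exprn_ge0.
have [cab|ncab] := boolP (c \in `]a, b[); last first.
  apply: (le_trans (IH a b ab _)); last by rewrite lee_fin.
  move=> x xab rx; have := roots x xab rx; rewrite inE => /predU1P[xc|//].
  by rewrite xc (negbTE ncab) in xab.
move: (cab); rewrite in_itv/= => /andP[ac cb].
have mf : measurable_fun setT (fun x => (`|p^`().[x]| * lorentz T (A - p.[x]))%:E).
  apply/measurable_EFinP; apply: measurable_funM.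
    by apply: measurableT_comp => //; apply: continuous_measurable_fun; exact: continuous_horner.
  apply: (measurableT_comp (measurable_lorentz T)); apply: measurable_funB => //.
  by apply: continuous_measurable_fun; exact: continuous_horner.
have -> : `[a, b]%classic = `[a, c]%classic `|` `]c, b]%classic.
  by rewrite -itv_bndbnd_setU// bnd_simp ltW.
rewrite ge0_integral_setU//=; last 3 first.
- exact: measurable_funTS.
- by move=> y _; rewrite lee_fin mulr_ge0// lorentz_ge0// ltW.
- apply/disj_setPS => y [/=]; rewrite !in_itv/= => /andP[_ y0] /andP[].
  by rewrite ltNge y0.
rewrite integral_itv_obnd_cbnd; last exact: measurable_funTS.
(* Each half is given the whole bound for the remaining list of roots, so every root doubles the
   constant. *)
rewrite (mulr_natl _ 2) mulr2n mulrDr EFinD.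
apply: leeD; apply: IH; rewrite ?(ltW ac) ?(ltW cb)//.
- move=> x xac rx.
  have xab : x \in `]a, b[.
    by move: xac; rewrite !in_itv/= => /andP[-> xc]; rewrite (lt_trans xc).
  have := roots x xab rx; rewrite inE => /predU1P[xc|//].
  by move: xac; rewrite xc in_itv/= ltxx andbF.
- move=> x xcb rx.
  have xab : x \in `]a, b[.
    by move: xcb; rewrite !in_itv/= => /andP[xc ->]; rewrite (lt_trans ac).
  have := roots x xab rx; rewrite inE => /predU1P[xc|//].
  by move: xcb; rewrite xc in_itv/= ltxx.
Qed.

(** A polynomial need not split over the reals: linear factors are removed as long as a root exists,
    and the last cofactor contributes none. *)
Lemma all_roots_seq (q : {poly R}) d : q != 0 -> (size q <= d.+1)%N ->
  exists2 s : seq R, (size s <= d)%N & forall x, root q x -> x \in s.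
Proof.
elim: d q => [|d IH] q q0 sq.
  exists [::] => // x; have /size_poly1P[c c0 ->] : size q == 1%N.
    by rewrite eqn_leq sq size_poly_gt0.
  by rewrite rootC (negbTE c0).
have [h|/forallNP h] := pselect (exists x, root q x); last first.
  by exists [::] => // x rx; case: (h x rx).
have [c rc] := h; have /factor_theorem[r qE] := rc.
have r0 : r != 0 by apply: contraNneq q0 => r0; rewrite qE r0 mul0r.
have [|s ss sr] := IH r r0.
  by move: sq; rewrite qE size_Mmonic ?monicXsubC// size_XsubC addn2.
exists (c :: s) => // x; rewrite qE rootM root_XsubC inE.
by case/orP => [/sr ->|->]; rewrite ?orbT.
Qed.

(** The bound sees only the degree, not the coefficients of p. Slices of a in direction j have
    coefficients that depend on the other coordinates, so this uniformity is what lets those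
    coordinates be integrated afterwards. *)
Lemma lorentz_poly_le (p : {poly R}) (T A M : R) d : 0 < T -> (size p <= d.+1)%N ->
  (\int[leb]_(x in `[(- M)%R, M]) (`|p^`().[x]| * lorentz T (A - p.[x]))%:E <= (40 * 2 ^+ d)%:E)%E.
Proof.
move=> T0 sp.
have [M0|M0] := ltP M (- M).
  by rewrite set_itv_ge ?bnd_simp -?ltNge// integral_set0 lee_fin mulr_ge0// exprn_ge0.
(* If p is constant, every point is a root of p' and no finite list exists, but the integrand
   vanishes. *)
have [p'0|p'0] := eqVneq p^`() 0.
  under eq_integral do rewrite p'0 horner0 normr0 mul0r.
  by rewrite integral0 lee_fin mulr_ge0// exprn_ge0.
have [|s ss sr] := @all_roots_seq p^`() d p'0.
  by rewrite polyorder.size_deriv (leq_trans (leq_pred _)).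
apply: (le_trans (@lorentz_poly_split p T A s T0 _ _ M0 _)).
  by move=> x _; exact: sr.
by rewrite lee_fin ler_wpM2l// ler_weXn2l// ler1n.
Qed.

End calculus.

(** * Lebesgue measure on R^n *)

(** The theorem quantifies over a plain measure, while Fubini and Tonelli expect one carrying the
    sigma-finite structure. This repackages a measure without changing its values. *)
Lemma sigma_finite_measureP d (T : measurableType d) (R : realType) (m : {measure set T -> \bar R}) :
  sigma_finite setT m -> exists nu : {sigma_finite_measure set T -> \bar R},
    forall A, (nu : {measure set T -> \bar R}) A = m A.
Proof.
move=> sfm.
pose H2 := isSFinite.Build _ _ _ _ (sfinite_measure_sigma_finite sfm).
pose H3 := isSigmaFinite.Build _ _ _ _ sfm.
pose nu := HB.pack_for (SigmaFiniteMeasure.type T R) (Measure.sort m) H2 H3.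
by exists nu.
Qed.

Lemma sigma_finite_product d1 d2 (T1 : measurableType d1) (T2 : measurableType d2) (R : realType)
    (m1 : {sigma_finite_measure set T1 -> \bar R}) (m2 : {sigma_finite_measure set T2 -> \bar R}) :
  sigma_finite setT (m1 \x m2)%E.
Proof.
have /sigma_finiteP[F [TF ndF Foo]] := sigma_finiteT m1.
have /sigma_finiteP[G [TG ndG Goo]] := sigma_finiteT m2.
exists (fun k => F k `*` G k) => [|k]; last first.
  have [mF Fk] := Foo k; have [mG Gk] := Goo k; split; first exact: measurableX.
  by rewrite product_measure1E// lte_mul_pinfty// ge0_fin_numE.
apply/seteqP; split => // -[x y] _.
have [i _ Fx] : (\bigcup_i F i) x by rewrite -TF.
have [l _ Gy] : (\bigcup_i G i) y by rewrite -TG.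
exists (maxn i l) => //; split => /=.
  exact: (subsetPset _ _ (ndF _ _ (leq_maxl i l))).
exact: (subsetPset _ _ (ndG _ _ (leq_maxr i l))).
Qed.

Section boxes.
Variable R : realType.
Notation leb := (@lebesgue_measure R).

Definition boxRn n (a b : Rn R n) : set (Rn R n) :=
  [set x | forall i, coord a i <= coord x i <= coord b i].

Lemma measurable_coord n (i : 'I_n) : measurable_fun setT (fun x : Rn R n => coord x i).
Proof. exact: measurable_tnth. Qed.

Lemma measurable_boxRn n (a b : Rn R n) : measurable (boxRn a b).
Proof.
rewrite (_ : boxRn a b = \bigcap_(i in [set: 'I_n]) ((fun x => coord x i) @^-1` `[coord a i, coord b i])).
  apply: fin_bigcap_measurable; first exact: finite_finset.
  move=> i _; rewrite -[X in measurable X]setTI; apply: measurable_coord => //.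
apply/seteqP; split => [x xab i _ /=|x xab i]; first by rewrite in_itv/=; exact: xab.
by have := xab i I; rewrite /= in_itv.
Qed.

Definition boxes n : set (set (Rn R n)) := [set A | exists a b, A = boxRn a b].

Lemma setI_closed_boxes n : setI_closed (@boxes n).
Proof.
move=> _ _ [a [b ->]] [c [d ->]].
exists [tuple Num.max (coord a i) (coord c i) | i < n],
  [tuple Num.min (coord b i) (coord d i) | i < n].
apply/seteqP; split => [x [/= xab xcd] i|x xi].
  rewrite /coord !tnth_mktuple ge_max le_min.
  by have /andP[-> ->] := xab i; have /andP[-> ->] := xcd i.
split => i; have := xi i; rewrite /coord !tnth_mktuple ge_max le_min.
  by move=> /andP[/andP[-> _] /andP[-> _]].
by move=> /andP[/andP[_ ->] /andP[_ ->]].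
Qed.

Definition cubeRn n (k : R) : set (Rn R n) := boxRn [tuple - k | _ < n] [tuple k | _ < n].

Lemma cubeRnE n (k : R) (x : Rn R n) : cubeRn k x <-> forall i, `|coord x i| <= k.
Proof.
by split => [h i|h i]; have := h i; rewrite /coord !tnth_mktuple ler_norml.
Qed.

Lemma nat_gt_coords n (x : Rn R n) : exists k : nat, forall i, `|coord x i| <= k%:R.
Proof.
exists (\max_(i < n) (Num.truncn `|coord x i|).+1)%N => i.
apply: (@le_trans _ _ (Num.truncn `|coord x i|).+1%:R); first exact/ltW/truncnS_gt.
rewrite ler_nat; exact: (@leq_bigmax _ (fun i : 'I_n => (Num.truncn `|coord x i|).+1)).
Qed.

Lemma bigcup_cubeRn n : \bigcup_k @cubeRn n k%:R = setT.
Proof.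
apply/seteqP; split => // x _; have [k hk] := nat_gt_coords x.
by exists k => //; apply/cubeRnE.
Qed.

(** The preimage of [[a, +oo[] under a coordinate is a countable union of boxes, with side
    [a, a + k] in that direction and [-k, k] in the others; these preimages generate the product
    sigma-algebra. *)
Lemma measurable_boxesE n : @measurable _ (Rn R n) = <<s @boxes n >>.
Proof.
apply/seteqP; split; last first.
  apply: smallest_sub; first exact: sigma_algebra_measurable.
  by move=> _ [a [b ->]]; exact: measurable_boxRn.
have mid : measurable_fun [set: g_sigma_algebraType (@boxes n)] (fun x : g_sigma_algebraType (@boxes n) => x : Rn R n).
  apply/measurable_fun_tnthP => i.
  apply: (measurability _ (RGenCInfty.measurableE R)) => _ [_ [a ->] <-].
  rewrite setTI.
  rewrite (_ : _ @^-1` _ = \bigcup_k (boxRn [tuple (if j == i then a else - k%:R) | j < n]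
     [tuple (if j == i then a + k%:R else k%:R) | j < n])); last first.
    apply/seteqP; split => [x|x [k _] /(_ i)] /=; rewrite in_itv/= andbT.
      move=> ax; have [k1 hk1] := nat_gt_coords x.
      pose k := maxn k1 (Num.truncn (tnth x i - a)).+1.
      exists k => // j; rewrite /coord !tnth_mktuple; case: eqP => [->|_].
        rewrite ax/= addrC -lerBlDr (le_trans (ltW (truncnS_gt _)))//.
        by rewrite ler_nat leq_maxr.
      by rewrite -ler_norml (le_trans (hk1 j))// ler_nat leq_maxl.
    by rewrite /coord !tnth_mktuple eqxx => /andP[].
  apply: bigcupT_measurable => k; apply: sub_sigma_algebra.
  by eexists; eexists.
by move=> A mA; have := mid measurableT A mA; rewrite setTI.
Qed.

(** [is_lebesgue_Rn] only speaks of boxes with ordered endpoints. Intersections of boxes can be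
    empty, and the maximum with 0 covers that case. *)
Lemma lebesgue_boxRn n (mu : {measure set (Rn R n) -> \bar R}) (a b : Rn R n) :
  is_lebesgue_Rn mu ->
  mu (boxRn a b) = (\prod_(i < n) Num.max 0 (coord b i - coord a i))%:E.
Proof.
move=> muL; have [ab|/existsNP[i /negP]] := pselect (forall i, coord a i <= coord b i).
  rewrite muL//; congr EFin; apply: eq_bigr => i _.
  by apply/esym/max_idPr; rewrite subr_ge0.
rewrite -ltNge => ba.
rewrite (bigD1 i)//= (_ : Num.max _ _ = 0) ?mul0r; last first.
  by apply/max_idPl; rewrite subr_le0 ltW.
rewrite (_ : boxRn a b = set0) ?measure0//.
apply/seteqP; split => // x /(_ i) /andP[h1 h2].
by move: ba; rewrite ltNge (le_trans h1 h2).
Qed.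

Lemma cubeRn_lty n (mu : {measure set (Rn R n) -> \bar R}) k : is_lebesgue_Rn mu ->
  (mu (cubeRn k) < +oo)%E.
Proof. by move=> muL; rewrite lebesgue_boxRn// ltry. Qed.

(** Boxes are stable under intersection and cubes exhaust the space with finite measure. Uniqueness
    lets any Lebesgue measure be exchanged for a pushforward of a product measure, where one
    coordinate can be integrated at a time. *)
Lemma lebesgue_Rn_unique n (mu nu : {measure set (Rn R n) -> \bar R}) :
  is_lebesgue_Rn mu -> is_lebesgue_Rn nu ->
  forall A, measurable A -> mu A = nu A.
Proof.
move=> muL nuL; apply: (measure_unique (@boxes n) (fun k => cubeRn k%:R)).
- exact: measurable_boxesE.
- exact: setI_closed_boxes.
- by move=> k; eexists; eexists.
- exact: bigcup_cubeRn.
- by move=> _ [a [b ->]]; rewrite !lebesgue_boxRn.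
- by move=> k; exact: cubeRn_lty.
Qed.

Lemma lebesgue_Rn_sigma_finite n (mu : {measure set (Rn R n) -> \bar R}) :
  is_lebesgue_Rn mu -> sigma_finite setT mu.
Proof.
move=> muL; exists (fun k => cubeRn k%:R); first by rewrite bigcup_cubeRn.
by move=> k; split; [exact: measurable_boxRn|exact: cubeRn_lty].
Qed.

Definition consRn n (p : measurableTypeR R * Rn R n) : Rn R n.+1 := [tuple of p.1 :: p.2].

Lemma measurable_consRn n : measurable_fun setT (@consRn n).
Proof.
apply: (@measurable_cons _ _ _ R); first exact: measurable_fst.
exact: measurable_snd.
Qed.

Lemma coord_consRn0 n p : coord (@consRn n p) ord0 = p.1.
Proof. by rewrite /coord tnth0. Qed.

Lemma coord_consRnS n p i : coord (@consRn n p) (lift ord0 i) = coord p.2 i.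
Proof. by rewrite /coord tnthS. Qed.

Definition lebesgue_cons n (nu : {sigma_finite_measure set (Rn R n) -> \bar R}) :
  {measure set (Rn R n.+1) -> \bar R}.
Proof. refine (pushforward (leb \x nu)%E (@consRn n)); exact: measurable_consRn. Defined.

Lemma lebesgue_consP n (nu : {sigma_finite_measure set (Rn R n) -> \bar R}) :
  is_lebesgue_Rn nu -> is_lebesgue_Rn (lebesgue_cons nu).
Proof.
move=> nuL a b ab; rewrite /= /lebesgue_cons /pushforward.
pose a' : Rn R n := [tuple coord a (lift ord0 i) | i < n].
pose b' : Rn R n := [tuple coord b (lift ord0 i) | i < n].
rewrite (_ : _ @^-1` _ = `[coord a ord0, coord b ord0] `*` boxRn a' b').
  rewrite product_measure1E//=; last exact: measurable_boxRn.
  rewrite lebesgue_measure_itv/= nuL; last first.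
    by move=> i; rewrite /coord !tnth_mktuple; exact: ab.
  rewrite big_ord_recl EFinM; congr (_ * _)%E; last first.
    by congr EFin; apply: eq_bigr => i _; rewrite /coord !tnth_mktuple.
  rewrite lte_fin EFinB; case: ltP => // ba.
  have := ab ord0 => ab0; rewrite (_ : coord a ord0 = coord b ord0) ?subee//.
  by apply/le_anti; rewrite ba ab0.
apply/seteqP; split => [[x y] /= h|[x y] /= [h1 h2] i].
  split; first by have := h ord0; rewrite coord_consRn0/= in_itv.
  by move=> i; have := h (lift ord0 i); rewrite coord_consRnS/= /coord !tnth_mktuple.
have [j ->|->] := unliftP ord0 i.
  by rewrite coord_consRnS; have := h2 j; rewrite /coord !tnth_mktuple.
by rewrite coord_consRn0/=; move: h1; rewrite in_itv.
Qed.

Lemma sigma_finite_lebesgue_exists n :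
  exists2 nu : {sigma_finite_measure set (Rn R n) -> \bar R}, True & is_lebesgue_Rn nu.
Proof.
elim: n => [|n [nu _ nuL]].
  (* In dimension 0 the only box is the whole one-point space, and the empty product gives it mass
     1. *)
  exists (dirac ([tuple] : Rn R 0)) => // a b _.
  by rewrite big_ord0 /= diracE mem_set// => -[].
have [nu' nuE] := sigma_finite_measureP (lebesgue_Rn_sigma_finite (lebesgue_consP nuL)).
by exists nu' => // a b ab; apply: etrans (nuE _) _; exact: lebesgue_consP.
Qed.

Lemma ge0_integral_consRn n (mu : {measure set (Rn R n.+1) -> \bar R})
    (nu : {sigma_finite_measure set (Rn R n) -> \bar R}) (f : Rn R n.+1 -> \bar R) :
  is_lebesgue_Rn mu -> is_lebesgue_Rn nu ->
  measurable_fun setT f -> (forall x, (0 <= f x)%E) ->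
  (\int[mu]_x f x = \int[leb]_t \int[nu]_y f (consRn (t, y)))%E.
Proof.
move=> muL nuL mf f0.
rewrite (eq_measure_integral (lebesgue_cons nu)); last first.
  move=> A mA _; apply: lebesgue_Rn_unique => //; exact: lebesgue_consP.
rewrite (ge0_integral_pushforward (@measurable_consRn n))//.
rewrite preimage_setT fubini_tonelli1//; last by move=> x; exact: f0.
by apply: measurableT_comp => //; exact: measurable_consRn.
Qed.

(** The other order of integration, with the first coordinate innermost. It serves when that
    coordinate is the distinguished one and has to be integrated before the rest. *)
Lemma ge0_integral_consRn2 n (mu : {measure set (Rn R n.+1) -> \bar R})
    (nu : {sigma_finite_measure set (Rn R n) -> \bar R}) (f : Rn R n.+1 -> \bar R) :
  is_lebesgue_Rn mu -> is_lebesgue_Rn nu ->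
  measurable_fun setT f -> (forall x, (0 <= f x)%E) ->
  (\int[mu]_x f x = \int[nu]_y \int[leb]_t f (consRn (t, y)))%E.
Proof.
move=> muL nuL mf f0; rewrite (ge0_integral_consRn muL nuL)//.
apply: (fubini_tonelli (f \o @consRn n)) => //=.
by apply: measurableT_comp => //; exact: measurable_consRn.
Qed.

Lemma integrable_consRn n (mu : {measure set (Rn R n.+1) -> \bar R})
    (nu : {sigma_finite_measure set (Rn R n) -> \bar R}) (f : Rn R n.+1 -> \bar R) :
  is_lebesgue_Rn mu -> is_lebesgue_Rn nu ->
  measurable_fun setT f -> (leb \x nu)%E.-integrable setT (f \o @consRn n) ->
  mu.-integrable setT f /\ (\int[mu]_x f x = \int[leb \x nu]_p f (consRn p))%E.
Proof.
move=> muL nuL mf intf; split.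
  apply/integrableP; split => //.
  rewrite (ge0_integral_consRn muL nuL)//; last exact: measurableT_comp.
  have /integrable12ltyP : (leb \x nu)%E.-integrable setT (f \o @consRn n) by [].
  by apply; apply: measurableT_comp => //; exact: measurable_consRn.
rewrite (eq_measure_integral (lebesgue_cons nu)); last first.
  move=> A mA _; apply: lebesgue_Rn_unique => //; exact: lebesgue_consP.
by rewrite (integral_pushforward (@measurable_consRn n))// preimage_setT.
Qed.

End boxes.

(** * Oscillatory integrals over products *)

Section product_integrals.
Context d1 d2 (T1 : measurableType d1) (T2 : measurableType d2) (R : realType).
Variables (m1 : {sigma_finite_measure set T1 -> \bar R})
  (m2 : {sigma_finite_measure set T2 -> \bar R}).

Lemma measurable_fun_fst_comp d3 (T3 : measurableType d3) (f : T1 -> T3) :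
  measurable_fun setT f -> measurable_fun [set: T1 * T2] (fun p => f p.1).
Proof. by move=> mf; apply: measurableT_comp. Qed.

Lemma measurable_fun_snd_comp d3 (T3 : measurableType d3) (f : T2 -> T3) :
  measurable_fun setT f -> measurable_fun [set: T1 * T2] (fun p => f p.2).
Proof. by move=> mf; apply: measurableT_comp. Qed.

Lemma integrable_prod_mul (u : T1 -> R) (v : T2 -> R) :
  m1.-integrable setT (EFin \o u) -> m2.-integrable setT (EFin \o v) ->
  (m1 \x m2)%E.-integrable setT (EFin \o (fun p => u p.1 * v p.2)).
Proof.
move=> iu iv.
have mu : measurable_fun setT u by apply/measurable_EFinP; exact: measurable_int iu.
have mv : measurable_fun setT v by apply/measurable_EFinP; exact: measurable_int iv.
apply/integrable12ltyP.
  apply/measurable_EFinP; apply: measurable_funM.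
    exact: measurable_fun_fst_comp.
  exact: measurable_fun_snd_comp.
have /integrableP[_ iu'] := iu.
have /integrableP[_ iv'] := iv.
rewrite (_ : integral _ _ _ = \int[m1]_x (`|(u x)%:E| * \int[m2]_y `|(v y)%:E|))%E; last first.
  apply: eq_integral => x _; rewrite -ge0_integralZl//.
    by apply: eq_integral => y _ /=; rewrite normrM EFinM.
  by apply/measurable_EFinP; exact: measurableT_comp.
rewrite ge0_integralZr//.
- by rewrite lte_mul_pinfty// ?integral_ge0// ge0_fin_numE// integral_ge0.
- by apply/measurable_EFinP; exact: measurableT_comp.
- exact: integral_ge0.
Qed.

Lemma Rintegral_prod_mul (u : T1 -> R) (v : T2 -> R) :
  m1.-integrable setT (EFin \o u) -> m2.-integrable setT (EFin \o v) ->
  Rintegral (m1 \x m2)%E setT (fun p => u p.1 * v p.2) =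
  Rintegral m1 setT u * Rintegral m2 setT v.
Proof.
move=> iu iv; rewrite /Rintegral -integral12_prod_meas1/=; last exact: integrable_prod_mul.
rewrite (_ : integral _ _ _ = \int[m1]_x ((u x)%:E * \int[m2]_y (v y)%:E))%E; last first.
  apply: eq_integral => x _; rewrite /fubini_F -integralZl//.
have vfin := integrable_fin_num measurableT iv.
have ufin := integrable_fin_num measurableT iu.
rewrite -(fineK vfin) integralZr// fineM//.
Qed.

Lemma integrable_mul_bounded d (T : measurableType d) (m : {measure set T -> \bar R}) (w g : T -> R) :
  m.-integrable setT (EFin \o w) -> measurable_fun setT g -> (forall x, `|g x| <= 1) ->
  m.-integrable setT (EFin \o (fun x => w x * g x)).
Proof.
move=> iw mg g1.
have mw : measurable_fun setT w by apply/measurable_EFinP; exact: measurable_int iw.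
apply: le_integrable iw => //.
  by apply/measurable_EFinP; exact: measurable_funM.
by move=> x _ /=; rewrite lee_fin normrM -[leRHS]mulr1 ler_wpM2l.
Qed.

Lemma measurable_cos_comp d (T : measurableType d) (f : T -> R) :
  measurable_fun setT f -> measurable_fun setT (fun x => cos (f x)).
Proof.
move=> mf; apply: (measurableT_comp _ mf).
by apply: continuous_measurable_fun; exact: continuous_cos.
Qed.

Lemma measurable_sin_comp d (T : measurableType d) (f : T -> R) :
  measurable_fun setT f -> measurable_fun setT (fun x => sin (f x)).
Proof.
move=> mf; apply: (measurableT_comp _ mf).
by apply: continuous_measurable_fun; exact: continuous_sin.
Qed.

(** The addition formulas split each integral into two products of one-factor integrals, each at
    most k l. In complex form it would be a single product; the real form costs the factor 2. *)
Lemma oscillatory_prod_le (u a : T1 -> R) (v b : T2 -> R) (k l : R) :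
  m1.-integrable setT (EFin \o u) -> m2.-integrable setT (EFin \o v) ->
  measurable_fun setT a -> measurable_fun setT b ->
  `|Rintegral m1 setT (fun x => u x * cos (a x))| <= k ->
  `|Rintegral m1 setT (fun x => u x * sin (a x))| <= k ->
  `|Rintegral m2 setT (fun x => v x * cos (b x))| <= l ->
  `|Rintegral m2 setT (fun x => v x * sin (b x))| <= l ->
  `|Rintegral (m1 \x m2)%E setT (fun p => u p.1 * v p.2 * cos (a p.1 + b p.2))| <= 2 * k * l /\
  `|Rintegral (m1 \x m2)%E setT (fun p => u p.1 * v p.2 * sin (a p.1 + b p.2))| <= 2 * k * l.
Proof.
move=> iu iv ma mb uc us vc vs.
have iuc := integrable_mul_bounded iu (measurable_cos_comp ma) (fun x => cos_max (a x)).
have ius := integrable_mul_bounded iu (measurable_sin_comp ma) (fun x => sin_max (a x)).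
have ivc := integrable_mul_bounded iv (measurable_cos_comp mb) (fun x => cos_max (b x)).
have ivs := integrable_mul_bounded iv (measurable_sin_comp mb) (fun x => sin_max (b x)).
have kl (x y z t : R) : `|x| <= k -> `|y| <= k -> `|z| <= l -> `|t| <= l ->
    `|x * z| + `|y * t| <= 2 * k * l.
  move=> xk yk zl tl; rewrite (_ : 2 * k * l = k * l + k * l); last by ring.
  by rewrite !normrM lerD// ler_pM.
split.
  rewrite (_ : (fun p => _) = (fun p => (u p.1 * cos (a p.1)) * (v p.2 * cos (b p.2)) -
      (u p.1 * sin (a p.1)) * (v p.2 * sin (b p.2)))); last first.
    by apply/funext => p; rewrite cosD; ring.
  rewrite RintegralB//; [|exact: integrable_prod_mul iuc ivc|exact: integrable_prod_mul ius ivs].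
  rewrite (Rintegral_prod_mul iuc ivc) (Rintegral_prod_mul ius ivs).
  by apply: le_trans (ler_normB _ _) _; exact: kl.
rewrite (_ : (fun p => _) = (fun p => (u p.1 * sin (a p.1)) * (v p.2 * cos (b p.2)) +
    (u p.1 * cos (a p.1)) * (v p.2 * sin (b p.2)))); last first.
  by apply/funext => p; rewrite sinD; ring.
rewrite RintegralD//; [|exact: integrable_prod_mul ius ivc|exact: integrable_prod_mul iuc ivs].
rewrite (Rintegral_prod_mul ius ivc) (Rintegral_prod_mul iuc ivs).
by apply: le_trans (ler_normD _ _) _; exact: kl.
Qed.
End product_integrals.

(** * Product weights and coordinate slices on R^n *)

Section Rn_integrals.
Variable R : realType.
Notation leb := (@lebesgue_measure R).

Definition prodw n (w : 'I_n -> R -> R) (x : Rn R n) : R := \prod_(i < n) w i (coord x i).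

Lemma measurable_prodw n (w : 'I_n -> R -> R) : (forall i, measurable_fun setT (w i)) ->
  measurable_fun setT (prodw w).
Proof.
move=> mw; apply: measurable_prod => i _.
exact: measurableT_comp (mw i) (measurable_coord i).
Qed.

Lemma prodw_cons n (w : 'I_n.+1 -> R -> R) p :
  prodw w (consRn p) = w ord0 p.1 * prodw (fun i => w (lift ord0 i)) p.2.
Proof.
rewrite /prodw big_ord_recl coord_consRn0; congr (_ * _).
by apply: eq_bigr => i _; rewrite coord_consRnS.
Qed.

Lemma measurable_dotRn n (al : Rn R n) : measurable_fun setT (fun x => dotRn x al).
Proof.
apply: measurable_sum => i; apply: measurable_funM => //; exact: measurable_coord.
Qed.

Lemma dotRn_cons n (al : Rn R n.+1) p :
  dotRn (consRn p) al = p.1 * coord al ord0 + dotRn p.2 [tuple of behead al].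
Proof.
rewrite /dotRn big_ord_recl coord_consRn0; congr (_ + _).
apply: eq_bigr => i _; rewrite coord_consRnS; congr (_ * _).
by rewrite /coord (tuple_eta al) tnthS; congr tnth; apply/val_inj.
Qed.

(** Coordinates are peeled off one by one, and [oscillatory_prod_le] charges a factor 2 for each.
    Integrability is proved along with the two bounds because the next Fubini step requires it of
    the tail. *)
Lemma oscillatory_Rn_le n (mu : {measure set (Rn R n) -> \bar R})
    (w : 'I_n -> R -> R) (al : Rn R n) (k : 'I_n -> R) : is_lebesgue_Rn mu ->
  (forall i, leb.-integrable setT (EFin \o w i)) ->
  (forall i, `|Rintegral leb setT (fun t => w i t * cos (t * coord al i))| <= k i) ->
  (forall i, `|Rintegral leb setT (fun t => w i t * sin (t * coord al i))| <= k i) ->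
  [/\ mu.-integrable setT (EFin \o prodw w),
   `|Rintegral mu setT (fun x => prodw w x * cos (dotRn x al))| <= 2 ^+ n * \prod_(i < n) k i &
   `|Rintegral mu setT (fun x => prodw w x * sin (dotRn x al))| <= 2 ^+ n * \prod_(i < n) k i].
Proof.
elim: n mu w al k => [|n IH] mu w al k muL iw wc ws.
  (* In dimension 0 the whole space is a box whose side product is empty. *)
  have mu1 : mu setT = 1%E.
    have := muL [tuple] [tuple]; rewrite big_ord0 => <-; last by case.
    by congr (mu _); apply/seteqP; split => // x _ [].
  have p1 : prodw w = cst 1 by apply/funext => x; rewrite /prodw big_ord0.
  have dot0 x : dotRn x al = 0 by rewrite /dotRn big_ord0.
  rewrite expr0 big_ord0 mulr1 p1.
  split.
  - apply/integrableP; split; first exact/measurable_EFinP.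
    rewrite (_ : (fun x => _) = cst 1%E); last by apply/funext => x /=; rewrite normr1.
    by rewrite integral_cst// mul1e mu1 ltry.
  - rewrite (_ : (fun x => _) = cst 1); last by apply/funext => x; rewrite dot0 cos0 mulr1.
    by rewrite Rintegral_cst// mu1 /= mulr1 normr1.
  - rewrite (_ : (fun x => _) = cst 0); last by apply/funext => x; rewrite dot0 sin0 mulr0.
    by rewrite Rintegral_cst// mul0r normr0.
have [nu _ nuL] := sigma_finite_lebesgue_exists R n.
have alS i : coord [tuple of behead al] i = coord al (lift ord0 i).
  by rewrite /coord [in RHS](tuple_eta al) tnthS; congr tnth; apply/val_inj.
have [inu nuc nus] : [/\ nu.-integrable setT (EFin \o prodw (fun i => w (lift ord0 i))),
   `|Rintegral nu setT (fun x => prodw (fun i => w (lift ord0 i)) x * cos (dotRn x [tuple of behead al]))|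
      <= 2 ^+ n * \prod_(i < n) k (lift ord0 i) &
   `|Rintegral nu setT (fun x => prodw (fun i => w (lift ord0 i)) x * sin (dotRn x [tuple of behead al]))|
      <= 2 ^+ n * \prod_(i < n) k (lift ord0 i)].
  by apply: (IH nu _ _ (fun i => k (lift ord0 i))) => // i; rewrite alS; [exact: wc|exact: ws].
have mw i : measurable_fun setT (w i).
  by apply/measurable_EFinP; exact: (measurable_int _ (iw i)).
have mp := measurable_prodw mw.
have md := measurable_dotRn al.
have [] := integrable_consRn (f := EFin \o prodw w) muL nuL.
- exact/measurable_EFinP.
- rewrite (_ : _ \o _ = EFin \o (fun p => w ord0 p.1 * prodw (fun i => w (lift ord0 i)) p.2)); last first.
    by apply/funext => p /=; rewrite prodw_cons.
  exact: integrable_prod_mul (iw ord0) inu.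
move=> imu _.
have mal : measurable_fun setT (fun t : measurableTypeR R => t * coord al ord0) by exact: measurable_funM.
have [oc os] := oscillatory_prod_le (iw ord0) inu mal
  (measurable_dotRn [tuple of behead al]) (wc ord0) (ws ord0) nuc nus.
rewrite big_ord_recl exprS.
have step (h : R -> R) : (forall x, `|h x| <= 1) -> measurable_fun setT h ->
    Rintegral mu setT (fun x => prodw w x * h (dotRn x al)) =
    Rintegral (leb \x nu)%E setT (fun p => w ord0 p.1 * prodw (fun i => w (lift ord0 i)) p.2 *
       h (p.1 * coord al ord0 + dotRn p.2 [tuple of behead al])).
  move=> h1 mh.
  have mhd : measurable_fun setT (fun x => h (dotRn x al)) by exact: measurableT_comp mh md.
  rewrite /Rintegral; congr fine.
  have [] := integrable_consRn (f := fun x => (prodw w x * h (dotRn x al))%:E) muL nuL.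
  - by apply/measurable_EFinP; exact: measurable_funM.
  - rewrite (_ : _ \o _ = EFin \o (fun p => w ord0 p.1 * prodw (fun i => w (lift ord0 i)) p.2 *
       h (dotRn (consRn p) al))); last by apply/funext => p /=; rewrite prodw_cons.
    apply: integrable_mul_bounded => //.
      exact: integrable_prod_mul (iw ord0) inu.
    by apply: (measurableT_comp mhd); exact: measurable_consRn.
  by move=> _ ->; apply: eq_integral => p _; rewrite prodw_cons dotRn_cons.
have kE : 2 * 2 ^+ n * (k ord0 * \prod_(i < n) k (lift ord0 i)) =
   2 * k ord0 * (2 ^+ n * \prod_(i < n) k (lift ord0 i)) by ring.
rewrite kE; split => //.
- rewrite step//; first by move=> x; exact: cos_max.
  by apply: continuous_measurable_fun; exact: continuous_cos.
- rewrite step//; first by move=> x; exact: sin_max.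
  by apply: continuous_measurable_fun; exact: continuous_sin.
Qed.

Lemma ge0_integral_prodw_le n (mu : {measure set (Rn R n) -> \bar R})
    (w : 'I_n -> R -> R) (k : 'I_n -> R) : is_lebesgue_Rn mu ->
  (forall i, measurable_fun setT (w i)) -> (forall i t, 0 <= w i t) ->
  (forall i, (\int[leb]_t (w i t)%:E <= (k i)%:E)%E) ->
  (\int[mu]_x (prodw w x)%:E <= (\prod_(i < n) k i)%:E)%E.
Proof.
elim: n mu w k => [|n IH] mu w k muL mw w0 wk.
  have mu1 : mu setT = 1%E.
    have := muL [tuple] [tuple]; rewrite big_ord0 => <-; last by case.
    by congr (mu _); apply/seteqP; split => // x _ [].
  rewrite big_ord0 (eq_integral (cst 1%E)); last by move=> x _; rewrite /prodw big_ord0.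
  by rewrite integral_cst// mul1e mu1.
have [nu _ nuL] := sigma_finite_lebesgue_exists R n.
have k0 i : 0 <= k i.
  by rewrite -lee_fin (le_trans _ (wk i))// integral_ge0// => t _; rewrite lee_fin.
rewrite (ge0_integral_consRn muL nuL); last 2 first.
- by apply/measurable_EFinP; exact: measurable_prodw.
- by move=> x; rewrite lee_fin prodr_ge0.
pose w' i := w (lift ord0 i).
have mw' : measurable_fun setT (@prodw n w') by apply: measurable_prodw => i; exact: mw.
have p0 y : 0 <= prodw w' y by apply: prodr_ge0 => i _; exact: w0.
rewrite (eq_integral (fun t : measurableTypeR R => (w ord0 t)%:E * \int[nu]_y (prodw w' y)%:E)%E); last first.
  move=> t _; rewrite -ge0_integralZl//; last 3 first.
  - exact/measurable_EFinP.
  - by move=> y _; rewrite lee_fin.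
  - by rewrite lee_fin.
  by apply: eq_integral => y _; rewrite prodw_cons EFinM.
rewrite ge0_integralZr//; last 3 first.
- by apply/measurable_EFinP; exact: mw.
- by move=> t _; rewrite lee_fin.
- by apply: integral_ge0 => y _; rewrite lee_fin.
rewrite big_ord_recl EFinM; apply: lee_pmul => //.
- by apply: integral_ge0 => t _; rewrite lee_fin.
- by apply: integral_ge0 => y _; rewrite lee_fin.
- by apply: (IH nu w' (fun i => k (lift ord0 i))) => //; [move=> i; exact: mw|move=> i t; exact: w0|move=> i;
  exact: wk].
Qed.

Definition updRn n (x : Rn R n) (j : 'I_n) (y : R) : Rn R n :=
  [tuple (if i == j then y else coord x i) | i < n].

Lemma eq_coordRn n (x y : Rn R n) : (forall i, coord x i = coord y i) -> x = y.
Proof. by move=> xy; apply: eq_from_tnth. Qed.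

Lemma coord_updRn n (x : Rn R n) j y i : coord (updRn x j y) i = if i == j then y else coord x i.
Proof. by rewrite /coord tnth_mktuple. Qed.

Lemma updRn_cons0 n t (y : Rn R n) t' : updRn (consRn (t, y)) ord0 t' = consRn (t', y).
Proof.
apply: eq_coordRn => i; rewrite coord_updRn.
have [j ->|->] := unliftP ord0 i; last by rewrite eqxx coord_consRn0.
by rewrite !coord_consRnS eq_sym (negbTE (neq_lift _ _)).
Qed.

Lemma updRn_consS n t (y : Rn R n) j t' :
  updRn (consRn (t, y)) (lift ord0 j) t' = consRn (t, updRn y j t').
Proof.
apply: eq_coordRn => i; rewrite coord_updRn.
have [k ->|->] := unliftP ord0 i.
  by rewrite !coord_consRnS (inj_eq lift_inj) coord_updRn.
by rewrite !coord_consRn0 (negbTE (neq_lift _ _)).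
Qed.

Lemma prod_neq_lift n (F : 'I_n.+1 -> R) l :
  \prod_(i < n.+1 | i != lift ord0 l) F i = F ord0 * \prod_(i < n | i != l) F (lift ord0 i).
Proof.
rewrite big_mkcond big_ord_recl/=; congr (_ * _).
by rewrite [RHS]big_mkcond; apply: eq_bigr => i _; rewrite (inj_eq lift_inj).
Qed.

Lemma prod_neq0 n (F : 'I_n.+1 -> R) :
  \prod_(i < n.+1 | i != ord0) F i = \prod_(i < n) F (lift ord0 i).
Proof.
by rewrite big_mkcond big_ord_recl/= mul1r.
Qed.

(** H may depend on all the coordinates, yet its integral along direction j is at most D whatever
    the others are. Integrating direction j first leaves a pure product. This is how a bound on
    polynomials in one variable becomes a bound on R^n. *)
Lemma coord_slice_integral_le n (mu : {measure set (Rn R n) -> \bar R}) (j : 'I_n)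
    (H : Rn R n -> R) (w : 'I_n -> R -> R) (k : 'I_n -> R) (D : R) : is_lebesgue_Rn mu ->
  measurable_fun setT H -> (forall x, 0 <= H x) -> 0 <= D ->
  (forall i, measurable_fun setT (w i)) -> (forall i t, 0 <= w i t) ->
  (forall i, (\int[leb]_t (w i t)%:E <= (k i)%:E)%E) ->
  (forall x, (\int[leb]_t (H (updRn x j t))%:E <= D%:E)%E) ->
  (\int[mu]_x (H x * \prod_(i < n | i != j) w i (coord x i))%:E <=
    (D * \prod_(i < n | i != j) k i)%:E)%E.
Proof.
move=> + + + + + + + HD; move: HD.
elim: n mu j H w k => [|n IH] mu j H w k HD muL mH H0 D0 mw w0 wk; first by case: (j).
have [nu _ nuL] := sigma_finite_lebesgue_exists R n.
have k0 i : 0 <= k i.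
  by rewrite -lee_fin (le_trans _ (wk i))// integral_ge0// => t _; rewrite lee_fin.
pose w' i := w (lift ord0 i).
have mw' : measurable_fun setT (@prodw n w') by apply: measurable_prodw => i; exact: mw.
have p0 y : 0 <= prodw w' y by apply: prodr_ge0 => i _; exact: w0.
have mHc : measurable_fun setT (H \o @consRn R n).
  by apply: measurableT_comp => //; exact: measurable_consRn.
have mF (P : pred 'I_n.+1) : measurable_fun setT (fun x : Rn R n.+1 => H x * \prod_(i < n.+1 | P i) w i (coord x i)).
  apply: measurable_funM => //; under eq_fun do rewrite big_mkcond/=.
  apply: measurable_prod => i _; case: (P i) => //.
  exact: measurableT_comp (mw i) (measurable_coord i).
have F0 (P : pred 'I_n.+1) x : 0 <= H x * \prod_(i < n.+1 | P i) w i (coord x i).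
  by rewrite mulr_ge0// prodr_ge0.
(* If j is not the first coordinate, the first one is outermost and its weight factors out of the
   induction hypothesis; if it is, it is placed innermost and integrated at once. *)
have [l jl|j0] := unliftP ord0 j.
  rewrite jl in HD *.
  rewrite (ge0_integral_consRn muL nuL); last 2 first.
  - by apply/measurable_EFinP; exact: mF.
  - by move=> x; rewrite lee_fin.
  pose c := D * \prod_(i < n | i != l) k (lift ord0 i).
  apply: (@le_trans _ _ (\int[leb]_t ((w ord0 t)%:E * c%:E)))%E.
    apply: ge0_le_integral => //.
    - by move=> t _; apply: integral_ge0 => y _; rewrite lee_fin.
    - apply: (@measurable_fun_fubini_tonelli_F _ _ _ _ _ nu (fun p => (H (consRn p) *
        \prod_(i < n.+1 | i != lift ord0 l) w i (coord (consRn p) i))%:E)).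
        apply/measurable_EFinP; apply: (measurableT_comp (mF _)); exact: measurable_consRn.
      by move=> p; rewrite lee_fin.
    - apply: emeasurable_funM => //; apply/measurable_EFinP; exact: mw.
    move=> t _.
    rewrite (eq_integral (fun y => (w ord0 t)%:E * (H (consRn (t, y)) *
       \prod_(i < n | i != l) w' i (coord y i))%:E)%E); last first.
      move=> y _; rewrite prod_neq_lift -EFinM coord_consRn0; congr EFin.
      rewrite mulrCA; congr (_ * (_ * _)); apply: eq_bigr => i _.
      by rewrite coord_consRnS.
    rewrite ge0_integralZl//; last 3 first.
    - apply/measurable_EFinP; apply: measurable_funM; first exact: measurable_fun_pair2 mHc.
      under eq_fun do rewrite big_mkcond/=.
      apply: measurable_prod => i _; case: (i != l) => //.
      exact: measurableT_comp (mw _) (measurable_coord i).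
    - by move=> y _; rewrite lee_fin mulr_ge0// prodr_ge0// => i _; exact: w0.
    - by rewrite lee_fin.
    apply: lee_wpmul2l; first by rewrite lee_fin.
    apply: (IH nu l _ w' (fun i => k (lift ord0 i))) => //.
    - by move=> x; have := HD (consRn (t, x)); under eq_integral do rewrite updRn_consS.
    - exact: measurable_fun_pair2 mHc.
    - by move=> i; exact: mw.
    - by move=> i t'; exact: w0.
    - by move=> i; exact: wk.
  have c0 : 0 <= c by rewrite mulr_ge0// prodr_ge0.
  rewrite ge0_integralZr//; last 2 first.
  - by apply/measurable_EFinP; exact: mw.
  - by move=> t _; rewrite lee_fin.
  rewrite prod_neq_lift mulrCA (EFinM (k ord0) c).
  by apply: lee_wpmul2r; [rewrite lee_fin|exact: wk].
rewrite j0 in HD *.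
rewrite (ge0_integral_consRn2 muL nuL); last 2 first.
- by apply/measurable_EFinP; exact: mF.
- by move=> x; rewrite lee_fin.
apply: (@le_trans _ _ (\int[nu]_y (D%:E * (prodw w' y)%:E)))%E.
  apply: ge0_le_integral => //.
  - by move=> t _; apply: integral_ge0 => y _; rewrite lee_fin.
  - apply: (@measurable_fun_fubini_tonelli_G _ _ _ _ _ leb (fun p => (H (consRn p) *
        \prod_(i < n.+1 | i != ord0) w i (coord (consRn p) i))%:E)).
      apply/measurable_EFinP; apply: (measurableT_comp (mF _)); exact: measurable_consRn.
    by move=> p; rewrite lee_fin.
  - apply: emeasurable_funM => //; exact/measurable_EFinP.
  move=> y _.
  rewrite (eq_integral (fun t : measurableTypeR R => (H (consRn (t, y)))%:E * (prodw w' y)%:E)%E); last first.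
    move=> t _; rewrite prod_neq0 EFinM; congr (_ * (_ %:E))%E.
    by apply: eq_bigr => i _; rewrite coord_consRnS.
  rewrite ge0_integralZr//; last 3 first.
  - apply/measurable_EFinP; exact: measurable_fun_pair1 mHc.
  - by move=> t _; rewrite lee_fin.
  - by rewrite lee_fin.
  apply: lee_wpmul2r; first by rewrite lee_fin.
  rewrite (eq_integral (fun t : measurableTypeR R => (H (updRn (consRn (0, y)) ord0 t))%:E)).
    exact: HD.
  by move=> t _; rewrite updRn_cons0.
rewrite ge0_integralZl//; last 2 first.
- exact/measurable_EFinP.
- by move=> y _; rewrite lee_fin.
rewrite prod_neq0 EFinM; apply: lee_wpmul2l; first by rewrite lee_fin.
apply: (ge0_integral_prodw_le (k := fun i => k (lift ord0 i)) nuL).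
- by move=> i; exact: mw.
- by move=> i t; exact: w0.
- by move=> i; exact: wk.
Qed.

End Rn_integrals.

(** * Schur's test for oscillatory integrals *)

Section dominated_Fubini.
Context d1 d2 (T1 : measurableType d1) (T2 : measurableType d2) (R : realType).
Variables (m1 : {sigma_finite_measure set T1 -> \bar R})
  (m2 : {sigma_finite_measure set T2 -> \bar R}).
Variables (f : T1 * T2 -> R) (u : T1 -> R) (v : T2 -> R).
Hypothesis mf : measurable_fun setT f.
Hypothesis iu : m1.-integrable setT (EFin \o u).
Hypothesis iv : m2.-integrable setT (EFin \o v).
Hypothesis fuv : forall p, `|f p| <= u p.1 * v p.2.

Lemma dominated_integrable : (m1 \x m2)%E.-integrable setT (EFin \o f).
Proof.
apply: le_integrable (integrable_prod_mul iu iv) => //.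
  exact/measurable_EFinP.
by move=> p _ /=; rewrite lee_fin (le_trans (fuv p)) ?ler_norm.
Qed.

(** The domination holds at every point, so every slice is integrable and not just almost every one.
    The iterated real-valued integrals below can thus be rewritten without exceptional sets. *)
Lemma dominated_integrable1 x : m2.-integrable setT (fun y => (f (x, y))%:E).
Proof.
have iuv : m2.-integrable setT (fun y => (u x)%:E * (v y)%:E)%E by exact: integrableZl.
apply: le_integrable iuv => //.
  by apply/measurable_EFinP; exact: measurable_fun_pair2 mf.
by move=> y _ /=; rewrite lee_fin (le_trans (fuv (x, y))) ?ler_norm.
Qed.

Lemma dominated_integrable2 y : m1.-integrable setT (fun x => (f (x, y))%:E).
Proof.
have iuv : m1.-integrable setT (fun x => (v y)%:E * (u x)%:E)%E by exact: integrableZl.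
apply: le_integrable iuv => //.
  by apply/measurable_EFinP; exact: measurable_fun_pair1 mf.
by move=> x _ /=; rewrite lee_fin mulrC (le_trans (fuv (x, y))) ?ler_norm.
Qed.

Lemma dominated_fubini_FE x :
  (Rintegral m2 setT (fun y => f (x, y)))%:E = (\int[m2]_y (f (x, y))%:E)%E.
Proof. by rewrite /Rintegral fineK//; exact: integrable_fin_num (dominated_integrable1 x). Qed.

Lemma dominated_fubini_GE y :
  (Rintegral m1 setT (fun x => f (x, y)))%:E = (\int[m1]_x (f (x, y))%:E)%E.
Proof. by rewrite /Rintegral fineK//; exact: integrable_fin_num (dominated_integrable2 y). Qed.

Lemma measurable_dominated_fubini_F :
  measurable_fun setT (fun x => Rintegral m2 setT (fun y => f (x, y))).
Proof.
apply/measurable_EFinP; rewrite (_ : _ \o _ = fubini_F m2 (EFin \o f)).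
  exact: measurable_fubini_F dominated_integrable.
by apply/funext => x /=; rewrite dominated_fubini_FE.
Qed.

Lemma measurable_dominated_fubini_G :
  measurable_fun setT (fun y => Rintegral m1 setT (fun x => f (x, y))).
Proof.
apply/measurable_EFinP; rewrite (_ : _ \o _ = fubini_G m1 (EFin \o f)).
  exact: measurable_fubini_G dominated_integrable.
by apply/funext => x /=; rewrite dominated_fubini_GE.
Qed.

Lemma Rintegral_Fubini : Rintegral m1 setT (fun x => Rintegral m2 setT (fun y => f (x, y))) =
  Rintegral m2 setT (fun y => Rintegral m1 setT (fun x => f (x, y))).
Proof.
rewrite [in LHS]/Rintegral (eq_integral (fun x => \int[m2]_y (f (x, y))%:E)%E); last first.
  by move=> x _; rewrite dominated_fubini_FE.
rewrite (Fubini dominated_integrable) [in RHS]/Rintegral; congr fine.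
by apply: eq_integral => y _; rewrite dominated_fubini_GE.
Qed.

End dominated_Fubini.

Section schur.
Context dX dZ (X : measurableType dX) (Z : measurableType dZ) (R : realType).
Variables (m : {sigma_finite_measure set X -> \bar R})
  (nu : {sigma_finite_measure set Z -> \bar R}).
Variables (theta : Z * X -> R) (rho : Z -> R).
Hypothesis mtheta : measurable_fun setT theta.
Hypothesis irho : nu.-integrable setT (EFin \o rho).
Hypothesis rho0 : forall z, 0 <= rho z.

(** For real p, this and [sin_transform] are the real and imaginary parts of the integral of exp(i
    theta(z, x)) p(x) dx. *)
Definition cos_transform (p : X -> R) (z : Z) := Rintegral m setT (fun x => p x * cos (theta (z, x))).
Definition sin_transform (p : X -> R) (z : Z) := Rintegral m setT (fun x => p x * sin (theta (z, x))).
Definition cos_kernel (x y : X) := Rintegral nu setT (fun z => rho z * cos (theta (z, x) - theta (z, y))).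

Section quadratic_form.
Variable p : X -> R.
Hypothesis ip : m.-integrable setT (EFin \o p).

Let mp : measurable_fun setT p.
Proof. by apply/measurable_EFinP; exact: measurable_int ip. Qed.
Let mrho : measurable_fun setT rho.
Proof. by apply/measurable_EFinP; exact: measurable_int irho. Qed.
Let A := cos_transform p.
Let B := sin_transform p.
Let M := Rintegral m setT (fun x => `|p x|).

Let inp : m.-integrable setT (EFin \o (fun x => `|p x|)).
Proof. exact: (integrable_norm ip). Qed.

Let M0 : 0 <= M.
Proof. by apply: Rintegral_ge0 => x _. Qed.

Let mtheta1 z : measurable_fun setT (fun x => theta (z, x)).
Proof. exact: measurable_fun_pair2. Qed.

Let iA z : m.-integrable setT (EFin \o (fun x => p x * cos (theta (z, x)))).
Proof.
apply: integrable_mul_bounded => //; first exact: measurable_cos_comp.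
by move=> x; exact: cos_max.
Qed.

Let iB z : m.-integrable setT (EFin \o (fun x => p x * sin (theta (z, x)))).
Proof.
apply: integrable_mul_bounded => //; first exact: measurable_sin_comp.
by move=> x; exact: sin_max.
Qed.

Lemma cos_transform_le z : `|A z| <= M.
Proof.
apply: le_trans (le_normr_Rintegral _ (iA z)) _ => //.
apply: le_Rintegral => //; first exact: (integrable_norm (iA z)).
by move=> x _; rewrite normrM -[leRHS]mulr1 ler_wpM2l// cos_max.
Qed.

Lemma sin_transform_le z : `|B z| <= M.
Proof.
apply: le_trans (le_normr_Rintegral _ (iB z)) _ => //.
apply: le_Rintegral => //; first exact: (integrable_norm (iB z)).
by move=> x _; rewrite normrM -[leRHS]mulr1 ler_wpM2l// sin_max.
Qed.

Let ZA c z : Rintegral m setT (fun x => c * (p x * cos (theta (z, x)))) = c * A z.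
Proof. by apply: RintegralZl => //; exact: iA. Qed.

Let ZB c z : Rintegral m setT (fun x => c * (p x * sin (theta (z, x)))) = c * B z.
Proof. by apply: RintegralZl => //; exact: iB. Qed.

Let i1 : nu.-integrable setT (EFin \o (fun z => rho z * 1)).
Proof. by apply: eq_integrable irho => // z _ /=; rewrite mulr1. Qed.

Lemma measurable_rho_cos_transform : measurable_fun setT (fun z => rho z * A z).
Proof.
have h : measurable_fun setT (fun z => Rintegral m setT (fun x => rho z * (p x * cos (theta (z, x))))).
  apply: (@measurable_dominated_fubini_F _ _ _ _ _ nu m
     (fun q => rho q.1 * (p q.2 * cos (theta q))) rho (fun x => `|p x|)) => //.
    apply: measurable_funM; first exact: measurable_fun_fst_comp.
    by apply: measurable_funM; [exact: measurable_fun_snd_comp|exact: measurable_cos_comp].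
  move=> q; rewrite normrM ger0_norm// ler_wpM2l// normrM -[leRHS]mulr1.
  by rewrite ler_wpM2l// cos_max.
rewrite (_ : (fun z => _) = (fun z => Rintegral m setT (fun x => rho z * (p x * cos (theta (z, x))))))//.
by apply/funext => z; rewrite RintegralZl.
Qed.

Lemma measurable_rho_sin_transform : measurable_fun setT (fun z => rho z * B z).
Proof.
have h : measurable_fun setT (fun z => Rintegral m setT (fun x => rho z * (p x * sin (theta (z, x))))).
  apply: (@measurable_dominated_fubini_F _ _ _ _ _ nu m
     (fun q => rho q.1 * (p q.2 * sin (theta q))) rho (fun x => `|p x|)) => //.
    apply: measurable_funM; first exact: measurable_fun_fst_comp.
    by apply: measurable_funM; [exact: measurable_fun_snd_comp|exact: measurable_sin_comp].
  move=> q; rewrite normrM ger0_norm// ler_wpM2l// normrM -[leRHS]mulr1.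
  by rewrite ler_wpM2l// sin_max.
rewrite (_ : (fun z => _) = (fun z => Rintegral m setT (fun x => rho z * (p x * sin (theta (z, x))))))//.
by apply/funext => z; rewrite RintegralZl.
Qed.

(** The pivot of the T T^* identity: integrated in x it gives [rho z * (A z ^+ 2 + B z ^+ 2)],
    integrated in z it gives [p x * S x]. Fubini equates the two iterated integrals. *)
Let F (q : Z * X) := p q.2 * (cos (theta q) * (rho q.1 * A q.1) + sin (theta q) * (rho q.1 * B q.1)).

Let mF : measurable_fun setT F.
Proof.
apply: measurable_funM; first exact: measurable_fun_snd_comp.
apply: measurable_funD; apply: measurable_funM.
- exact: measurable_cos_comp.
- apply: (measurable_fun_fst_comp (f := fun z => rho z * A z)); exact: measurable_rho_cos_transform.
- exact: measurable_sin_comp.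
- apply: (measurable_fun_fst_comp (f := fun z => rho z * B z)); exact: measurable_rho_sin_transform.
Qed.

Let FE z x : cos (theta (z, x)) * (rho z * A z) + sin (theta (z, x)) * (rho z * B z) =
  Rintegral m setT (fun y => rho z * p y * cos (theta (z, x) - theta (z, y))).
Proof.
rewrite (_ : (fun y => _) = (fun y => (rho z * cos (theta (z, x))) * (p y * cos (theta (z, y))) +
  (rho z * sin (theta (z, x))) * (p y * sin (theta (z, y))))); last first.
  by apply/funext => y; rewrite cosB; ring.
rewrite RintegralD//; last 2 first.
- have := integrableZl measurableT (rho z * cos (theta (z, x))) (iA z).
  by apply: eq_integrable => // y _ /=; rewrite EFinM.
- have := integrableZl measurableT (rho z * sin (theta (z, x))) (iB z).
  by apply: eq_integrable => // y _ /=; rewrite EFinM.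
by rewrite ZA ZB; ring.
Qed.

Let Fle q : `|F q| <= (rho q.1 * (2 * M)) * `|p q.2|.
Proof.
rewrite /F normrM mulrC ler_wpM2r// (le_trans (ler_normD _ _))//.
have h (x y : R) : `|x| <= 1 -> `|y| <= M -> `|x * (rho q.1 * y)| <= rho q.1 * M.
  move=> x1 yM; rewrite mulrCA normrM (ger0_norm (rho0 _)) ler_wpM2l//.
  by rewrite normrM -[leRHS]mul1r ler_pM.
have := h _ _ (cos_max (theta q)) (cos_transform_le q.1).
have := h _ _ (sin_max (theta q)) (sin_transform_le q.1).
by move=> h1 h2; rewrite (le_trans (lerD h2 h1))//; lra.
Qed.

Let irhoM : nu.-integrable setT (EFin \o (fun z => rho z * (2 * M))).
Proof. by have := integrableZr measurableT (2 * M) irho; apply: eq_integrable. Qed.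

Let S x := Rintegral m setT (fun y => p y * cos_kernel x y).

Let pcos x y z : `|rho z * p y * cos (theta (z, x) - theta (z, y))| <= rho z * `|p y|.
Proof.
by rewrite normrM -[leRHS]mulr1 ler_pM ?cos_max// normrM (ger0_norm (rho0 _)).
Qed.

Let mpcos x : measurable_fun setT (fun q : Z * X => rho q.1 * p q.2 * cos (theta (q.1, x) - theta q)).
Proof.
apply: measurable_funM.
  by apply: measurable_funM; [exact: measurable_fun_fst_comp|exact: measurable_fun_snd_comp].
apply: measurable_cos_comp; apply: measurable_funB => //.
by apply: (measurable_fun_fst_comp (f := fun z => theta (z, x))); exact: measurable_fun_pair1.
Qed.

Let SE x : Rintegral nu setT (fun z => F (z, x)) = p x * S x.
Proof.
have iG : nu.-integrable setT (EFin \o (fun z => cos (theta (z, x)) * (rho z * A z) + sin (theta (z, x)) *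
  (rho z * B z))).
  apply: le_integrable irhoM => //.
    apply/measurable_EFinP; apply: measurable_funD; apply: measurable_funM.
    - by apply: measurable_cos_comp; exact: measurable_fun_pair1.
    - exact: measurable_rho_cos_transform.
    - by apply: measurable_sin_comp; exact: measurable_fun_pair1.
    - exact: measurable_rho_sin_transform.
  move=> z _ /=; rewrite lee_fin (ger0_norm (mulr_ge0 (rho0 _) _)) ?mulr_ge0//.
  have h (a y : R) : `|a| <= 1 -> `|y| <= M -> `|a * (rho z * y)| <= rho z * M.
    move=> x1 yM; rewrite mulrCA normrM (ger0_norm (rho0 _)) ler_wpM2l//.
    by rewrite normrM -[leRHS]mul1r ler_pM.
  apply: le_trans (ler_normD _ _) _.
  have := h _ _ (cos_max (theta (z, x))) (cos_transform_le z).
  have := h _ _ (sin_max (theta (z, x))) (sin_transform_le z).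
  by move=> h1 h2; rewrite (le_trans (lerD h2 h1))//; lra.
rewrite /F/= RintegralZl//.
congr (_ * _); under eq_Rintegral do rewrite FE.
rewrite (@Rintegral_Fubini _ _ _ _ _ nu m (fun q => rho q.1 * p q.2 * cos (theta (q.1, x) - theta q))
   rho (fun x => `|p x|)) //; last by move=> [z y]; exact: pcos.
apply: eq_Rintegral => y _; rewrite /cos_kernel -RintegralZl//.
  by apply: eq_Rintegral => z _; rewrite mulrCA mulrA.
apply: integrable_mul_bounded => //; last by move=> z; exact: cos_max.
by apply: measurable_cos_comp; apply: measurable_funB; exact: measurable_fun_pair1.
Qed.

Let QE z : rho z * (A z ^+ 2 + B z ^+ 2) = Rintegral m setT (fun x => F (z, x)).
Proof.
rewrite (_ : (fun x => F (z, x)) = (fun x => (rho z * A z) * (p x * cos (theta (z, x))) +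
  (rho z * B z) * (p x * sin (theta (z, x))))); last first.
  by apply/funext => x; rewrite /F/=; ring.
rewrite RintegralD//; last 2 first.
- have := integrableZl measurableT (rho z * A z) (iA z).
  by apply: eq_integrable => // y _ /=; rewrite EFinM.
- have := integrableZl measurableT (rho z * B z) (iB z).
  by apply: eq_integrable => // y _ /=; rewrite EFinM.
by rewrite ZA ZB; ring.
Qed.

Lemma measurable_quadratic_form : measurable_fun setT (fun z => rho z * (A z ^+ 2 + B z ^+ 2)).
Proof.
rewrite (_ : (fun z => _) = (fun z => Rintegral m setT (fun x => F (z, x)))).
  exact: (@measurable_dominated_fubini_F _ _ _ _ _ nu m F (fun z => rho z * (2 * M)) (fun x => `|p x|)).
by apply/funext => z; rewrite QE.
Qed.

Lemma Rintegral_quadratic_form :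
  Rintegral nu setT (fun z => rho z * (A z ^+ 2 + B z ^+ 2)) = Rintegral m setT (fun x => p x * S x).
Proof.
transitivity (Rintegral nu setT (fun z => Rintegral m setT (fun x => F (z, x)))).
  by apply: eq_Rintegral => z _; exact: QE.
rewrite (@Rintegral_Fubini _ _ _ _ _ nu m F (fun z => rho z * (2 * M)) (fun x => `|p x|))//.
by apply: eq_Rintegral => x _; rewrite SE.
Qed.

Let measurable_pS : measurable_fun setT (fun x => p x * S x).
Proof.
rewrite (_ : (fun x => _) = (fun x => Rintegral nu setT (fun z => F (z, x)))).
  exact: (@measurable_dominated_fubini_G _ _ _ _ _ nu m F (fun z => rho z * (2 * M)) (fun x => `|p x|)).
by apply/funext => x; rewrite SE.
Qed.

Lemma integrable_quadratic_form : nu.-integrable setT (EFin \o (fun z => rho z * (A z ^+ 2 + B z ^+ 2))).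
Proof.
have iM : nu.-integrable setT (EFin \o (fun z => rho z * (2 * M ^+ 2))).
  by have := integrableZr measurableT (2 * M ^+ 2) irho; apply: eq_integrable.
have sqM x : `|x| <= M -> x ^+ 2 <= M ^+ 2.
  by move=> xM; rewrite -real_normK ?num_real// lerXn2r ?nnegrE.
apply: le_integrable iM => //.
  by apply/measurable_EFinP; exact: measurable_quadratic_form.
move=> z _ /=; rewrite lee_fin !ger0_norm ?mulr_ge0 ?addr_ge0 ?sqr_ge0//.
rewrite ler_wpM2l// (_ : 2 * M ^+ 2 = M ^+ 2 + M ^+ 2); last by ring.
by rewrite lerD// sqM ?cos_transform_le ?sin_transform_le.
Qed.

Lemma quadratic_form_le (k : X * X -> R) : measurable_fun setT k ->
  (forall x y, `|cos_kernel x y| <= k (x, y)) ->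
  (\int[nu]_z (rho z * (A z ^+ 2 + B z ^+ 2))%:E <=
   \int[m]_x \int[m]_y (`|p x| * `|p y| * k (x, y))%:E)%E.
Proof.
move=> mk Ck.
have k0 x y : 0 <= k (x, y) by exact: le_trans (Ck x y).
have mK : measurable_fun setT (fun q : X * X => (`|p q.1| * `|p q.2| * k q)%:E).
  apply/measurable_EFinP; apply: measurable_funM => //; apply: measurable_funM.
    by apply: (measurable_fun_fst_comp (f := fun x => `|p x|)); exact: measurableT_comp.
  by apply: (measurable_fun_snd_comp (f := fun x => `|p x|)); exact: measurableT_comp.
have -> : (\int[nu]_z (rho z * (A z ^+ 2 + B z ^+ 2))%:E = (Rintegral m setT (fun x => p x * S x))%:E)%E.
  rewrite -Rintegral_quadratic_form /Rintegral fineK//.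
  exact: (integrable_fin_num _ integrable_quadratic_form).
have mpK x : measurable_fun setT (fun y => p y * cos_kernel x y).
  rewrite (_ : (fun y => _) = (fun y => Rintegral nu setT (fun z => rho z * p y * cos (theta (z, x) - theta (z, y))))).
    apply: (@measurable_dominated_fubini_G _ _ _ _ _ nu m (fun q => rho q.1 * p q.2 * cos (theta (q.1, x) - theta q))
      rho (fun x => `|p x|)) => //.
    by move=> [z y]; exact: pcos.
  apply/funext => y; rewrite /cos_kernel -RintegralZl//.
    by apply: eq_Rintegral => z _; rewrite mulrCA mulrA.
  apply: integrable_mul_bounded => //; last by move=> z; exact: cos_max.
  by apply: measurable_cos_comp; apply: measurable_funB; exact: measurable_fun_pair1.
(* [fine] sends the infinite values to 0, so the inequality holds without knowing that e is
   finite. *)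
have fine_abse (e : \bar R) : (`|fine e|%:E <= `|e|)%E by case: e => //= ; rewrite normr0 leey.
apply: (@le_trans _ _ `|\int[m]_x (p x * S x)%:E|%E).
  by apply: le_trans (fine_abse _); rewrite lee_fin ler_norm.
apply: (le_trans (le_abse_integral _ _ _)) => //; first exact/measurable_EFinP.
apply: ge0_le_integral => //.
- by apply/measurable_EFinP; exact: measurableT_comp.
- apply: (@measurable_fun_fubini_tonelli_F _ _ _ _ _ m _ mK) => q.
  by case: q => x y; rewrite lee_fin !mulr_ge0.
move=> x _ /=; rewrite normrM EFinM.
rewrite (eq_integral (fun y => `|p x|%:E * (`|p y| * k (x, y))%:E)%E); last first.
  by move=> y _; rewrite -EFinM mulrA.
rewrite ge0_integralZl//; last 2 first.
- apply/measurable_EFinP; apply: measurable_funM; first exact: measurableT_comp.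
  exact: measurable_fun_pair2.
- by move=> y _; rewrite lee_fin mulr_ge0.
apply: lee_wpmul2l => //.
apply: (le_trans (fine_abse _)).
apply: (le_trans (le_abse_integral _ _ _)) => //; first exact/measurable_EFinP.
apply: ge0_le_integral => //.
- by apply/measurable_EFinP; exact: measurableT_comp.
- apply/measurable_EFinP; apply: measurable_funM; first exact: measurableT_comp.
  exact: measurable_fun_pair2.
by move=> y _; rewrite lee_fin normrM ler_wpM2l.
Qed.

End quadratic_form.

(** By the arithmetic-geometric inequality, sqrt b |h| <= b + h^2, and both terms are integrable. *)
Lemma integrable_sqrt_mul (b h : X -> R) : (forall x, 0 <= b x) ->
  m.-integrable setT (EFin \o b) -> measurable_fun setT h ->
  (\int[m]_x (h x ^+ 2)%:E < +oo)%E ->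
  m.-integrable setT (EFin \o (fun x => Num.sqrt (b x) * h x)).
Proof.
move=> b0 ib mh h2.
have mb : measurable_fun setT b by apply/measurable_EFinP; exact: measurable_int ib.
have ih2 : m.-integrable setT (fun x => (h x ^+ 2)%:E).
  apply/integrableP; split; first by apply/measurable_EFinP; exact: measurable_funX.
  by rewrite (eq_integral (fun x => (h x ^+ 2)%:E))// => x _ /=; rewrite ger0_norm ?sqr_ge0.
apply: le_integrable (integrableD _ ib ih2) => //.
  apply/measurable_EFinP; apply: measurable_funM => //.
  by apply: (measurableT_comp _ mb); apply: continuous_measurable_fun; exact: sqrt_continuous.
move=> x _ /=; rewrite lee_fin [leRHS]ger0_norm ?addr_ge0 ?sqr_ge0// normrM.
rewrite ger0_norm ?sqrtr_ge0// -[leRHS]/(b x + h x ^+ 2) -{2}(sqr_sqrtr (b0 x)) -[h x ^+ 2]real_normK ?num_real//.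
by have := sqr_ge0 (Num.sqrt (b x) - `|h x|); have := sqrtr_ge0 (b x); have := normr_ge0 (h x); nra.
Qed.

(* T T^* method: the square expands into p(x) p(y) cos (theta (z, x) - theta (z, y)),
   so integrating in z first leaves the kernel [cos_kernel]. *)
Lemma schur_test (b h : X -> R) (k : X * X -> R) (D : R) : (forall x, 0 <= b x) ->
  m.-integrable setT (EFin \o b) -> measurable_fun setT h ->
  (\int[m]_x (h x ^+ 2)%:E < +oo)%E -> measurable_fun setT k ->
  (forall x y, `|cos_kernel x y| <= k (x, y)) ->
  (forall x y, k (x, y) = k (y, x)) ->
  (forall x, (\int[m]_y (b y * k (x, y))%:E <= D%:E)%E) ->
  (\int[nu]_z (rho z * (cos_transform (fun x => (Num.sqrt (b x) * h x)%R) z ^+ 2 +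
    sin_transform (fun x => (Num.sqrt (b x) * h x)%R) z ^+ 2))%:E <=
    (2 * D)%:E * \int[m]_x (h x ^+ 2)%:E)%E.
Proof.
move=> b0 ib mh h2 mk Ck ksym kD; set p := fun x : X => _.
have mb : measurable_fun setT b by apply/measurable_EFinP; exact: measurable_int ib.
have k0 x y : 0 <= k (x, y) by exact: le_trans (Ck x y).
apply: (le_trans (quadratic_form_le (integrable_sqrt_mul b0 ib mh h2) mk Ck)).
have mG : measurable_fun setT (fun q : X * X => (h q.1 ^+ 2 * (b q.2 * k q))%:E).
  apply/measurable_EFinP; apply: measurable_funM.
    by apply: (measurable_fun_fst_comp (f := fun x => h x ^+ 2)); exact: measurable_funX.
  by apply: measurable_funM => //; exact: measurable_fun_snd_comp.
have mG' : measurable_fun setT (fun q : X * X => (h q.2 ^+ 2 * (b q.1 * k q))%:E).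
  apply/measurable_EFinP; apply: measurable_funM.
    by apply: (measurable_fun_snd_comp (f := fun x => h x ^+ 2)); exact: measurable_funX.
  by apply: measurable_funM => //; exact: measurable_fun_fst_comp.
have G0 (q : X * X) : (0 <= (h q.1 ^+ 2 * (b q.2 * k q))%:E)%E.
  by case: q => x y; rewrite lee_fin mulr_ge0 ?sqr_ge0 ?mulr_ge0.
have G0' (q : X * X) : (0 <= (h q.2 ^+ 2 * (b q.1 * k q))%:E)%E.
  by case: q => x y; rewrite lee_fin mulr_ge0 ?sqr_ge0 ?mulr_ge0.
have mp : measurable_fun setT p.
  apply: measurable_funM => //.
  by apply: (measurableT_comp _ mb); apply: continuous_measurable_fun; exact: sqrt_continuous.
have G1 : (\int[m]_x \int[m]_y (h x ^+ 2 * (b y * k (x, y)))%:E <= D%:E * \int[m]_x (h x ^+ 2)%:E)%E.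
  rewrite -ge0_integralZl//; last 3 first.
  - by apply/measurable_EFinP; exact: measurable_funX.
  - by move=> x _; rewrite lee_fin sqr_ge0.
  - have [x _] : exists x : X, True by exists point.
    by apply: le_trans (kD x); apply: integral_ge0 => y _; rewrite lee_fin mulr_ge0.
  apply: ge0_le_integral => //.
  - by move=> x _; apply: integral_ge0 => y _; exact: (G0 (x, y)).
  - exact: (@measurable_fun_fubini_tonelli_F _ _ _ _ _ m _ mG G0).
  - by apply: measurable_funeM; apply/measurable_EFinP; exact: measurable_funX.
  move=> x _; under eq_integral do rewrite EFinM.
  rewrite ge0_integralZl//; last 3 first.
  - by apply/measurable_EFinP; apply: measurable_funM => //; exact: measurable_fun_pair2.
  - by move=> y _; rewrite lee_fin mulr_ge0.
  - by rewrite lee_fin sqr_ge0.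
  by rewrite muleC; apply: lee_wpmul2r; rewrite ?lee_fin ?sqr_ge0.
have G2 : (\int[m]_x \int[m]_y (h y ^+ 2 * (b x * k (x, y)))%:E <= D%:E * \int[m]_x (h x ^+ 2)%:E)%E.
  (* After exchanging the order of integration, the symmetry of k reduces this term to the previous
     one. *)
  rewrite (fubini_tonelli _ mG' G0')/=; apply: le_trans G1; rewrite le_eqVlt; apply/orP; left; apply/eqP.
  by apply: eq_integral => x _; apply: eq_integral => y _; rewrite ksym.
have D0 : 0 <= D.
  have [x _] : exists x : X, True by exists point.
  by rewrite -lee_fin; apply: le_trans (kD x); apply: integral_ge0 => y _; rewrite lee_fin mulr_ge0.
have mK : measurable_fun setT (fun q : X * X => (`|p q.1| * `|p q.2| * k q)%:E).
  apply/measurable_EFinP; apply: measurable_funM => //; apply: measurable_funM.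
    by apply: (measurable_fun_fst_comp (f := fun x => `|p x|)); exact: measurableT_comp.
  by apply: (measurable_fun_snd_comp (f := fun x => `|p x|)); exact: measurableT_comp.
have K0 (q : X * X) : (0 <= (`|p q.1| * `|p q.2| * k q)%:E)%E.
  by case: q => x y; rewrite lee_fin !mulr_ge0.
apply: (@le_trans _ _ (\int[m \x m]_q (h q.1 ^+ 2 * (b q.2 * k q))%:E +
    \int[m \x m]_q (h q.2 ^+ 2 * (b q.1 * k q))%:E)%E); last first.
  rewrite (fubini_tonelli1 _ mG G0) (fubini_tonelli1 _ mG' G0').
  rewrite (mulr_natl D 2) mulr2n EFinD ge0_muleDl ?lee_fin//.
  exact: (leeD G1 G2).
rewrite -ge0_integralD//.
have -> : (\int[m]_x \int[m]_y (`|p x| * `|p y| * k (x, y))%:E =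
    \int[m \x m]_q (`|p q.1| * `|p q.2| * k q)%:E)%E by rewrite fubini_tonelli1.
apply: ge0_le_integral => //; first exact: emeasurable_funD.
move=> [x y] _ /=; rewrite lee_fin !mulrA -mulrDl; apply: ler_wpM2r => //.
rewrite /p !normrM !(ger0_norm (sqrtr_ge0 _)).
rewrite -[h x ^+ 2]real_normK ?num_real// -[h y ^+ 2]real_normK ?num_real//.
rewrite -{2}(sqr_sqrtr (b0 x)) -{2}(sqr_sqrtr (b0 y)).
(* The cross weighting of Schur's test: |p(x) p(y)| <= h(x)^2 b(y) + h(y)^2 b(x). Each term puts b
   on the variable where the kernel is integrated and costs D, whence 2 D. *)
have := sqr_ge0 (`|h x| * Num.sqrt (b y) - `|h y| * Num.sqrt (b x)).
have := mulr_ge0 (mulr_ge0 (normr_ge0 (h x)) (sqrtr_ge0 (b y))) (mulr_ge0 (normr_ge0 (h y)) (sqrtr_ge0 (b x))).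
nra.
Qed.

End schur.

(** * Kernel bounds *)

Notation mnm := mpoly.fun_of_multinom.

Section polynomials.
Variables (R : realType) (n : nat).
Implicit Types (a : mpoly.mpoly n R) (x : Rn R n).

Lemma pevalE a x : peval a x =
  \sum_(m <- mpoly.msupp a) mpoly.mcoeff m a * \prod_i coord x i ^+ mnm m i.
Proof. exact: mpoly.mevalE. Qed.

Lemma peval_mderivE a x j : peval (mpoly.mderiv j a) x =
  \sum_(m <- mpoly.msupp a) (mnm m j)%:R * mpoly.mcoeff m a *
    \prod_i coord x i ^+ (mnm m i - (j == i))%N.
Proof.
rewrite /peval /mpoly.mderiv (big_morph (mpoly.meval (coord x)) (mpoly.mevalD (coord x)) (mpoly.meval0 (coord
  x))); apply: eq_bigr => m _.
rewrite mpoly.mevalZ mpoly.mevalX; congr (_ * _); apply: eq_bigr => i _.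
by rewrite mpoly.mnmBE mpoly.mnm1E.
Qed.

Lemma measurable_peval a : measurable_fun setT (peval a).
Proof.
rewrite (_ : peval a = fun x => \sum_(m <- mpoly.msupp a) mpoly.mcoeff m a * \prod_i coord x i ^+ mnm m i).
  apply: measurable_sum => m; apply: measurable_funM => //.
  apply: measurable_prod => i _; apply: measurable_funX; exact: measurable_coord.
by apply/funext => x; rewrite pevalE.
Qed.

Lemma peval_bounded a (M : R) : exists c : R, forall x, cubeRn M x -> `|peval a x| <= c.
Proof.
exists (\sum_(m <- mpoly.msupp a) `|mpoly.mcoeff m a| * \prod_i M ^+ mnm m i) => x /cubeRnE xM.
rewrite pevalE (le_trans (ler_norm_sum _ _ _))//; apply: ler_sum => m _.
rewrite normrM ler_wpM2l// normr_prod; apply: ler_prod => i _.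
by rewrite normr_ge0/= normrX lerXn2r ?nnegrE ?(le_trans _ (xM i)).
Qed.

Definition pdeg a (j : 'I_n) : nat := \max_(m <- mpoly.msupp a) mnm m j.

(** Freezing the other coordinates only alters the coefficients: the degree bound is the same for
    all x, as [lorentz_poly_le] wants it. *)
Lemma peval_slice a x (j : 'I_n) : exists p : {poly R},
  [/\ (size p <= (pdeg a j).+1)%N,
   forall y, peval a (updRn x j y) = p.[y] &
   forall y, peval (mpoly.mderiv j a) (updRn x j y) = p^`().[y]].
Proof.
pose c (m : mpoly.multinom n) := mpoly.mcoeff m a * \prod_(i | i != j) coord x i ^+ mnm m i.
exists (\sum_(m <- mpoly.msupp a) c m *: 'X^(mnm m j)).
split => [|y|y].
- rewrite /pdeg; elim: (mpoly.msupp a : seq _) => [|m r IH].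
    by rewrite !big_nil size_poly0.
  rewrite !big_cons; apply: (leq_trans (size_polyD _ _)).
  rewrite geq_max; apply/andP; split; last by rewrite (leq_trans IH)// ltnS leq_maxr.
  by apply: (leq_trans (size_scale_leq _ _)); rewrite size_polyXn ltnS leq_maxl.
- rewrite pevalE horner_sum; apply: eq_bigr => m _.
  rewrite hornerZ hornerXn (bigD1 j)//= coord_updRn eqxx /c -mulrA; congr (_ * _).
  rewrite mulrC; congr (_ * _); apply: eq_bigr => i ij.
  by rewrite coord_updRn (negbTE ij).
- rewrite peval_mderivE raddf_sum horner_sum; apply: eq_bigr => m _.
  rewrite -[X in X.[y]]/((c m *: 'X^(mnm m j))^`()) derivZ derivXn hornerZ hornerMn hornerXn (bigD1 j)//=
    coord_updRn eqxx /c subn1.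
  rewrite (eq_bigr (fun i => coord x i ^+ mnm m i)); last first.
    by move=> i ij; rewrite coord_updRn (negbTE ij) eq_sym (negbTE ij) subn0.
  by rewrite -mulr_natr; ring.
Qed.

End polynomials.

Section cubes.
Variables (R : realType) (n : nat).
Notation leb := (@lebesgue_measure R).

Definition itv1 (M t : R) : R := \1_(`[- M, M]%classic) t.
Definition cube1 (M : R) (x : Rn R n) : R := prodw (fun _ => itv1 M) x.

Lemma itv1E M t : itv1 M t = ((`|t| <= M)%R)%:R.
Proof. by rewrite /itv1 indicE mem_setE/= in_itv/= ler_norml. Qed.

Lemma itv1_ge0 M t : 0 <= itv1 M t.
Proof. by rewrite itv1E. Qed.

Lemma measurable_itv1 M : measurable_fun setT (itv1 M).
Proof. exact: measurable_indic. Qed.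

Lemma measurable_cube1 M : measurable_fun setT (cube1 M).
Proof. by apply: measurable_prodw => i; exact: measurable_itv1. Qed.

Lemma cube1_in M x : cubeRn M x -> cube1 M x = 1.
Proof. by move=> /cubeRnE xM; rewrite /cube1 /prodw big1// => i _; rewrite itv1E xM. Qed.

Lemma cube1_out M x : ~ cubeRn M x -> cube1 M x = 0.
Proof.
move=> xM; have /existsNP[i /negP xi] : ~ forall i, `|coord x i| <= M by move=> /cubeRnE.
by rewrite /cube1 /prodw (bigD1 i)//= itv1E (negbTE xi) mul0r.
Qed.

(** The case of the polynomial X, of degree 1, in the bound for polynomials: 80 = 40 * 2. *)
Lemma lorentz_itv_le (T c M : R) : 0 < T ->
  (\int[leb]_t (lorentz T (c - t) * itv1 M t)%:E <= 80%:E)%E.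
Proof.
move=> T0.
have -> : (\int[leb]_t (lorentz T (c - t) * itv1 M t)%:E =
   \int[leb]_(t in `[(- M)%R, M]) (`|('X : {poly R})^`().[t]| * lorentz T (c - 'X.[t]))%:E)%E.
  rewrite [RHS]integral_mkcond; apply: eq_integral => t _.
  rewrite patchE /itv1 indicE derivX hornerX hornerC normr1 mul1r.
  by case: (t \in _); rewrite ?mulr1 ?mulr0.
apply: (le_trans (@lorentz_poly_le _ 'X T c M 1 T0 _)); first by rewrite size_polyX.
by rewrite lee_fin expr1; lra.
Qed.

End cubes.

Section measurable_Rintegral.
Context dX dZ (X : measurableType dX) (Z : measurableType dZ) (R : realType).
Variable m : {sigma_finite_measure set X -> \bar R}.

(** Tonelli applies to the positive and negative parts separately, and [fine] is measurable, so
    measurability in the parameter holds even at points where the integral diverges. *)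
Lemma measurable_Rintegral (f : Z * X -> R) : measurable_fun setT f ->
  measurable_fun setT (fun z => Rintegral m setT (fun x => f (z, x))).
Proof.
move=> mf; rewrite /Rintegral.
have mE : measurable_fun setT (EFin \o f) by exact/measurable_EFinP.
apply: (@measurableT_comp _ _ _ _ _ _ (@fine R)); first exact: fine_measurable.
rewrite (_ : (fun z => _) = (fun z => fubini_F m ((EFin \o f)^\+)%E z - fubini_F m ((EFin \o f)^\-)%E z)%E).
  apply: emeasurable_funB; apply: measurable_fun_fubini_tonelli_F => //.
  - exact: measurable_funepos.
  - exact: measurable_funeneg.
apply/funext => z; rewrite [LHS]integralE /fubini_F/=.
by congr (_ - _)%E; apply: eq_integral => x _; rewrite ?funeposE ?funenegE.
Qed.

End measurable_Rintegral.

Lemma tau_oscillatory_le (R : realType) (T c : R) : 0 < T ->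
  `|Rintegral lebesgue_measure setT (fun t => tau T t * cos (t * c))| <= lorentz T c /\
  `|Rintegral lebesgue_measure setT (fun t => tau T t * sin (t * c))| <= lorentz T c.
Proof.
move=> T0; split.
  rewrite (_ : (fun t => _) = (fun t => tau T t * cos (c * t))); first exact: tau_cos_le.
  by apply/funext => t; rewrite [t * c]mulrC.
rewrite (_ : (fun t => _) = (fun t => tau T t * sin (c * t))).
  by rewrite tau_sin0// normr0 lorentz_ge0// ltW.
by apply/funext => t; rewrite [t * c]mulrC.
Qed.

Section kernel_bounds.
Variables (R : realType) (n : nat) (mu : {sigma_finite_measure set (Rn R n) -> \bar R}).
Notation leb := (@lebesgue_measure R).
Hypothesis muL : is_lebesgue_Rn mu.

Lemma integrable_bounded_cube (b : Rn R n -> R) (M c : R) : measurable_fun setT b ->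
  (forall x, cubeRn M x -> `|b x| <= c) ->
  mu.-integrable setT (EFin \o (fun x => b x * cube1 M x)).
Proof.
move=> mb bc.
have mc := @measurable_cube1 R n M.
have ic : mu.-integrable setT (EFin \o (fun x => c * cube1 M x)).
  apply/integrableP; split; first by apply/measurable_EFinP; exact: measurable_funM.
  rewrite (eq_integral (fun x => (`|c| * cube1 M x)%:E)); last first.
    move=> x _ /=; rewrite normrM (ger0_norm (x := cube1 M x))//.
    by apply: prodr_ge0 => i _; exact: itv1_ge0.
  under eq_integral do rewrite EFinM.
  rewrite ge0_integralZl//; last 2 first.
  - exact/measurable_EFinP.
  - by move=> x _; rewrite lee_fin; apply: prodr_ge0 => i _; exact: itv1_ge0.
  have h : (\int[mu]_x (cube1 M x)%:E <= (\prod_(i < n) (fine (leb `[(- M)%R, M]%classic)))%:E)%E.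
    apply: (@ge0_integral_prodw_le R n mu (fun _ => itv1 M)) => //.
    - by move=> i; exact: measurable_itv1.
    - move=> i; rewrite /itv1 integral_indic// setIT fineK//.
      by rewrite lebesgue_measure_itv/=; case: ifP.
  by rewrite lte_mul_pinfty// (le_lt_trans h)// ltry.
apply: le_integrable ic => //.
  by apply/measurable_EFinP; exact: measurable_funM.
move=> x _ /=; rewrite lee_fin !normrM.
have [xM|xM] := pselect (cubeRn M x); last by rewrite cube1_out// normr0 !mulr0.
by rewrite ler_wpM2r// (le_trans (bc x xM))// ler_norm.
Qed.

Lemma dotRnB (x y z : Rn R n) (u : Rn R n) : (forall i, coord u i = coord y i - coord z i) ->
  dotRn x u = dotRn x y - dotRn x z.
Proof.
by move=> h; rewrite /dotRn -sumrB; apply: eq_bigr => i _; rewrite h mulrBr.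
Qed.

Definition subRn (x y : Rn R n) : Rn R n := [tuple coord x i - coord y i | i < n].
Lemma coord_subRn x y i : coord (subRn x y) i = coord x i - coord y i.
Proof. by rewrite /coord tnth_mktuple. Qed.

(** Phases take the output variable first and the integration variable second; here the pair is (xi,
    x). *)
Definition fourier_phase (q : Rn R n * Rn R n) : R := - dotRn q.2 q.1.

Lemma measurable_fourier_phase : measurable_fun setT fourier_phase.
Proof.
apply: measurable_funN; apply: measurable_sum => i; apply: measurable_funM.
  exact: (measurable_fun_snd_comp (measurable_coord i)).
exact: (measurable_fun_fst_comp (measurable_coord i)).
Qed.

(** Schur's test with density [cube1 M] and one Lorentz factor per coordinate. In the constant, 2^n
    comes from the addition formulas, 80^n from the masses of the Lorentz factors and the leading 2
    from Schur; neither T nor M appears. *)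
Lemma fourier_cos_bound (T M : R) (h : Rn R n -> R) : 0 < T ->
  measurable_fun setT h -> (\int[mu]_x (h x ^+ 2)%:E < +oo)%E ->
  (\int[mu]_xi (prodw (fun _ => tau T) xi *
     (cos_transform mu fourier_phase (fun x => (cube1 M x * h x)%R) xi ^+ 2 +
      sin_transform mu fourier_phase (fun x => (cube1 M x * h x)%R) xi ^+ 2))%:E <=
    (2 * (2 ^+ n * 80 ^+ n))%:E * \int[mu]_x (h x ^+ 2)%:E)%E.
Proof.
move=> T0 mh h2; set p := fun x : Rn R n => cube1 M x * h x; set theta := fourier_phase.
(* An indicator is its own square root, which brings the density to the form sqrt b * h of Schur's
   test. *)
have pE : p = (fun x => Num.sqrt (1 * cube1 M x) * h x).
  apply/funext => x; rewrite /p mul1r; congr (_ * _).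
  have [xM|xM] := pselect (cubeRn M x); first by rewrite cube1_in// sqrtr1.
  by rewrite cube1_out// sqrtr0.
rewrite pE.
have mtheta : measurable_fun setT theta by exact: measurable_fourier_phase.
pose k (q : Rn R n * Rn R n) := 2 ^+ n * \prod_(i < n) lorentz T (coord q.1 i - coord q.2 i).
have osc (al : Rn R n) := @oscillatory_Rn_le R n mu (fun _ => tau T) al (fun i => lorentz T (coord al i)) muL
  (fun i => integrable_tau T0)
  (fun i => (tau_oscillatory_le (coord al i) T0).1) (fun i => (tau_oscillatory_le (coord al i) T0).2).
have c0 M' (x : Rn R n) : 0 <= cube1 M' x by apply: prodr_ge0 => i _; exact: itv1_ge0.
apply: (@schur_test _ _ _ _ _ mu mu theta (prodw (fun _ => tau T)) _ _ _ (fun x => 1 * cube1 M x) h k) => //.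
- by have [] := osc [tuple 0 | _ < n].
- by move=> z; apply: prodr_ge0 => i _; exact: tau_ge0.
- by move=> x; rewrite mul1r.
- by apply: (@integrable_bounded_cube (fun => 1) M 1) => // x _; rewrite normr1.
- apply: measurable_funM => //; apply: measurable_prod => i _.
  apply: (measurableT_comp (measurable_lorentz T)); apply: measurable_funB.
    exact: (measurable_fun_fst_comp (measurable_coord i)).
  exact: (measurable_fun_snd_comp (measurable_coord i)).
- move=> x y; rewrite /cos_kernel /theta /fourier_phase/=.
  have [_ h1 _] := osc (subRn y x); apply: le_trans (le_trans h1 _).
    rewrite le_eqVlt; apply/orP; left; apply/eqP; congr (`| _ |); apply: eq_Rintegral => z _.
    congr (_ * cos _); rewrite (dotRnB z (coord_subRn y x)) opprK addrC.
    by congr (_ - _); rewrite /dotRn; apply: eq_bigr => i _; rewrite mulrC.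
  rewrite /k ler_wpM2l ?exprn_ge0//; apply: ler_prod => i _.
  by rewrite coord_subRn (lorentz_ge0 _ (ltW T0)) -lorentzN opprB lexx.
- move=> x y; rewrite /k/=; congr (_ * _); apply: eq_bigr => i _.
  by rewrite -lorentzN opprB.
- move=> x.
  rewrite (eq_integral (fun y => (2 ^+ n)%:E * (prodw (fun i t => lorentz T (coord x i - t) * itv1 M t)
    y)%:E)%E); last first.
    move=> y _; rewrite -EFinM mul1r /k mulrCA; congr (EFin (_ * _)).
    by rewrite /cube1 /prodw mulrC -big_split.
  have ml (i : 'I_n) : measurable_fun setT (fun t : R => lorentz T (coord x i - t) * itv1 M t).
    apply: measurable_funM; last exact: measurable_itv1.
    by apply: (measurableT_comp (measurable_lorentz T)); exact: measurable_funB.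
  have l0 (i : 'I_n) t : 0 <= lorentz T (coord x i - t) * itv1 M t.
    by rewrite mulr_ge0 ?lorentz_ge0 ?itv1_ge0// ltW.
  rewrite ge0_integralZl//; last 2 first.
  + by apply/measurable_EFinP; exact: measurable_prodw.
  + by move=> y _; rewrite lee_fin; apply: prodr_ge0.
  rewrite EFinM; apply: lee_wpmul2l; first by rewrite lee_fin exprn_ge0.
  have := @ge0_integral_prodw_le R n mu _ (fun _ => 80) muL ml l0.
  rewrite prodr_const card_ord; apply => i; exact: lorentz_itv_le.
Qed.

(* [measurableTypeR R] carries the sigma-algebra on which [lebesgue_measure] is declared. *)
Definition smoothing_phase (a : mpoly.mpoly n R) (q : (measurableTypeR R * Rn R n) * Rn R n) : R :=
  q.1.1 * peval a q.2 + dotRn q.1.2 q.2.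

Lemma measurable_smoothing_phase a : measurable_fun setT (smoothing_phase a).
Proof.
apply: measurable_funD.
  apply: measurable_funM.
    by apply: (measurable_fun_fst_comp (f := fun z : measurableTypeR R * Rn R n => z.1)); exact: measurable_fst.
  exact: (measurable_fun_snd_comp (measurable_peval a)).
apply: measurable_sum => i; apply: measurable_funM.
  apply: (measurable_fun_fst_comp (f := fun z : measurableTypeR R * Rn R n => coord z.2 i)).
  exact: (measurable_fun_snd_comp (measurable_coord i)).
exact: (measurable_fun_snd_comp (measurable_coord i)).
Qed.

(** Direction j carries the decaying weight and will only be integrated in absolute value; the other
    directions carry cutoffs whose transforms concentrate near frequency 0. *)
Definition smoothing_weight (s T : R) (j i : 'I_n) : R -> R := if i == j then bracket_cut s T else tau T.

Definition bracket_cut_bound (s : R) : R := 2 * (2 `^ s / (2 * s - 1)).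

Lemma integrable_bracket_cut s T : 1 / 2 < s -> 0 < T -> leb.-integrable setT (EFin \o bracket_cut s T).
Proof.
move=> s12 T0; apply/integrableP; split; first by apply/measurable_EFinP; exact: measurable_bracket_cut.
rewrite (eq_integral (fun y : measurableTypeR R => (bracket_cut s T y)%:E)); last first.
  by move=> y _ /=; rewrite ger0_norm// bracket_cut_ge0.
by rewrite (le_lt_trans (bracket_cut_integral s12 T0))// ltry.
Qed.

Lemma bracket_cut_oscillatory_le s T (g : R -> R) : 1 / 2 < s -> 0 < T ->
  measurable_fun setT g -> (forall t, `|g t| <= 1) ->
  `|Rintegral leb setT (fun t => bracket_cut s T t * g t)| <= bracket_cut_bound s.
Proof.
move=> s12 T0 mg g1.
have io := integrable_bracket_cut s12 T0.
have iog := integrable_mul_bounded io mg g1.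
apply: le_trans (le_normr_Rintegral _ iog) _ => //.
apply: (@le_trans _ _ (Rintegral leb setT (bracket_cut s T))).
  apply: le_Rintegral => //; first exact: (integrable_norm iog).
  by move=> t _; rewrite normrM (ger0_norm (bracket_cut_ge0 _ _ _)) -[leRHS]mulr1 ler_wpM2l ?bracket_cut_ge0.
rewrite -lee_fin /Rintegral fineK; first exact: bracket_cut_integral.
exact: (integrable_fin_num _ io).
Qed.

(** The central estimate. The time cutoff yields a Lorentz factor in a(xi) - a(eta), each direction
    i <> j one in xi_i - eta_i, and direction j the constant [bracket_cut_bound s]. The density |d_j
    a| is the Jacobian that gives the first factor a bounded mass along direction j: 40 * 2^deg for
    it, 80 for each of the others, uniformly in T and M. *)
Lemma smoothing_cos_bound (a : mpoly.mpoly n R) (j : 'I_n) (s T M : R) (h : Rn R n -> R) :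
  1 / 2 < s -> 0 < T ->
  measurable_fun setT h -> (\int[mu]_x (h x ^+ 2)%:E < +oo)%E ->
  (\int[leb \x mu]_z (tau T z.1 * prodw (smoothing_weight s T j) z.2 *
     (cos_transform mu (smoothing_phase a) (fun x => (Num.sqrt (`|peval (mpoly.mderiv j a) x| * cube1 M x) *
       h x)%R) z ^+ 2 +
      sin_transform mu (smoothing_phase a) (fun x => (Num.sqrt (`|peval (mpoly.mderiv j a) x| * cube1 M x) *
        h x)%R) z ^+ 2))%:E <=
    (2 * (2 * 2 ^+ n * bracket_cut_bound s * (40 * 2 ^+ pdeg a j * \prod_(i < n | i != j) 80)))%:E *
       \int[mu]_x (h x ^+ 2)%:E)%E.
Proof.
move=> s12 T0 mh h2.
set theta := smoothing_phase a.
set rho := fun z : measurableTypeR R * Rn R n => tau T z.1 * prodw (smoothing_weight s T j) z.2.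
have mtheta : measurable_fun setT theta by exact: measurable_smoothing_phase.
pose c := 2 * 2 ^+ n * bracket_cut_bound s.
have om0 : 0 <= bracket_cut_bound s.
  by rewrite mulr_ge0// divr_ge0 ?powR_ge0//; lra.
have c0 : 0 <= c by apply: mulr_ge0 => //; apply: mulr_ge0 => //; exact: exprn_ge0.
pose P (x y : Rn R n) := \prod_(i < n | i != j) lorentz T (coord x i - coord y i).
pose k (q : Rn R n * Rn R n) := c * (lorentz T (peval a q.1 - peval a q.2) * P q.1 q.2).
have cube0 M' (x : Rn R n) : 0 <= cube1 M' x by apply: prodr_ge0 => i _; exact: itv1_ge0.
have mda := measurable_peval (mpoly.mderiv j a).
have mb : measurable_fun setT (fun x => `|peval (mpoly.mderiv j a) x|) by exact: measurableT_comp.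
pose w := smoothing_weight s T j.
have iw i : leb.-integrable setT (EFin \o w i).
  by rewrite /w /smoothing_weight; case: eqP => _; [exact: integrable_bracket_cut|exact: integrable_tau].
pose kap (al : Rn R n) i := if i == j then bracket_cut_bound s else lorentz T (coord al i).
have wc al i : `|Rintegral leb setT (fun t => w i t * cos (t * coord al i))| <= kap al i.
  rewrite /w /kap /smoothing_weight; case: eqP => _; last exact: (tau_oscillatory_le _ T0).1.
  apply: bracket_cut_oscillatory_le => //; last by move=> t; exact: cos_max.
  by apply: measurable_cos_comp; exact: measurable_funM.
have ws al i : `|Rintegral leb setT (fun t => w i t * sin (t * coord al i))| <= kap al i.
  rewrite /w /kap /smoothing_weight; case: eqP => _; last exact: (tau_oscillatory_le _ T0).2.
  apply: bracket_cut_oscillatory_le => //; last by move=> t; exact: sin_max.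
  by apply: measurable_sin_comp; exact: measurable_funM.
have osc (al : Rn R n) := oscillatory_Rn_le muL iw (wc al) (ws al).
(* Schur's test takes a measure with sigma-finite structure on the output space, so the space-time
   product is repackaged. *)
have [nu nuE] := sigma_finite_measureP (sigma_finite_product leb mu).
have nuI (f : measurableTypeR R * Rn R n -> \bar R) : (\int[leb \x mu]_z f z = \int[nu]_z f z)%E.
  by apply: eq_measure_integral => A _ _; exact/esym/nuE.
rewrite nuI.
have irho : nu.-integrable setT (EFin \o rho).
  have [ip _ _] := osc [tuple 0 | _ < n].
  have /integrableP[mr ir] := integrable_prod_mul (integrable_tau T0) ip.
  by apply/integrableP; split => //; rewrite -nuI.
have w0 i t : 0 <= w i t.
  by rewrite /w /smoothing_weight; case: eqP => _; [exact: bracket_cut_ge0|exact: tau_ge0].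
have [cb bcb] := peval_bounded (mpoly.mderiv j a) M.
have rho0 z : 0 <= rho z.
  by rewrite mulr_ge0 ?tau_ge0//; apply: prodr_ge0 => i _; exact: w0.
have := @schur_test _ _ _ _ _ mu nu theta rho mtheta irho rho0
  (fun x => `|peval (mpoly.mderiv j a) x| * cube1 M x) h k (c * (40 * 2 ^+ pdeg a j * \prod_(i < n | i != j) 80)).
apply => //.
- by move=> x; rewrite mulr_ge0.
- apply: (@integrable_bounded_cube _ M cb) => // x xM.
  by rewrite normr_id; exact: bcb.
- apply: measurable_funM => //; apply: measurable_funM.
    apply: (measurableT_comp (measurable_lorentz T)); apply: measurable_funB.
      exact: (measurable_fun_fst_comp (measurable_peval a)).
    exact: (measurable_fun_snd_comp (measurable_peval a)).
  rewrite /P; under eq_fun do rewrite big_mkcond/=.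
  apply: measurable_prod => i _; case: (i != j) => //.
  apply: (measurableT_comp (measurable_lorentz T)); apply: measurable_funB.
    exact: (measurable_fun_fst_comp (measurable_coord i)).
  exact: (measurable_fun_snd_comp (measurable_coord i)).
- move=> x y; rewrite /cos_kernel /Rintegral -nuI.
  have [iw' h1 h2'] := osc (subRn x y).
  have mt : measurable_fun setT (fun t : measurableTypeR R => t * (peval a x - peval a y)) by exact: measurable_funM.
  have [+ _] := oscillatory_prod_le (integrable_tau T0) iw' mt (measurable_dotRn (subRn x y))
    (tau_oscillatory_le (peval a x - peval a y) T0).1 (tau_oscillatory_le (peval a x - peval a y) T0).2 h1 h2'.
  move=> h3; apply: le_trans (le_trans h3 _).
    rewrite le_eqVlt; apply/orP; left; apply/eqP; congr (`| _ |); apply: eq_Rintegral => z _.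
    congr (_ * cos _); rewrite (dotRnB z.2 (coord_subRn x y)) /theta /smoothing_phase/=; ring.
  rewrite le_eqVlt; apply/orP; left; apply/eqP.
  rewrite /k /c /P/= (bigD1 j)//= {1}/kap eqxx (eq_bigr (fun i => lorentz T (coord x i - coord y i))); first by ring.
  by move=> i ij; rewrite /kap (negbTE ij) coord_subRn.
- move=> x y; rewrite /k/=; congr (_ * (_ * _)); first by rewrite -lorentzN opprB.
  by apply: eq_bigr => i _; rewrite -lorentzN opprB.
move=> x.
(* The cube indicator is distributed: its j-th factor goes to H, where it bounds the slice, and the
   i-th one joins the Lorentz factor of direction i. *)
pose H y : R := `|peval (mpoly.mderiv j a) y| * lorentz T (peval a x - peval a y) * itv1 M (coord y j).
pose w' i t := lorentz T (coord x i - t) * itv1 M t.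
rewrite (eq_integral (fun y => c%:E * (H y * \prod_(i < n | i != j) w' i (coord y i))%:E)%E); last first.
  move=> y _; rewrite -EFinM; congr EFin.
  by rewrite /k /H /w' big_split/= /cube1 /prodw (bigD1 j)//= /P; ring.
have ml (i : 'I_n) : measurable_fun setT (w' i).
  apply: measurable_funM; last exact: measurable_itv1.
  by apply: (measurableT_comp (measurable_lorentz T)); exact: measurable_funB.
have l0 (i : 'I_n) t : 0 <= w' i t.
  by rewrite mulr_ge0 ?lorentz_ge0 ?itv1_ge0// ltW.
have mH : measurable_fun setT H.
  apply: measurable_funM; last exact: (measurableT_comp (measurable_itv1 M) (measurable_coord j)).
  apply: measurable_funM => //; apply: (measurableT_comp (measurable_lorentz T)).
  by apply: measurable_funB => //; exact: measurable_peval.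
have H0 y : 0 <= H y by apply: mulr_ge0; [apply: mulr_ge0 => //; exact/lorentz_ge0/ltW|exact: itv1_ge0].
rewrite ge0_integralZl//; last 2 first.
- apply/measurable_EFinP; apply: measurable_funM => //.
  under eq_fun do rewrite big_mkcond/=.
  apply: measurable_prod => i _; case: (i != j) => //.
  exact: measurableT_comp (ml i) (measurable_coord i).
- by move=> y _; rewrite lee_fin mulr_ge0// prodr_ge0.
rewrite (EFinM c); apply: lee_wpmul2l; first by rewrite lee_fin.
apply: (@coord_slice_integral_le R n mu j H w' (fun _ => 80)) => //.
- by move=> i; exact: lorentz_itv_le.
(* Along direction j, a is a polynomial p and d_j a is its derivative, so H is exactly the integrand
   of [lorentz_poly_le]. *)
move=> y; have [p [sp pE p'E]] := peval_slice a y j.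
apply: le_trans (@lorentz_poly_le _ p T (peval a x) M _ T0 sp).
rewrite [leRHS]integral_mkcond le_eqVlt; apply/orP; left; apply/eqP.
apply: eq_integral => t _; rewrite patchE /H pE p'E coord_updRn eqxx /itv1 indicE.
by case: (t \in _); rewrite ?mulr1 ?mulr0.
Qed.

End kernel_bounds.

(** * Completeness of weighted L^2 *)

Section exhaustion.
Context d (T : measurableType d) (R : realType) (m : {measure set T -> \bar R}).

Lemma ge0_integral_exhaustion_le (F : (set T)^nat) (f : T -> \bar R) (C : \bar R) :
  nondecreasing_seq F -> (forall k, measurable (F k)) -> \bigcup_k F k = setT ->
  measurable_fun setT f -> (forall x, (0 <= f x)%E) ->
  (forall k, (\int[m]_(x in F k) f x <= C)%E) -> (\int[m]_x f x <= C)%E.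
Proof.
move=> ndF mF FT mf f0 fC.
have h : (\int[m]_(x in F i) f x @[i --> \oo] --> \int[m]_(x in \bigcup_i F i) f x)%E.
  apply: ge0_nondecreasing_set_cvg_integral => //.
  by move=> i; exact: measurable_funTS.
rewrite FT in h; rewrite -(cvg_lim _ h)//; apply: lime_le.
  by apply/cvg_ex; eexists; exact: h.
by apply: nearW.
Qed.

(** How T tends to infinity: on F k the cutoff weight is at least c v, so a bound uniform in k for
    the cutoff weights gives a bound for v on each F k, at the price of 1/c, and then on the whole
    space. *)
Lemma weighted_exhaustion_le (F : (set T)^nat) (rho : nat -> T -> R) (v G : T -> R) (c K : R) :
  nondecreasing_seq F -> (forall k, measurable (F k)) -> \bigcup_k F k = setT ->
  measurable_fun setT v -> (forall x, 0 <= v x) ->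
  (forall k, measurable_fun setT (rho k)) ->
  (forall k x, 0 <= rho k x) ->
  measurable_fun setT G -> (forall x, 0 <= G x) -> 0 < c ->
  (forall k x, F k x -> c * v x <= rho k x) ->
  (forall k, (\int[m]_x (rho k x * G x)%:E <= K%:E)%E) ->
  (\int[m]_x (v x * G x)%:E <= (c^-1 * K)%:E)%E.
Proof.
move=> ndF mF FT mv v0 mrho rho0 mG G0 c0 Fv rhoK.
apply: (ge0_integral_exhaustion_le ndF mF FT).
- by apply/measurable_EFinP; exact: measurable_funM.
- by move=> x; rewrite lee_fin mulr_ge0.
move=> k; rewrite EFinM.
apply: (@le_trans _ _ (c^-1%:E * \int[m]_x (rho k x * G x)%:E)%E); last first.
  by apply: lee_wpmul2l => //; rewrite lee_fin invr_ge0 ltW.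
rewrite -ge0_integralZl//; last 3 first.
- by apply/measurable_EFinP; exact: measurable_funM.
- by move=> x _; rewrite lee_fin mulr_ge0.
- by rewrite lee_fin invr_ge0 ltW.
apply: (@le_trans _ _ (\int[m]_(x in F k) (c^-1%:E * (rho k x * G x)%:E))%E).
  apply: ge0_le_integral => //.
  - by move=> x _; rewrite lee_fin mulr_ge0.
  - by apply/measurable_EFinP; apply: measurable_funTS; exact: measurable_funM.
  - apply: measurable_funTS; apply: measurable_funeM; apply/measurable_EFinP; exact: measurable_funM.
  move=> x Fx; rewrite -EFinM lee_fin mulrA ler_wpM2r// mulrC ler_pdivlMr// mulrC.
  exact: Fv.
apply: ge0_subset_integral => //.
- apply: measurable_funeM; apply/measurable_EFinP; exact: measurable_funM.
- by move=> x _; rewrite -EFinM lee_fin mulr_ge0 ?mulr_ge0// invr_ge0 ltW.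
Qed.

End exhaustion.

Lemma limn_einf_le (R : realType) (f : (\bar R)^nat) (c : \bar R) :
  (forall j, (f j <= c)%E) -> (limn_einf f <= c)%E.
Proof.
move=> fc; rewrite limn_einf_lim; apply: lime_le; first exact: is_cvg_einfs.
apply: nearW => j; apply: le_trans (fc j).
by apply: ereal_inf_lbound; exists j => /=.
Qed.

Lemma limn_einf_ge0 (R : realType) (f : (\bar R)^nat) :
  (forall j, (0 <= f j)%E) -> (0 <= limn_einf f)%E.
Proof.
move=> f0; rewrite limn_einf_lim; apply: lime_ge; first exact: is_cvg_einfs.
by apply: nearW => j; apply: le_ereal_inf_tmp => _ [i /= _ <-].
Qed.

Section L2_complete.
Context d (T : measurableType d) (R : realType) (m : {measure set T -> \bar R}).

(** Each term is at most the sum S, so increment j is at most sqrt S * 2^-j, and the telescoping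
    series is dominated by a geometric one. *)
Lemma cvgn_of_weighted_increments (u : nat -> R) :
  (\sum_(j <oo) (4 ^+ j * (u j.+1 - u j) ^+ 2)%:E < +oo)%E -> cvgn u.
Proof.
set S := (X in (X < _)%E) => Sfin.
have t0 j : 0 <= 4 ^+ j * (u j.+1 - u j) ^+ 2 by apply: mulr_ge0; [exact: exprn_ge0|exact: sqr_ge0].
have S0 : (0 <= S)%E by apply: nneseries_ge0 => j _ _; rewrite lee_fin.
have SE : S = (fine S)%:E by rewrite fineK// ge0_fin_numE.
have dj j : `|u j.+1 - u j| <= geometric (Num.sqrt (fine S)) 2^-1 j.
  have : ((4 ^+ j * (u j.+1 - u j) ^+ 2)%:E <= S)%E.
    apply: le_trans (nneseries_lim_ge j.+1 _); last by move=> i _ _; rewrite lee_fin.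
    by rewrite big_nat_recr//= leeDr// sume_ge0// => i _; rewrite lee_fin.
  rewrite SE lee_fin => h.
  have fS0 : 0 <= fine S by exact: fine_ge0.
  rewrite /geometric/= exprVn ler_pdivlMr ?exprn_gt0//.
  rewrite -(ler_pXn2r (n := 2)) ?nnegrE ?mulr_ge0 ?exprn_ge0 ?sqrtr_ge0//.
  rewrite sqr_sqrtr// exprMn real_normK ?num_real// -exprM mulnC exprM mulrC.
  by rewrite (_ : 2 ^+ 2 = 4 :> R)//; ring.
have cs : cvgn (series (telescope u)).
  apply: normed_cvg; apply: (@series_le_cvg _ _ (geometric (Num.sqrt (fine S)) 2^-1)) => //.
  - by move=> j /=.
  - by move=> j; apply: mulr_ge0; [exact: sqrtr_ge0|rewrite exprn_ge0// invr_ge0].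
  - apply: is_cvg_geometric_series; rewrite ger0_norm ?invr_ge0//.
    by rewrite invf_lt1// ltr1n.
rewrite (_ : u = (fun n => u 0%N + series (telescope u) n)).
  by apply: is_cvgD => //; exact: is_cvg_cst.
by apply/funext => n; exact: eq_sum_telescope.
Qed.

(* Fatou along an almost everywhere convergent subsequence; the limit is set to 0
   where the series of weighted squared increments diverges. *)
Lemma L2_complete (u : nat -> T -> R) (eps : nat -> \bar R) :
  (forall k, measurable_fun setT (u k)) -> eps @ \oo --> 0%E ->
  (forall k l, (k <= l)%N -> (\int[m]_x ((u l x - u k x) ^+ 2)%:E <= eps k)%E) ->
  exists2 W : T -> R, measurable_fun setT W &
    forall k, (\int[m]_x ((u k x - W x) ^+ 2)%:E <= eps k)%E.
Proof.
move=> mu eps0 ueps.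
(* The rate 8^-j leaves 4^j * 8^-j = 2^-j, still summable, after multiplication by the weights
   4^j. *)
have /choice[N HN] : forall j : nat, exists N : nat, forall k, (N <= k)%N -> (eps k <= (8 ^- j)%:E)%E.
  move=> j; have /fine_cvgP[efin ecvg] := eps0.
  have e0 : 0 < (8 : R) ^- j by rewrite invr_gt0 exprn_gt0.
  have hd : \forall k \near \oo, `|0 - (fine \o eps) k| < 8 ^- j.
    by move/cvgrPdist_lt : ecvg => /(_ _ e0).
  have [N _ HN] : \forall k \near \oo, eps k \is a fin_num /\ `|0 - (fine \o eps) k| < 8 ^- j.
    by near=> k; split; near: k.
  exists N => k Nk; have [ef] := HN k Nk; rewrite sub0r normrN => h1.
  by rewrite -(fineK ef) lee_fin; apply/ltW/(le_lt_trans _ h1)/ler_norm.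
(* Partial sums of N i + 1 are nondecreasing and dominate both N j and j, the three properties
   wanted of the subsequence. *)
pose phi (j : nat) : nat := (\sum_(i < j.+1) (N i).+1)%N.
have phiS j : (phi j <= phi j.+1)%N by rewrite {2}/phi big_ord_recr/= leq_addr.
have phiN j : (N j <= phi j)%N by rewrite /phi big_ord_recr/= (leq_trans (leqnSn _))// leq_addl.
have phij j : (j <= phi j)%N.
  elim: j => // j IH; rewrite /phi big_ord_recr/= -/(phi j) -addn1 addnS addn0.
  by rewrite addnS ltnS (leq_trans IH)// leq_addr.
pose t j x := 4 ^+ j * (u (phi j.+1) x - u (phi j) x) ^+ 2.
have t0 j x : 0 <= t j x by apply: mulr_ge0; [exact: exprn_ge0|exact: sqr_ge0].
have mt j : measurable_fun setT (t j).
  by apply: measurable_funM => //; apply: measurable_funX; exact: measurable_funB.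
pose S x := (\sum_(j <oo) (t j x)%:E)%E.
have S0 x : (0 <= S x)%E by apply: nneseries_ge0 => j _ _; rewrite lee_fin.
have mS : measurable_fun setT S.
  by apply: ge0_emeasurable_sum => // j; [move=> x _ _; rewrite lee_fin|move=> _; exact/measurable_EFinP].
have intS : (\int[m]_x S x < +oo)%E.
  rewrite integral_nneseries//; last 2 first.
  - by move=> j; exact/measurable_EFinP.
  - by move=> j x _; rewrite lee_fin.
  apply: (@le_lt_trans _ _ (\sum_(j <oo) ((2 : R) / (2 ^ (j + 1))%:R)%:E)%E).
    apply: lee_nneseries => [j _ _|j _].
      by apply: integral_ge0 => x _; rewrite lee_fin.
    under eq_integral do rewrite /t EFinM.
    rewrite ge0_integralZl//; last 2 first.
    - by apply/measurable_EFinP; apply: measurable_funX; exact: measurable_funB.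
    - by move=> x _; rewrite lee_fin sqr_ge0.
    apply: (@le_trans _ _ ((4 ^+ j)%:E * (8 ^- j)%:E)%E).
      apply: lee_wpmul2l; first by rewrite lee_fin exprn_ge0.
      by apply: le_trans (ueps _ _ (phiS j)) _; exact: HN.
    rewrite -EFinM lee_fin expnD expn1 natrM natrX invfM mulrCA divff// mulr1.
    rewrite -exprVn -exprMn -exprVn (_ : 4 / 8 = 2^-1)//.
    by rewrite (_ : 8 = 4 * 2) ?invfM ?mulrA ?divff ?mul1r//; ring.
  have := @cvg_geometric_eseries_half R 2 0; rewrite expr0 divr1 => /cvg_lim.
  by rewrite /eseries => ->//; rewrite ltry.
have cvgS x : (S x < +oo)%E -> cvgn (fun j => u (phi j) x).
  by move=> Sx; exact: cvgn_of_weighted_increments.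
pose E := [set x | (S x < +oo)%E].
have mE : measurable E.
  rewrite (_ : E = setT `&` [set x | (S x < (cst +oo) x)%E]); last by rewrite setTI.
  exact: emeasurable_fun_lt.
pose h j x := u (phi j) x * \1_E x.
have mh j : measurable_fun setT (h j).
  by apply: measurable_funM => //; exact: measurable_indic.
have cvgh x : cvgn (h ^~ x).
  rewrite /h indicE; case: (boolP (x \in E)) => xE /=.
    by under eq_fun do rewrite mulr1; apply: cvgS; move: xE; rewrite inE.
  by under eq_fun do rewrite mulr0; exact: is_cvg_cst.
exists (fun x => limn (h ^~ x)).
  by apply: (measurable_fun_cvg mh) => x _; exact: cvgh.
move=> k.
(* The shift by k ensures k <= phi (j + k) for every j, so the Cauchy bound applies to all terms of
   the sequence given to Fatou. *)
pose g j x := ((u k x - u (phi (j + k)) x) ^+ 2)%:E.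
have mg j : measurable_fun setT (g j).
  by apply/measurable_EFinP; apply: measurable_funX; exact: measurable_funB.
apply: (@le_trans _ _ (\int[m]_x limn_einf (g ^~ x))%E).
  apply: ae_ge0_le_integral => //.
  - by move=> x _; rewrite lee_fin sqr_ge0.
  - apply/measurable_EFinP; apply: measurable_funX; apply: measurable_funB => //.
    by apply: (measurable_fun_cvg mh) => x _; exact: cvgh.
  - by move=> x _; apply: limn_einf_ge0 => j; rewrite lee_fin sqr_ge0.
  - apply: (emeasurable_fun_cvg (fun n x => einfs (g ^~ x) n)).
      by move=> n; exact: measurable_fun_einfs.
    by move=> x _; rewrite limn_einf_lim; exact: is_cvg_einfs.
  have iS : m.-integrable setT S.
    by apply/integrableP; split => //; under eq_integral do rewrite gee0_abs//.
  apply: filterS (integrable_ae measurableT iS) => x /(_ I) Sx _.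
  have xE : x \in E by rewrite inE/= /E/= -ge0_fin_numE.
  have hE : h ^~ x = (fun j => u (phi j) x).
    by apply/funext => j; rewrite /h indicE xE mulr1.
  have gl : g j x @[j --> \oo] --> ((u k x - limn (h ^~ x)) ^+ 2)%:E.
    apply: cvg_EFin; first exact: nearW.
    have ul : (fun j => u (phi (j + k)%N) x) @ \oo --> limn (h ^~ x).
      by have := cvgh x; rewrite hE => cu; have := cu; rewrite -(cvg_shiftn k).
    rewrite (_ : _ \o _ = fun j => (u k x - u (phi (j + k)%N) x) * (u k x - u (phi (j + k)%N) x)); last first.
      by apply/funext => j; rewrite /= expr2.
    by rewrite expr2; apply: cvgM; apply: cvgB; [exact: cvg_cst|exact: ul|exact: cvg_cst|exact: ul].
  by have [-> _] := cvg_limn_einf_sup gl.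
apply: le_trans (fatou _ _ _ _) _ => //.
  by move=> j x _; rewrite lee_fin sqr_ge0.
apply: limn_einf_le => j; apply: le_trans (ueps k (phi (j + k)%N) _); last first.
  by rewrite (leq_trans _ (phij _))// leq_addl.
rewrite le_eqVlt; apply/orP; left; apply/eqP; apply: eq_integral => x _.
by rewrite /g -sqrrN opprB.
Unshelve. all: by end_near. Qed.

End L2_complete.

Section L2_complete_complex.
Context d (T : measurableType d) (R : realType) (m : {measure set T -> \bar R}).
Local Open Scope complex_scope.

Lemma measurable_cnorm2 (f : T -> R[i]) : cmeasurable f -> measurable_fun setT (fun x => cnorm2 (f x)).
Proof. by move=> [mr mi]; apply: measurable_funD; exact: measurable_funX. Qed.

Lemma cnorm2_ge0 (z : R[i]) : 0 <= cnorm2 z.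
Proof. by rewrite addr_ge0 ?sqr_ge0. Qed.

Lemma cmeasurableB (f g : T -> R[i]) : cmeasurable f -> cmeasurable g -> cmeasurable (fun x => f x - g x).
Proof.
move=> [fr fi] [gr gi]; split.
  by rewrite (_ : (fun x => _) = (fun x => complex.Re (f x) - complex.Re (g x)));
    [exact: measurable_funB|apply/funext => x; case: (f x); case: (g x)].
by rewrite (_ : (fun x => _) = (fun x => complex.Im (f x) - complex.Im (g x)));
    [exact: measurable_funB|apply/funext => x; case: (f x); case: (g x)].
Qed.

Lemma cnorm2B (z w : R[i]) :
  cnorm2 (z - w) = (complex.Re z - complex.Re w) ^+ 2 + (complex.Im z - complex.Im w) ^+ 2.
Proof. by case: z => a b; case: w => e f. Qed.

(** The right-hand side minus the left-hand side is |2 z - w|^2. *)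
Lemma cnorm2_le_split (z w : R[i]) : cnorm2 w <= 2 * cnorm2 (z - w) + 2 * cnorm2 z.
Proof.
rewrite cnorm2B /cnorm2; case: z => a b; case: w => e f /=.
have := sqr_ge0 (2 * a - e); have := sqr_ge0 (2 * b - f); nra.
Qed.

(** Multiplication by sqrt v reduces to the unweighted real case, applied to real and imaginary
    parts. Each part is within eps k of its limit, hence the sum of two eps k; positivity of v
    allows dividing back. *)
Lemma weighted_L2_complete (v : T -> R) (u : nat -> T -> R[i]) (eps : nat -> \bar R) :
  measurable_fun setT v -> (forall x, 0 < v x) ->
  (forall k, cmeasurable (u k)) -> eps @ \oo --> 0%E ->
  (forall k l, (k <= l)%N -> (\int[m]_x (v x * cnorm2 (u l x - u k x))%:E <= eps k)%E) ->
  exists2 W : T -> R[i], cmeasurable W &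
    forall k, (\int[m]_x (v x * cnorm2 (u k x - W x))%:E <= eps k + eps k)%E.
Proof.
move=> mv v0 mu eps0 ueps.
have msv : measurable_fun setT (fun x => Num.sqrt (v x)).
  by apply: (measurableT_comp _ mv); apply: continuous_measurable_fun; exact: sqrt_continuous.
have sv0 x : 0 < Num.sqrt (v x) by rewrite sqrtr_gt0.
have sv2 x : Num.sqrt (v x) ^+ 2 = v x by rewrite sqr_sqrtr// ltW.
have msvV : measurable_fun setT (fun x => (Num.sqrt (v x))^-1).
  rewrite (_ : (fun x => _) = (fun x => Num.sqrt (v x) `^ (-1))).
    exact: (measurableT_comp (@measurable_powR R (-1)) msv).
  by apply/funext => x; rewrite powR_inv1// ltW.
have mcn k l : measurable_fun setT (fun x => (v x * cnorm2 (u l x - u k x))%:E).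
  by apply/measurable_EFinP; apply: measurable_funM => //; apply: measurable_cnorm2; exact: cmeasurableB.
have hr k l : (k <= l)%N -> (\int[m]_x ((Num.sqrt (v x) * complex.Re (u l x) - Num.sqrt (v x) * complex.Re (u
  k x)) ^+ 2)%:E <= eps k)%E.
  move=> kl; apply: le_trans (ueps k l kl); apply: ge0_le_integral => //.
  - by move=> x _; rewrite lee_fin sqr_ge0.
  - have [mr _] := mu l; have [mr' _] := mu k.
    by apply/measurable_EFinP; apply: measurable_funX; apply: measurable_funB; exact: measurable_funM.
  - move=> x _; rewrite lee_fin -mulrBr exprMn sv2; apply: ler_wpM2l; first exact: ltW.
    by rewrite cnorm2B lerDl sqr_ge0.
have hi k l : (k <= l)%N -> (\int[m]_x ((Num.sqrt (v x) * complex.Im (u l x) - Num.sqrt (v x) * complex.Im (u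
  k x)) ^+ 2)%:E <= eps k)%E.
  move=> kl; apply: le_trans (ueps k l kl); apply: ge0_le_integral => //.
  - by move=> x _; rewrite lee_fin sqr_ge0.
  - have [_ mr] := mu l; have [_ mr'] := mu k.
    by apply/measurable_EFinP; apply: measurable_funX; apply: measurable_funB; exact: measurable_funM.
  - move=> x _; rewrite lee_fin -mulrBr exprMn sv2; apply: ler_wpM2l; first exact: ltW.
    by rewrite cnorm2B lerDr sqr_ge0.
have [Wr mWr Wrl] := L2_complete (fun k => measurable_funM msv (mu k).1) eps0 hr.
have [Wi mWi Wil] := L2_complete (fun k => measurable_funM msv (mu k).2) eps0 hi.
exists (fun x => (Wr x / Num.sqrt (v x)) +i* (Wi x / Num.sqrt (v x))).
  by split => /=; exact: measurable_funM.
move=> k; apply: le_trans (leeD (Wrl k) (Wil k)).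
have [mr mi] := mu k.
rewrite -ge0_integralD//.
- rewrite le_eqVlt; apply/orP; left; apply/eqP; apply: eq_integral => x _.
  rewrite -EFinD; congr EFin; rewrite cnorm2B /= -{1}(sv2 x).
  by field; rewrite gt_eqF.
- by move=> x _; rewrite lee_fin sqr_ge0.
- by apply/measurable_EFinP; apply: measurable_funX; apply: measurable_funB => //; exact: measurable_funM.
- by move=> x _; rewrite lee_fin sqr_ge0.
- by apply/measurable_EFinP; apply: measurable_funX; apply: measurable_funB => //; exact: measurable_funM.
Qed.

End L2_complete_complex.

(** * Truncated oscillatory transforms *)

Section oscillatory_transform.
Context dX dZ (X : measurableType dX) (Z : measurableType dZ) (R : realType).
Variables (m : {sigma_finite_measure set X -> \bar R}) (theta : Z * X -> R).
Hypothesis mtheta : measurable_fun setT theta.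
Local Open Scope complex_scope.

Definition cintegrable (p : X -> R[i]) :=
  m.-integrable setT (EFin \o (fun x => complex.Re (p x))) /\
  m.-integrable setT (EFin \o (fun x => complex.Im (p x))).

Definition osc_transform (p : X -> R[i]) (z : Z) : R[i] :=
  cintegral m setT (fun x => cexpi (theta (z, x)) * p x).

(** The squared modulus of the oscillatory integral with real density r. *)
Definition osc_energy (r : X -> R) (z : Z) : R :=
  cos_transform m theta r z ^+ 2 + sin_transform m theta r z ^+ 2.

Lemma osc_energy_ge0 r z : 0 <= osc_energy r z.
Proof. by rewrite addr_ge0 ?sqr_ge0. Qed.

Lemma integrable_mul_cos (p : X -> R) z : m.-integrable setT (EFin \o p) ->
  m.-integrable setT (EFin \o (fun x => p x * cos (theta (z, x)))).
Proof.
move=> ip; apply: integrable_mul_bounded => //; last by move=> x; exact: cos_max.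
by apply: measurable_cos_comp; exact: measurable_fun_pair2.
Qed.

Lemma integrable_mul_sin (p : X -> R) z : m.-integrable setT (EFin \o p) ->
  m.-integrable setT (EFin \o (fun x => p x * sin (theta (z, x)))).
Proof.
move=> ip; apply: integrable_mul_bounded => //; last by move=> x; exact: sin_max.
by apply: measurable_sin_comp; exact: measurable_fun_pair2.
Qed.

Lemma cos_transformD (p q : X -> R) z :
  m.-integrable setT (EFin \o p) -> m.-integrable setT (EFin \o q) ->
  cos_transform m theta (fun x => p x + q x) z = cos_transform m theta p z + cos_transform m theta q z.
Proof.
move=> ip iq; rewrite /cos_transform.
rewrite -(RintegralD measurableT (integrable_mul_cos z ip) (integrable_mul_cos z iq)).
by apply: eq_Rintegral => x _; rewrite mulrDl.
Qed.

Lemma sin_transformD (p q : X -> R) z :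
  m.-integrable setT (EFin \o p) -> m.-integrable setT (EFin \o q) ->
  sin_transform m theta (fun x => p x + q x) z = sin_transform m theta p z + sin_transform m theta q z.
Proof.
move=> ip iq; rewrite /sin_transform.
rewrite -(RintegralD measurableT (integrable_mul_sin z ip) (integrable_mul_sin z iq)).
by apply: eq_Rintegral => x _; rewrite mulrDl.
Qed.

Lemma cos_transformB (p q : X -> R) z :
  m.-integrable setT (EFin \o p) -> m.-integrable setT (EFin \o q) ->
  cos_transform m theta (fun x => p x - q x) z = cos_transform m theta p z - cos_transform m theta q z.
Proof.
move=> ip iq; rewrite /cos_transform.
rewrite -(RintegralB measurableT (integrable_mul_cos z ip) (integrable_mul_cos z iq)).
by apply: eq_Rintegral => x _; rewrite mulrBl.
Qed.

Lemma sin_transformB (p q : X -> R) z :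
  m.-integrable setT (EFin \o p) -> m.-integrable setT (EFin \o q) ->
  sin_transform m theta (fun x => p x - q x) z = sin_transform m theta p z - sin_transform m theta q z.
Proof.
move=> ip iq; rewrite /sin_transform.
rewrite -(RintegralB measurableT (integrable_mul_sin z ip) (integrable_mul_sin z iq)).
by apply: eq_Rintegral => x _; rewrite mulrBl.
Qed.

Lemma cos_sin_transform_sum n (p : 'I_n -> X -> R) z :
  (forall j, m.-integrable setT (EFin \o p j)) ->
  cos_transform m theta (fun x => \sum_j p j x) z = \sum_j cos_transform m theta (p j) z /\
  sin_transform m theta (fun x => \sum_j p j x) z = \sum_j sin_transform m theta (p j) z.
Proof.
elim: n p => [|n IH] p ip.
  rewrite !big_ord0 /cos_transform /sin_transform; split.
    by under eq_Rintegral do rewrite big_ord0 mul0r; rewrite Rintegral_cst// mul0r.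
  by under eq_Rintegral do rewrite big_ord0 mul0r; rewrite Rintegral_cst// mul0r.
have -> : (fun x => \sum_j p j x) = (fun x => p ord0 x + \sum_(j < n) p (lift ord0 j) x).
  by apply/funext => x; rewrite big_ord_recl.
have [h1 h2] := IH (fun j => p (lift ord0 j)) (fun j => ip _).
have is_ : m.-integrable setT (EFin \o (fun x => \sum_(j < n) p (lift ord0 j) x)).
  rewrite (_ : _ \o _ = (fun x => \sum_(j < n) (p (lift ord0 j) x)%:E)%E).
    by apply: integrable_sum => // j _; exact: ip.
  by apply/funext => x /=; rewrite sumEFin.
by rewrite cos_transformD// sin_transformD// h1 h2 !big_ord_recl.
Qed.

Lemma osc_transformE p z : cintegrable p ->
  osc_transform p z =
    (cos_transform m theta (fun x => complex.Re (p x)) z - sin_transform m theta (fun x => complex.Im (p x)) z) +i*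
    (sin_transform m theta (fun x => complex.Re (p x)) z + cos_transform m theta (fun x => complex.Im (p x)) z).
Proof.
move=> [ir ii]; rewrite /osc_transform /cintegral; congr (_ +i* _).
  rewrite /cos_transform /sin_transform.
  rewrite -(RintegralB measurableT (integrable_mul_cos z ir) (integrable_mul_sin z ii)).
  by apply: eq_Rintegral => x _; case: (p x) => a b /=; ring.
rewrite /cos_transform /sin_transform.
rewrite -(RintegralD measurableT (integrable_mul_sin z ir) (integrable_mul_cos z ii)).
by apply: eq_Rintegral => x _; case: (p x) => a b /=; ring.
Qed.

Lemma osc_transformB p q z : cintegrable p -> cintegrable q ->
  osc_transform p z - osc_transform q z = osc_transform (fun x => p x - q x) z.
Proof.
move=> ip iq; have [ipr ipi] := ip; have [iqr iqi] := iq.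
have rE : (fun x => complex.Re (p x - q x)) = (fun x => complex.Re (p x) - complex.Re (q x)).
  by apply/funext => x; case: (p x); case: (q x).
have iE : (fun x => complex.Im (p x - q x)) = (fun x => complex.Im (p x) - complex.Im (q x)).
  by apply/funext => x; case: (p x); case: (q x).
have ipq : cintegrable (fun x => p x - q x).
  split; rewrite ?rE ?iE.
    by have := integrableB measurableT ipr iqr.
  by have := integrableB measurableT ipi iqi.
rewrite !osc_transformE// rE iE !cos_transformB// !sin_transformB//.
by apply/eqP; rewrite eq_complex/=; apply/andP; split; apply/eqP; ring.
Qed.

Lemma osc_transformZ (c : R) p z : cintegrable p ->
  osc_transform (fun x => c%:C * p x) z = c%:C * osc_transform p z.
Proof.
move=> ip; have [ir ii] := ip.
have rE : (fun x => complex.Re (c%:C * p x)) = (fun x => c * complex.Re (p x)).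
  by apply/funext => x; case: (p x) => u v /=; ring.
have iE : (fun x => complex.Im (c%:C * p x)) = (fun x => c * complex.Im (p x)).
  by apply/funext => x; case: (p x) => u v /=; ring.
have cZ (q : X -> R) : m.-integrable setT (EFin \o q) ->
    cos_transform m theta (fun x => c * q x) z = c * cos_transform m theta q z.
  move=> iq; rewrite /cos_transform -(RintegralZl c measurableT (integrable_mul_cos z iq)).
  by apply: eq_Rintegral => x _; rewrite mulrA.
have sZ (q : X -> R) : m.-integrable setT (EFin \o q) ->
    sin_transform m theta (fun x => c * q x) z = c * sin_transform m theta q z.
  move=> iq; rewrite /sin_transform -(RintegralZl c measurableT (integrable_mul_sin z iq)).
  by apply: eq_Rintegral => x _; rewrite mulrA.
have icp : cintegrable (fun x => c%:C * p x).
  split; rewrite ?rE ?iE.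
    by have := integrableZl measurableT c ir.
  by have := integrableZl measurableT c ii.
rewrite !osc_transformE// rE iE !cZ// !sZ//.
by apply/eqP; rewrite eq_complex/=; apply/andP; split; apply/eqP; ring.
Qed.

(** The real and imaginary parts of the density interfere in each component of the transform; (a -
    b)^2 <= 2 a^2 + 2 b^2 and its analogue separate them, so that only real densities need be
    estimated. *)
Lemma cnorm2_osc_transform_le p z : cintegrable p ->
  cnorm2 (osc_transform p z) <=
    2 * (osc_energy (fun x => complex.Re (p x)) z + osc_energy (fun x => complex.Im (p x)) z).
Proof.
move=> ip; rewrite osc_transformE// /cnorm2 /osc_energy /=.
set a := cos_transform _ _ _ _; set b := sin_transform _ _ _ _.
set e := sin_transform _ _ _ _; set f := cos_transform _ _ _ _.
by have := sqr_ge0 (a + b); have := sqr_ge0 (e - f); nra.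
Qed.

Lemma measurable_cos_transform (p : X -> R) : measurable_fun setT p ->
  measurable_fun setT (cos_transform m theta p).
Proof.
move=> mp; apply: (measurable_Rintegral m (f := fun q => p q.2 * cos (theta q))).
by apply: measurable_funM; [exact: measurable_fun_snd_comp|exact: measurable_cos_comp].
Qed.

Lemma measurable_sin_transform (p : X -> R) : measurable_fun setT p ->
  measurable_fun setT (sin_transform m theta p).
Proof.
move=> mp; apply: (measurable_Rintegral m (f := fun q => p q.2 * sin (theta q))).
by apply: measurable_funM; [exact: measurable_fun_snd_comp|exact: measurable_sin_comp].
Qed.

Lemma measurable_osc_energy (p : X -> R) : measurable_fun setT p ->
  measurable_fun setT (osc_energy p).
Proof.
move=> mp; apply: measurable_funD; apply: measurable_funX.
  exact: measurable_cos_transform.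
exact: measurable_sin_transform.
Qed.

Lemma cmeasurable_osc_transform p : cintegrable p -> cmeasurable (osc_transform p).
Proof.
move=> ip; have [/measurable_int/measurable_EFinP mr /measurable_int/measurable_EFinP mi] := ip.
rewrite (_ : osc_transform p = fun z => (cos_transform m theta (fun x => complex.Re (p x)) z - sin_transform
  m theta (fun x => complex.Im (p x)) z) +i*
    (sin_transform m theta (fun x => complex.Re (p x)) z + cos_transform m theta (fun x => complex.Im (p x))
      z)); last first.
  by apply/funext => z; exact: osc_transformE.
split => /=.
  by apply: measurable_funB; [exact: measurable_cos_transform|exact: measurable_sin_transform].
by apply: measurable_funD; [exact: measurable_sin_transform|exact: measurable_cos_transform].
Qed.

(** * Truncations under an abstract energy bound *)

Section truncation.
Variables (nu : {measure set Z -> \bar R}) (v : Z -> R) (b : X -> R) (F : (set X)^nat) (C : R).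
Hypothesis mv : measurable_fun setT v.
Hypothesis v0 : forall z, 0 < v z.
Hypothesis mb : measurable_fun setT b.
Hypothesis b0 : forall x, 0 <= b x.
Hypothesis ndF : nondecreasing_seq F.
Hypothesis mF : forall k, measurable (F k).
Hypothesis FT : \bigcup_k F k = setT.
Hypothesis iF : forall k, m.-integrable setT (EFin \o (fun x => \1_(F k) x * b x)).
Hypothesis C0 : 0 <= C.
(** Stated for any measurable E inside F k, with a right-hand side that sees h only on E: for E = F
    l minus F k it makes the truncations Cauchy. The Fourier transform uses v = b = 1, the smoothing
    operator [<x>^(-2s)] for v and |grad a| for b. *)
Hypothesis energy_le : forall k (E : set X) (h : X -> R), measurable E -> E `<=` F k ->
  measurable_fun setT h -> (\int[m]_x (h x ^+ 2)%:E < +oo)%E ->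
  (\int[nu]_z (v z * osc_energy (fun x => (\1_E x * Num.sqrt (b x) * h x)%R) z)%:E <=
    C%:E * \int[m]_x ((\1_E x * h x) ^+ 2)%:E)%E.

Variable f : X -> R[i].
Hypothesis mf : cmeasurable f.
Hypothesis f2 : (\int[m]_x (cnorm2 (f x))%:E < +oo)%E.

Definition truncated (E : set X) (x : X) : R[i] := (\1_E x * Num.sqrt (b x))%:C * f x.

Let ReE E : (fun x => complex.Re (truncated E x)) = (fun x => \1_E x * Num.sqrt (b x) * complex.Re (f x)).
Proof. by apply/funext => x; rewrite /truncated; case: (f x) => a c /=; ring. Qed.

Let ImE E : (fun x => complex.Im (truncated E x)) = (fun x => \1_E x * Num.sqrt (b x) * complex.Im (f x)).
Proof. by apply/funext => x; rewrite /truncated; case: (f x) => a c /=; ring. Qed.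

Let re2 : (\int[m]_x (complex.Re (f x) ^+ 2)%:E < +oo)%E.
Proof.
apply: le_lt_trans f2; apply: ge0_le_integral => //.
- by move=> x _; rewrite lee_fin sqr_ge0.
- by apply/measurable_EFinP; apply: measurable_funX; exact: mf.1.
- by apply/measurable_EFinP; exact: measurable_cnorm2.
- by move=> x _; rewrite lee_fin /cnorm2 lerDl sqr_ge0.
Qed.

Let im2 : (\int[m]_x (complex.Im (f x) ^+ 2)%:E < +oo)%E.
Proof.
apply: le_lt_trans f2; apply: ge0_le_integral => //.
- by move=> x _; rewrite lee_fin sqr_ge0.
- by apply/measurable_EFinP; apply: measurable_funX; exact: mf.2.
- by apply/measurable_EFinP; exact: measurable_cnorm2.
- by move=> x _; rewrite lee_fin /cnorm2 lerDr sqr_ge0.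
Qed.

Let sqrt_indic (E : set X) x : \1_E x * Num.sqrt (b x) = Num.sqrt (\1_E x * b x).
Proof. by rewrite indicE; case: (x \in E); rewrite ?mul1r// !mul0r sqrtr0. Qed.

Lemma cintegrable_truncated k (E : set X) : measurable E -> E `<=` F k -> cintegrable (truncated E).
Proof.
move=> mE EF.
have iE : m.-integrable setT (EFin \o (fun x => \1_E x * b x)).
  apply: le_integrable (iF k) => //.
    by apply/measurable_EFinP; apply: measurable_funM => //; exact: measurable_indic.
  move=> x _ /=; rewrite lee_fin !normrM ler_wpM2r// !indicE.
  have [xE|xE] := boolP (x \in E); last by rewrite normr0.
  by rewrite mem_set//; apply: EF; exact: set_mem.
have E0 x : 0 <= \1_E x * b x by rewrite mulr_ge0.
have [mr mi] := mf.
split; rewrite ?ReE ?ImE.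
  under eq_fun do rewrite sqrt_indic; exact: integrable_sqrt_mul.
under eq_fun do rewrite sqrt_indic; exact: integrable_sqrt_mul.
Qed.

Let indic_sq (E : set X) x : \1_E x ^+ 2 = \1_E x :> R.
Proof. by rewrite indicE; case: (x \in E); rewrite ?expr1n// expr0n. Qed.

Let truncated_le k (E : set X) : measurable E -> E `<=` F k ->
  (\int[nu]_z (v z * cnorm2 (osc_transform (truncated E) z))%:E <=
    (2 * C)%:E * \int[m]_(x in E) (cnorm2 (f x))%:E)%E.
Proof.
move=> mE EF; have ic := cintegrable_truncated mE EF.
have [mr mi] := mf.
have mq : measurable_fun setT (fun x => \1_E x * Num.sqrt (b x)).
  apply: measurable_funM => //; apply: (measurableT_comp _ mb).
  by apply: continuous_measurable_fun; exact: sqrt_continuous.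
have mer := measurable_osc_energy (measurable_funM mq mr).
have mei := measurable_osc_energy (measurable_funM mq mi).
apply: (@le_trans _ _ (\int[nu]_z (2%:E * ((v z * osc_energy (fun x => (\1_E x * Num.sqrt (b x) * complex.Re
  (f x))%R) z)%:E + (v z * osc_energy (fun x => (\1_E x * Num.sqrt (b x) * complex.Im (f x))%R) z)%:E)))%E).
  apply: ge0_le_integral => //.
  - by move=> z _; rewrite lee_fin mulr_ge0 ?cnorm2_ge0// ltW.
  - apply/measurable_EFinP; apply: measurable_funM => //; apply: measurable_cnorm2.
    exact: cmeasurable_osc_transform.
  - apply: measurable_funeM; apply: emeasurable_funD; apply/measurable_EFinP; exact: measurable_funM.
  move=> z _; rewrite -EFinD -EFinM lee_fin -mulrDr mulrCA.
  rewrite ler_wpM2l ?(ltW (v0 z))//.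
  by have := cnorm2_osc_transform_le z ic; rewrite ReE ImE.
have vE0 r z : (0 <= (v z * osc_energy r z)%:E)%E.
  by rewrite lee_fin mulr_ge0 ?osc_energy_ge0// ltW.
rewrite ge0_integralZl//; last 2 first.
- by apply: emeasurable_funD; apply/measurable_EFinP; exact: measurable_funM.
- by move=> z _; rewrite adde_ge0.
rewrite ge0_integralD//; last 2 first.
- by apply/measurable_EFinP; exact: measurable_funM.
- by apply/measurable_EFinP; exact: measurable_funM.
rewrite EFinM -muleA; apply: lee_wpmul2l => //.
apply: (le_trans (leeD (energy_le mE EF mr re2) (energy_le mE EF mi im2))).
rewrite -ge0_muleDr; last 2 first.
- by apply: integral_ge0 => x _; rewrite lee_fin sqr_ge0.
- by apply: integral_ge0 => x _; rewrite lee_fin sqr_ge0.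
apply: lee_wpmul2l; first by rewrite lee_fin.
rewrite -ge0_integralD//; last 4 first.
- by move=> x _; rewrite lee_fin sqr_ge0.
- by apply/measurable_EFinP; apply: measurable_funX; exact: measurable_funM.
- by move=> x _; rewrite lee_fin sqr_ge0.
- by apply/measurable_EFinP; apply: measurable_funX; exact: measurable_funM.
rewrite [leRHS]integral_mkcond le_eqVlt; apply/orP; left; apply/eqP; apply: eq_integral => x _.
rewrite -EFinD patchE !exprMn -mulrDr indic_sq indicE /cnorm2.
by case: (x \in E); rewrite ?mul1r// mul0r.
Qed.

(** Bounds the squared weighted distance from the truncation at k to any later one; it vanishes in
    the limit since f is square integrable. *)
Definition truncation_tail k : \bar R := ((2 * C)%:E * \int[m]_(x in ~` F k) (cnorm2 (f x))%:E)%E.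

Let mcf : measurable_fun setT (fun x => (cnorm2 (f x))%:E).
Proof. by apply/measurable_EFinP; exact: measurable_cnorm2. Qed.

Lemma truncation_tail_cvg : truncation_tail @ \oo --> 0%E.
Proof.
pose I := (\int[m]_x (cnorm2 (f x))%:E)%E.
have c0 x : (0 <= (cnorm2 (f x))%:E)%E by rewrite lee_fin cnorm2_ge0.
have I0 : (0 <= I)%E by apply: integral_ge0.
have If : I \is a fin_num by rewrite ge0_fin_numE.
have Ik k : (0 <= \int[m]_(x in F k) (cnorm2 (f x))%:E)%E by apply: integral_ge0.
have Ikf k : (\int[m]_(x in F k) (cnorm2 (f x))%:E)%E \is a fin_num.
  rewrite ge0_fin_numE//; apply: le_lt_trans f2; apply: ge0_subset_integral => //.
have tE k : (\int[m]_(x in ~` F k) (cnorm2 (f x))%:E = I - \int[m]_(x in F k) (cnorm2 (f x))%:E)%E.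
  rewrite /I -(setvU (F k)) ge0_integral_setU//; last 3 first.
  - exact: measurableC.
  - by rewrite setvU.
  - by rewrite disj_set2E setICl.
  by rewrite addeK.
have Icvg : (\int[m]_(x in F k) (cnorm2 (f x))%:E @[k --> \oo] --> I)%E.
  rewrite /I -FT; apply: ge0_nondecreasing_set_cvg_integral => // i.
  exact: measurable_funTS.
rewrite (_ : truncation_tail = fun k => (2 * C)%:E * (I - \int[m]_(x in F k) (cnorm2 (f x))%:E))%E; last first.
  by apply/funext => k; rewrite -tE.
rewrite -(mule0 (2 * C)%:E); apply: cvgeZl => //.
rewrite -(subee If); apply: cvgeB => //; first by rewrite fin_num_adde_defl// fin_numN.
exact: cvg_cst.
Qed.

Lemma truncation_tail_le k : (truncation_tail k <= (2 * C)%:E * \int[m]_x (cnorm2 (f x))%:E)%E.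
Proof.
apply: lee_wpmul2l; first by rewrite lee_fin mulr_ge0.
apply: ge0_subset_integral => //; first exact: measurableC.
by move=> x _; rewrite lee_fin cnorm2_ge0.
Qed.

Lemma osc_truncation_le k :
  (\int[nu]_z (v z * cnorm2 (osc_transform (truncated (F k)) z))%:E <=
    (2 * C)%:E * \int[m]_x (cnorm2 (f x))%:E)%E.
Proof.
apply: (le_trans (truncated_le (mF k) (@subset_refl _ (F k)))).
apply: lee_wpmul2l; first by rewrite lee_fin mulr_ge0.
by apply: ge0_subset_integral => // x _; rewrite lee_fin cnorm2_ge0.
Qed.

Lemma cmeasurable_osc_truncation k : cmeasurable (osc_transform (truncated (F k))).
Proof. by apply: cmeasurable_osc_transform; exact: (cintegrable_truncated (mF k) (@subset_refl _ (F k))). Qed.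

Lemma osc_truncation_limit : exists2 W : Z -> R[i], cmeasurable W &
  forall k, (\int[nu]_z (v z * cnorm2 (osc_transform (truncated (F k)) z - W z))%:E <=
    truncation_tail k + truncation_tail k)%E.
Proof.
apply: weighted_L2_complete => //; first exact: cmeasurable_osc_truncation.
  exact: truncation_tail_cvg.
move=> k l kl.
have Fkl : F k `<=` F l by apply/subsetPset; exact: ndF.
have mD : measurable (F l `\` F k) by exact: measurableD.
(* The transform is linear in the density, so a difference of truncations is the truncation to the
   shell F l minus F k, to which the energy bound applies. *)
have dE z : osc_transform (truncated (F l)) z - osc_transform (truncated (F k)) z =
    osc_transform (truncated (F l `\` F k)) z.
  rewrite osc_transformB; last 2 first.
  - exact: (cintegrable_truncated (mF l) (@subset_refl _ (F l))).
  - exact: (cintegrable_truncated (mF k) (@subset_refl _ (F k))).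
  congr (osc_transform _ z); apply/funext => x; rewrite /truncated -mulrBl; congr (_ * _).
  rewrite -rmorphB -mulrBl; congr ((_ * _)%:C).
  rewrite !indicE in_setD; have [xk|xk] := boolP (x \in F k); last by rewrite subr0 andbT.
  by rewrite (mem_set (Fkl _ (set_mem xk))) subrr.
under eq_integral do rewrite dE.
apply: (le_trans (truncated_le mD (@subDsetl _ _ _))).
apply: lee_wpmul2l; first by rewrite lee_fin mulr_ge0.
apply: ge0_subset_integral => //.
- exact: measurableC.
- exact: measurable_funTS.
- by move=> x _; rewrite lee_fin cnorm2_ge0.
Qed.

End truncation.
End oscillatory_transform.

(** * Energy bounds *)

Section balls.
Variables (R : realType) (n : nat).
Implicit Types (x : Rn R n) (K : R).

Lemma dotRn_ge0 x : 0 <= dotRn x x.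
Proof. by apply: sumr_ge0 => i _; rewrite -expr2 sqr_ge0. Qed.

Lemma sqr_coord_le x i : coord x i ^+ 2 <= dotRn x x.
Proof.
rewrite /dotRn (bigD1 i)//= -expr2 lerDl; apply: sumr_ge0 => j _.
by rewrite -expr2 sqr_ge0.
Qed.

Lemma normr_coord_le x i : `|coord x i| <= normRn x.
Proof. by rewrite /normRn -sqrtr_sqr ler_wsqrtr// sqr_coord_le. Qed.

(** Truncations are to balls, while the product kernels call for cubes. A set inside a ball lies in
    the cube of the same size, so its indicator absorbs that of the cube. *)
Lemma ballRn_cubeRn K : @ballRn R n K `<=` cubeRn K.
Proof. by move=> x xK; apply/cubeRnE => i; exact: le_trans (normr_coord_le x i) xK. Qed.

Lemma measurable_dotRn_diag : measurable_fun setT (fun x => dotRn x x).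
Proof. by apply: measurable_sum => i; apply: measurable_funM; exact: measurable_coord. Qed.

Lemma measurable_ballRn K : measurable (@ballRn R n K).
Proof.
have mn : measurable_fun setT (@normRn R n).
  apply: (measurableT_comp _ measurable_dotRn_diag).
  by apply: continuous_measurable_fun; exact: sqrt_continuous.
rewrite (_ : ballRn K = setT `&` @normRn R n @^-1` `]-oo, K]).
  by apply: mn.
by rewrite setTI; apply/seteqP; split => x /=; rewrite in_itv.
Qed.

Lemma nondecreasing_ballRn : nondecreasing_seq (fun k : nat => @ballRn R n k%:R).
Proof.
by move=> k l kl; apply/subsetPset => x /= xk; apply: (le_trans xk); rewrite ler_nat.
Qed.

Lemma bigcup_ballRn : \bigcup_k @ballRn R n k%:R = setT.
Proof.
apply/seteqP; split => // x _; exists (Num.truncn (normRn x)).+1 => //=.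
by apply: ltW; exact: truncnS_gt.
Qed.

End balls.

(** * Splitting |grad a|^(1/2) over the coordinates *)

Section gradient.
Variables (R : realType) (n : nat) (a : mpoly.mpoly n R).
Implicit Types x : Rn R n.

Lemma grad_norm_ge0 x : 0 <= grad_norm a x.
Proof. exact: sqrtr_ge0. Qed.

Lemma measurable_grad_norm : measurable_fun setT (grad_norm a).
Proof.
rewrite /grad_norm; apply: (@measurableT_comp _ _ _ _ _ _ (@Num.sqrt R)).
  by apply: continuous_measurable_fun; exact: sqrt_continuous.
by apply: measurable_sum => i; apply: measurable_funX; exact: measurable_peval.
Qed.

Lemma normr_mderiv_le x j : `|peval (mpoly.mderiv j a) x| <= grad_norm a x.
Proof.
rewrite /grad_norm -sqrtr_sqr ler_wsqrtr// (bigD1 j)//= lerDl.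
by apply: sumr_ge0 => i _; rewrite sqr_ge0.
Qed.

Lemma grad_norm_bounded M : exists c, forall x, cubeRn M x -> `|grad_norm a x| <= c.
Proof.
have /choice[c cP] : forall j, exists c, forall x, cubeRn M x -> `|peval (mpoly.mderiv j a) x| <= c.
  by move=> j; exact: peval_bounded.
exists (Num.sqrt (\sum_j c j ^+ 2)) => x xM.
rewrite ger0_norm ?grad_norm_ge0// ler_wsqrtr//; apply: ler_sum => j _.
by rewrite -[leLHS]real_normK ?num_real// lerXn2r ?nnegrE ?(le_trans _ (cP j x xM)) ?cP.
Qed.

Definition grad_ratio (j : 'I_n) x : R :=
  (Num.sqrt `|peval (mpoly.mderiv j a) x| / Num.sqrt (grad_norm a x)) ^+ 3.

Lemma grad_ratio_itv j x : 0 <= grad_ratio j x <= 1.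
Proof.
have q0 : 0 <= Num.sqrt `|peval (mpoly.mderiv j a) x| / Num.sqrt (grad_norm a x).
  by rewrite divr_ge0 ?sqrtr_ge0.
rewrite exprn_ge0//= exprn_ile1//.
(* At critical points the inverse of 0 is 0, so the ratio is 0 there. *)
have [s0|s0] := eqVneq (Num.sqrt (grad_norm a x)) 0; first by rewrite s0 invr0 mulr0.
by rewrite ler_pdivrMr ?mul1r ?ler_wsqrtr ?normr_mderiv_le// lt_def s0 sqrtr_ge0.
Qed.

Lemma measurable_grad_ratio j : measurable_fun setT (grad_ratio j).
Proof.
have ms : measurable_fun setT (@Num.sqrt R).
  by apply: continuous_measurable_fun; exact: sqrt_continuous.
apply: measurable_funX; apply: measurable_funM.
  apply: (measurableT_comp ms); apply: measurableT_comp => //; exact: measurable_peval.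
rewrite (_ : (fun x => _) = (fun x => Num.sqrt (grad_norm a x) `^ (-1))).
  exact: (measurableT_comp (@measurable_powR R (-1)) (measurableT_comp ms measurable_grad_norm)).
by apply/funext => x; rewrite powR_inv1// sqrtr_ge0.
Qed.

(* With e_j = |d_j a|^(1/2) and s = |grad a|^(1/2), this is s^4 = \sum_j e_j^4
   divided by s^3; where s = 0 both sides vanish. *)
Lemma sqrt_grad_normE x :
  Num.sqrt (grad_norm a x) = \sum_j Num.sqrt `|peval (mpoly.mderiv j a) x| * grad_ratio j x.
Proof.
set s := Num.sqrt (grad_norm a x).
have e4 j : Num.sqrt `|peval (mpoly.mderiv j a) x| ^+ 4 = peval (mpoly.mderiv j a) x ^+ 2.
  by rewrite (exprM _ 2 2) sqr_sqrtr// real_normK// num_real.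
have s4 : s ^+ 4 = \sum_j peval (mpoly.mderiv j a) x ^+ 2.
  rewrite (exprM _ 2 2) sqr_sqrtr ?grad_norm_ge0// sqr_sqrtr//.
  by apply: sumr_ge0 => j _; rewrite sqr_ge0.
rewrite (eq_bigr (fun j => peval (mpoly.mderiv j a) x ^+ 2 * s ^- 3)); last first.
  by move=> j _; rewrite /grad_ratio -/s exprMn exprVn mulrA -exprS e4.
rewrite -mulr_suml -s4; have [->|s0] := eqVneq s 0; first by rewrite expr0n mul0r.
by field.
Qed.

End gradient.

(** Induction through (x + S)^2 <= 2 x^2 + 2 S^2, which doubles the constant with each summand. *)
Lemma sqr_sum_le (R : realDomainType) n (x : 'I_n -> R) :
  (\sum_j x j) ^+ 2 <= 2 ^+ n * \sum_j x j ^+ 2.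
Proof.
elim: n x => [|n IH] x; first by rewrite !big_ord0 expr0n mulr0.
rewrite !big_ord_recl; have := IH (fun j => x (lift ord0 j)).
set S := \sum_(i < n) _; set Q := \sum_(i < n) _ => h.
have h1 : 1 <= 2 ^+ n :> R by rewrite exprn_ege1// ler1n.
have h2 := sqr_ge0 (x ord0 - S); have h3 := sqr_ge0 (x ord0).
have h4 : x ord0 ^+ 2 <= 2 ^+ n * x ord0 ^+ 2 by rewrite ler_peMl.
apply: (@le_trans _ _ (2 * x ord0 ^+ 2 + 2 * S ^+ 2)); first by nra.
by rewrite (exprS 2 n) -mulrA mulrDr [leRHS]mulrDr lerD// ler_wpM2l.
Qed.

(** * Comparison of the weight with the cutoffs *)

Section weights.
Variables (R : realType) (n : nat).
Implicit Types x : Rn R n.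

Lemma prod34_le (P : pred 'I_n) (w : 'I_n -> R) : (forall i, P i -> 3 / 4 <= w i) ->
  (3 / 4) ^+ n <= \prod_(i | P i) w i.
Proof.
move=> h; rewrite -[in leLHS](card_ord n) -prodr_const (bigID P)/= -[leRHS]mulr1.
apply: ler_pM.
- by apply: prodr_ge0 => i _; lra.
- by apply: prodr_ge0 => i _; lra.
- by apply: ler_prod => i Pi; rewrite h// andbT; lra.
- by apply: prodr_ile1 => i _; lra.
Qed.

Lemma jbr_powE s x : jbr_pow s x ^+ 2 = (1 + dotRn x x) `^ (- s).
Proof.
rewrite /jbr_pow -powR_mulrn ?powR_ge0// -powRrM; congr (_ `^ _).
by rewrite mulNr divfK.
Qed.

Lemma jbr_pow_gt0 s x : 0 < jbr_pow s x ^+ 2.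
Proof. by rewrite exprn_gt0// powR_gt0// ltr_pwDl// dotRn_ge0. Qed.

Lemma powR_Nle (s u v : R) : 0 <= s -> 0 < u -> u <= v -> v `^ (- s) <= u `^ (- s).
Proof.
move=> s0 u0 uv; rewrite !powRN lef_pV2 ?posrE ?powR_gt0// ?(lt_le_trans u0)//.
by rewrite ge0_ler_powR// nnegrE ltW// (lt_le_trans u0).
Qed.

Lemma jbr_pow_le1 s x : 0 <= s -> jbr_pow s x ^+ 2 <= 1.
Proof.
move=> s0; have h1 : 1 `^ (- s) = 1 :> R by rewrite powR1.
rewrite jbr_powE -[leRHS]h1 powR_Nle// lerDl.
exact: dotRn_ge0.
Qed.

Lemma jbr_pow_ge s x K : 0 <= s -> 0 <= K -> ballRn K x -> (1 + K ^+ 2) `^ (- s) <= jbr_pow s x ^+ 2.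
Proof.
move=> s0 K0 xK; rewrite jbr_powE powR_Nle//.
  by rewrite ltr_pwDl// dotRn_ge0.
rewrite lerD2l -(sqr_sqrtr (dotRn_ge0 x)) lerXn2r ?nnegrE ?sqrtr_ge0//.
Qed.

Lemma measurable_jbr_pow s : measurable_fun setT (@jbr_pow R n s).
Proof.
apply: (measurableT_comp (@measurable_powR R _)); apply: measurable_funD => //.
exact: measurable_dotRn_diag.
Qed.

(** As |x_j| <= |x|, the weight in x_j alone dominates [<x>^(-2s)]. The time cutoff and the
    remaining space cutoffs are at least 3/4 on the half-size box, and there are at most n + 1 of
    them. *)
Lemma smoothing_weight_ge s T (j : 'I_n) t x : 0 <= s -> 0 < T ->
  `|t| <= T / 2 -> cubeRn (T / 2) x ->
  (3 / 4) ^+ n.+1 * jbr_pow s x ^+ 2 <= tau T t * prodw (smoothing_weight s T j) x.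
Proof.
move=> s0 T0 tT /cubeRnE xT; rewrite exprS -mulrA.
apply: ler_pM; [lra| |exact: tau_ge34|].
  by apply: mulr_ge0; [apply: exprn_ge0; lra|exact: sqr_ge0].
rewrite /prodw (bigD1 j)//= mulrC; apply: ler_pM.
- exact: sqr_ge0.
- by rewrite exprn_ge0//; lra.
- rewrite /smoothing_weight eqxx /bracket_cut indicE mem_set/=; last first.
    by rewrite /= in_itv/= -ler_norml (le_trans (xT j))//; lra.
  rewrite mulr1 jbr_powE powR_Nle//; first by rewrite ltr_pwDl// sqr_ge0.
  by rewrite lerD2l sqr_coord_le.
- by apply: prod34_le => i ij; rewrite /smoothing_weight (negbTE ij) tau_ge34.
Qed.

End weights.

Section energy_bounds.
Variables (R : realType) (n : nat) (mu : {sigma_finite_measure set (Rn R n) -> \bar R}).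
Notation leb := (@lebesgue_measure R).
Hypothesis muL : is_lebesgue_Rn mu.

Lemma L2_indic_mul (E : set (Rn R n)) (h : Rn R n -> R) : measurable E ->
  measurable_fun setT h -> (\int[mu]_x (h x ^+ 2)%:E < +oo)%E ->
  (\int[mu]_x ((\1_E x * h x) ^+ 2)%:E < +oo)%E.
Proof.
move=> mE mh h2; apply: le_lt_trans h2; apply: ge0_le_integral => //.
- by move=> x _; rewrite lee_fin sqr_ge0.
- by apply/measurable_EFinP; apply: measurable_funX; apply: measurable_funM.
- by apply/measurable_EFinP; exact: measurable_funX.
- move=> x _; rewrite lee_fin exprMn indicE; case: (x \in E) => /=.
    by rewrite expr1n mul1r.
  by rewrite expr0n mul0r sqr_ge0.
Qed.

Lemma nondecreasing_cubes : nondecreasing_seq (fun k => @cubeRn R n k.+1%:R).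
Proof.
move=> k l kl; apply/subsetPset => x /cubeRnE xk; apply/cubeRnE => i.
by apply: (le_trans (xk i)); rewrite ler_nat.
Qed.

Lemma bigcup_cubes : \bigcup_k @cubeRn R n k.+1%:R = setT.
Proof.
apply/seteqP; split => // x _; have [k hk] := nat_gt_coords x.
by exists k => //; apply/cubeRnE => i; rewrite (le_trans (hk i))// ler_nat.
Qed.

Definition fourier_const : R := (3 / 4) ^- n * (2 * (2 ^+ n * 80 ^+ n)).

Lemma fourier_energy_le M (h : Rn R n -> R) : measurable_fun setT h ->
  (\int[mu]_x (h x ^+ 2)%:E < +oo)%E ->
  (\int[mu]_z (1 * osc_energy mu (@fourier_phase R n) (fun x => (cube1 M x * h x)%R) z)%:E <=
    fourier_const%:E * \int[mu]_x (h x ^+ 2)%:E)%E.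
Proof.
move=> mh h2.
have hE : (\int[mu]_x (h x ^+ 2)%:E = (fine (\int[mu]_x (h x ^+ 2)%:E))%:E)%E.
  by rewrite fineK// ge0_fin_numE// integral_ge0// => x _; rewrite lee_fin sqr_ge0.
rewrite hE -EFinM /fourier_const -(mulrA _ _ (fine _)).
(* The scale T = 2 (k + 1) makes the half-size box exactly the k-th cube; k + 1 keeps T positive at
   k = 0. *)
apply: (weighted_exhaustion_le (rho := fun k => prodw (fun _ => tau (2 * k.+1%:R))) nondecreasing_cubes _
  bigcup_cubes) => //.
- by move=> k; exact: measurable_boxRn.
- by move=> k; apply: measurable_prodw => i; exact: measurable_tau.
- by move=> k x; apply: prodr_ge0 => i _; exact: tau_ge0.
- apply: measurable_osc_energy; first exact: measurable_fourier_phase.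
  by apply: measurable_funM => //; exact: measurable_cube1.
- by move=> z; exact: osc_energy_ge0.
- move=> k x /cubeRnE xk; rewrite mulr1; apply: prod34_le => i _; apply: tau_ge34.
    by rewrite mulr_gt0.
  by rewrite mulrC mulKf.
move=> k; rewrite EFinM -hE; exact: fourier_cos_bound.
Qed.

Lemma fourier_truncation_energy_le (k : nat) (E : set (Rn R n)) (h : Rn R n -> R) :
  measurable E -> E `<=` ballRn k%:R -> measurable_fun setT h ->
  (\int[mu]_x (h x ^+ 2)%:E < +oo)%E ->
  (\int[mu]_z (1 * osc_energy mu (@fourier_phase R n) (fun x => (\1_E x * Num.sqrt 1 * h x)%R) z)%:E <=
    fourier_const%:E * \int[mu]_x ((\1_E x * h x) ^+ 2)%:E)%E.
Proof.
move=> mE Ek mh h2.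
rewrite (_ : (fun x => _) = (fun x => cube1 k%:R x * (\1_E x * h x))).
  apply: fourier_energy_le; last exact: L2_indic_mul.
  by apply: measurable_funM => //; exact: measurable_indic.
apply/funext => x; rewrite sqrtr1 mulr1 indicE.
have [xE|xE] := boolP (x \in E); last by rewrite !mul0r mulr0.
by rewrite cube1_in ?mul1r//; apply: ballRn_cubeRn; apply: Ek; exact: set_mem.
Qed.

Variables (a : mpoly.mpoly n R) (s : R).
Hypothesis s12 : 1 / 2 < s.

Let s0 : 0 <= s. Proof. by apply: le_trans (ltW s12); rewrite divr_ge0. Qed.

Definition stbox (k : nat) : set (measurableTypeR R * Rn R n) :=
  `[- k.+1%:R, k.+1%:R]%classic `*` cubeRn k.+1%:R.

Lemma nondecreasing_stbox : nondecreasing_seq stbox.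
Proof.
move=> k l kl; apply/subsetPset => -[t x] /= [+ xk]; rewrite /= !in_itv/= -!ler_norml => tk.
split => /=; last by move: xk; apply/subsetPset; exact: nondecreasing_cubes.
by rewrite in_itv/= -ler_norml (le_trans tk)// ler_nat.
Qed.

Lemma measurable_stbox k : measurable (stbox k).
Proof. by apply: measurableX; [exact: measurable_itv|exact: measurable_boxRn]. Qed.

Lemma bigcup_stbox : \bigcup_k stbox k = setT.
Proof.
apply/seteqP; split => // -[t x] _; have [k hk] := nat_gt_coords x.
exists (maxn k (Num.truncn `|t|)) => //; split => /=.
  rewrite in_itv/= -ler_norml; apply: (le_trans (ltW (truncnS_gt _))).
  by rewrite ler_nat ltnS leq_maxr.
apply/cubeRnE => i; rewrite (le_trans (hk i))// ler_nat.
by rewrite (leq_trans _ (leqnSn _))// leq_maxl.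
Qed.

Definition smoothing_const_at (j : 'I_n) : R :=
  (3 / 4) ^- n.+1 * (2 * (2 * 2 ^+ n * bracket_cut_bound s * (40 * 2 ^+ pdeg a j * \prod_(i < n | i != j) 80))).

Definition smoothing_piece j M h x : R := Num.sqrt (`|peval (mpoly.mderiv j a) x| * cube1 M x) * h x.

Lemma measurable_smoothing_piece j M h : measurable_fun setT h ->
  measurable_fun setT (smoothing_piece j M h).
Proof.
move=> mh; apply: measurable_funM => //.
apply: (@measurableT_comp _ _ _ _ _ _ (@Num.sqrt R)).
  by apply: continuous_measurable_fun; exact: sqrt_continuous.
apply: measurable_funM; last exact: measurable_cube1.
by apply: measurableT_comp => //; exact: measurable_peval.
Qed.

Lemma smoothing_piece_energy_le j M (h : Rn R n -> R) : measurable_fun setT h ->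
  (\int[mu]_x (h x ^+ 2)%:E < +oo)%E ->
  (\int[leb \x mu]_z (jbr_pow s z.2 ^+ 2 * osc_energy mu (smoothing_phase a) (smoothing_piece j M h) z)%:E <=
    (smoothing_const_at j)%:E * \int[mu]_x (h x ^+ 2)%:E)%E.
Proof.
move=> mh h2.
have hE : (\int[mu]_x (h x ^+ 2)%:E = (fine (\int[mu]_x (h x ^+ 2)%:E))%:E)%E.
  by rewrite fineK// ge0_fin_numE// integral_ge0// => x _; rewrite lee_fin sqr_ge0.
rewrite hE -EFinM /smoothing_const_at -(mulrA _ _ (fine _)).
apply: (@weighted_exhaustion_le _ _ _ (leb \x mu)%E stbox (fun k z => tau (2 * k.+1%:R) z.1 * prodw
  (smoothing_weight s (2 * k.+1%:R) j) z.2)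
   (fun z => jbr_pow s z.2 ^+ 2) (osc_energy mu (smoothing_phase a) (smoothing_piece j M h))).
- exact: nondecreasing_stbox.
- exact: measurable_stbox.
- exact: bigcup_stbox.
- apply: measurable_funX.
  by apply: (measurable_fun_snd_comp (f := jbr_pow s)); exact: measurable_jbr_pow.
- by move=> z; exact: sqr_ge0.
- move=> k; apply: measurable_funM.
    by apply: measurable_fun_fst_comp; exact: measurable_tau.
  apply: measurable_fun_snd_comp; apply: measurable_prodw => i.
  by rewrite /smoothing_weight; case: ifP => _; [exact: measurable_bracket_cut|exact: measurable_tau].
- move=> k z; rewrite mulr_ge0 ?tau_ge0//; apply: prodr_ge0 => i _.
  by rewrite /smoothing_weight; case: ifP => _; [exact: bracket_cut_ge0|exact: tau_ge0].
- apply: measurable_osc_energy; first exact: measurable_smoothing_phase.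
  exact: measurable_smoothing_piece.
- by move=> z; exact: osc_energy_ge0.
- by apply: exprn_gt0; lra.
- move=> k [t x] [/= tk xk]; apply: smoothing_weight_ge => //.
  + by rewrite mulrC mulKf//; move: tk; rewrite in_itv/= -ler_norml.
  + by rewrite mulrC mulKf.
move=> k; rewrite EFinM -hE; exact: smoothing_cos_bound.
Qed.

Definition smoothing_const : R := 2 ^+ n * \sum_j smoothing_const_at j.

Lemma smoothing_const_at_ge0 j : 0 <= smoothing_const_at j.
Proof.
have om0 : 0 <= bracket_cut_bound s by rewrite mulr_ge0// divr_ge0 ?powR_ge0//; move: s12 => ?; lra.
rewrite /smoothing_const_at; apply: mulr_ge0.
  by rewrite invr_ge0; apply: exprn_ge0; lra.
apply: mulr_ge0 => //; apply: mulr_ge0.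
  by apply: mulr_ge0 => //; apply: mulr_ge0 => //; exact: exprn_ge0.
apply: mulr_ge0; last by apply: prodr_ge0.
by apply: mulr_ge0 => //; exact: exprn_ge0.
Qed.

(** The density is a sum of n pieces with factor |d_j a|^(1/2), each bounded by the estimate for its
    own j. The squared sum costs the 2^n in [smoothing_const], and the ratios, at most 1, do not
    increase the norm of h on E. *)
Lemma smoothing_truncation_energy_le (k : nat) (E : set (Rn R n)) (h : Rn R n -> R) :
  measurable E -> E `<=` ballRn k%:R -> measurable_fun setT h ->
  (\int[mu]_x (h x ^+ 2)%:E < +oo)%E ->
  (\int[leb \x mu]_z (jbr_pow s z.2 ^+ 2 *
     osc_energy mu (smoothing_phase a) (fun x => (\1_E x * Num.sqrt (grad_norm a x) * h x)%R) z)%:E <=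
    smoothing_const%:E * \int[mu]_x ((\1_E x * h x) ^+ 2)%:E)%E.
Proof.
move=> mE Ek mh h2.
(* The ratio and the indicator of E go into the square integrable factor, so each piece keeps
   exactly the Jacobian factor that its Schur bound demands. *)
pose h' j x := grad_ratio a j x * (\1_E x * h x).
have mEh : measurable_fun setT (fun x => \1_E x * h x).
  by apply: measurable_funM => //; exact: measurable_indic.
have mh' j : measurable_fun setT (h' j).
  by apply: measurable_funM => //; exact: measurable_grad_ratio.
have h'le j : (\int[mu]_x (h' j x ^+ 2)%:E <= \int[mu]_x ((\1_E x * h x) ^+ 2)%:E)%E.
  apply: ge0_le_integral => //.
  - by move=> x _; rewrite lee_fin sqr_ge0.
  - by apply/measurable_EFinP; exact: measurable_funX.
  - by apply/measurable_EFinP; exact: measurable_funX.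
  - move=> x _; rewrite lee_fin /h' exprMn ler_piMl ?sqr_ge0//.
    by have /andP[r0 r1] := grad_ratio_itv a j x; rewrite exprn_ile1.
have h'2 j : (\int[mu]_x (h' j x ^+ 2)%:E < +oo)%E.
  by apply: (le_lt_trans (h'le j)); exact: L2_indic_mul.
have pE : (fun x => \1_E x * Num.sqrt (grad_norm a x) * h x) =
    (fun x => \sum_j smoothing_piece j k%:R (h' j) x).
  apply/funext => x; rewrite sqrt_grad_normE mulr_sumr mulr_suml; apply: eq_bigr => j _.
  rewrite /smoothing_piece /h' indicE; have [xE|xE] := boolP (x \in E); last first.
    by rewrite !mul0r !mulr0.
  rewrite cube1_in ?mulr1 ?mul1r ?mulrA//.
  by apply: ballRn_cubeRn; apply: Ek; exact: set_mem.
rewrite pE.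
have ip j : mu.-integrable setT (EFin \o smoothing_piece j k%:R (h' j)).
  have [cb bcb] := peval_bounded (mpoly.mderiv j a) k%:R.
  apply: integrable_sqrt_mul => //.
    by move=> x; rewrite mulr_ge0//; apply: prodr_ge0 => i _; exact: itv1_ge0.
  apply: (@integrable_bounded_cube _ _ mu muL _ k%:R cb).
    by apply: measurableT_comp => //; exact: measurable_peval.
  by move=> x xM; rewrite normr_id; exact: bcb.
have mJ : measurable_fun setT (fun z : measurableTypeR R * Rn R n => jbr_pow s z.2 ^+ 2).
  apply: measurable_funX.
  by apply: (measurable_fun_snd_comp (f := jbr_pow s)); exact: measurable_jbr_pow.
have me j : measurable_fun setT (osc_energy mu (smoothing_phase a) (smoothing_piece j k%:R (h' j))).
  apply: measurable_osc_energy; first exact: measurable_smoothing_phase.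
  exact: measurable_smoothing_piece.
have mJe j : measurable_fun setT (fun z : measurableTypeR R * Rn R n =>
    (jbr_pow s z.2 ^+ 2 * osc_energy mu (smoothing_phase a) (smoothing_piece j k%:R (h' j)) z)%:E).
  by apply/measurable_EFinP; exact: measurable_funM.
have Je0 j z : (0 <= (jbr_pow s z.2 ^+ 2 * osc_energy mu (smoothing_phase a) (smoothing_piece j k%:R (h' j)) z)%:E)%E.
  by rewrite lee_fin mulr_ge0 ?sqr_ge0 ?osc_energy_ge0.
apply: (@le_trans _ _ (\int[leb \x mu]_z ((2 ^+ n)%:E * \sum_j (jbr_pow s z.2 ^+ 2 *
     osc_energy mu (smoothing_phase a) (smoothing_piece j k%:R (h' j)) z)%:E))%E).
  apply: ge0_le_integral => //.
  - by move=> z _; rewrite lee_fin mulr_ge0 ?sqr_ge0 ?osc_energy_ge0.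
  - apply/measurable_EFinP; apply: measurable_funM => //.
    apply: measurable_osc_energy; first exact: measurable_smoothing_phase.
    by apply: measurable_sum => j; exact: measurable_smoothing_piece.
  - by apply: measurable_funeM; apply: emeasurable_sum => j; exact: mJe.
  move=> z _; rewrite sumEFin -EFinM lee_fin -mulr_sumr mulrCA ler_wpM2l ?sqr_ge0//.
  have [hc hs] := cos_sin_transform_sum (measurable_smoothing_phase a) z ip.
  rewrite /osc_energy hc hs big_split/= mulrDr; apply: lerD; exact: sqr_sum_le.
rewrite ge0_integralZl//; last 2 first.
- by apply: emeasurable_sum => j; exact: mJe.
- by move=> z _; apply: sume_ge0 => j _; exact: Je0.
rewrite ge0_integral_sum//.
rewrite /smoothing_const (EFinM (2 ^+ n)) -muleA.
apply: lee_wpmul2l; first by rewrite lee_fin exprn_ge0.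
rewrite -sumEFin ge0_sume_distrl; last by move=> j _; rewrite lee_fin smoothing_const_at_ge0.
apply: lee_sum => j _; apply: (le_trans (smoothing_piece_energy_le j k%:R (mh' j) (h'2 j))).
by apply: lee_wpmul2l; [rewrite lee_fin smoothing_const_at_ge0|exact: h'le].
Qed.

End energy_bounds.

Local Open Scope complex_scope.

(** * The Fourier transform and the smoothing operator *)

Lemma lee_cvg0 (R : realType) (e : (\bar R)^nat) (L : \bar R) (c : R) :
  e @ \oo --> 0%E -> (forall k, (L <= 2%:E * e k + c%:E)%E) -> (L <= c%:E)%E.
Proof.
move=> e0 h.
have h1 : (fun k => 2%:E * e k + c%:E)%E @ \oo --> (2%:E * 0 + c%:E)%E.
  apply: cvgeD; first by rewrite fin_num_adde_defl.
    exact: cvgeZl.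
  exact: cvg_cst.
move: h1; rewrite mule0 add0e => h1; rewrite -(cvg_lim _ h1)//; apply: lime_ge.
  by apply/cvg_ex; eexists; exact: h1.
exact: nearW.
Qed.

Lemma cvge0_squeeze (R : realType) (e d : (\bar R)^nat) :
  (forall k, (0 <= e k)%E) -> (forall k, (e k <= d k)%E) -> d @ \oo --> 0%E -> e @ \oo --> 0%E.
Proof.
move=> e0 ed d0; apply: (squeeze_cvge _ (cvg_cst 0%E) d0).
by apply: nearW => k; rewrite e0 ed.
Qed.

Section energy_split.
Context d (T : measurableType d) (R : realType) (m : {measure set T -> \bar R}).

Lemma integral_cnorm2_split (D : set T) (v : T -> R) (z w : T -> R[i]) : measurable D ->
  measurable_fun setT v -> (forall x, 0 <= v x) -> cmeasurable z -> cmeasurable w ->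
  (\int[m]_(x in D) (v x * cnorm2 (w x))%:E <=
   2%:E * \int[m]_(x in D) (v x * cnorm2 (z x - w x))%:E +
   2%:E * \int[m]_(x in D) (v x * cnorm2 (z x))%:E)%E.
Proof.
move=> mD mv v0 mz mw.
have mf (f : T -> R[i]) : cmeasurable f -> measurable_fun D (fun x => (v x * cnorm2 (f x))%:E).
  move=> cf; apply/measurable_EFinP; apply: measurable_funTS; apply: measurable_funM => //.
  exact: measurable_cnorm2.
have f0 (f : T -> R[i]) x : D x -> (0 <= (v x * cnorm2 (f x))%:E)%E.
  by rewrite lee_fin mulr_ge0 ?cnorm2_ge0.
have mzw := cmeasurableB mz mw.
rewrite -ge0_integralZl//; last 2 first.
- exact: mf.
- by move=> x; exact: (f0 (fun x => z x - w x)).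
rewrite -ge0_integralZl//; last 2 first.
- exact: mf.
- by move=> x; exact: f0.
rewrite -ge0_integralD//; last 4 first.
- by move=> x Dx; rewrite mule_ge0// (f0 (fun x => z x - w x)).
- by apply: measurable_funeM; exact: mf.
- by move=> x Dx; rewrite mule_ge0// f0.
- by apply: measurable_funeM; exact: mf.
apply: ge0_le_integral => //.
- by move=> x; exact: f0.
- exact: mf.
- by apply: emeasurable_funD; apply: measurable_funeM; exact: mf.
- move=> x _; rewrite -!EFinM -EFinD lee_fin !(mulrCA 2) -mulrDr ler_wpM2l//.
  exact: cnorm2_le_split.
Qed.

Lemma cintegral_mkcond (A : set T) (f : T -> R[i]) :
  cintegral m A f = cintegral m setT (fun x => (\1_A x)%:C * f x).
Proof.
rewrite /cintegral; congr (_ +i* _); rewrite [LHS]Rintegral_mkcond.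
  apply: eq_Rintegral => x _; rewrite patchE indicE.
  by case: (x \in A); case: (f x) => u v /=; rewrite ?mul1r !mul0r ?subr0 ?addr0.
apply: eq_Rintegral => x _; rewrite patchE indicE.
by case: (x \in A); case: (f x) => u v /=; rewrite ?mul1r !mul0r ?subr0 ?addr0.
Qed.

End energy_split.

Lemma cexpiD (R : realType) (x y : R) : cexpi (x + y) = cexpi x * cexpi y.
Proof.
apply/eqP; rewrite eq_complex/= cosD sinD; apply/andP; split => //.
by apply/eqP; ring.
Qed.

(** * Existence and bound of the L^2 Fourier transform *)

Section Fourier_transform.
Variables (R : realType) (n : nat) (mu : {sigma_finite_measure set (Rn R n) -> \bar R}).
Hypothesis muL : is_lebesgue_Rn mu.

Lemma integrable_indic_ball (b : Rn R n -> R) (k : nat) c : measurable_fun setT b ->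
  (forall x, cubeRn k%:R x -> `|b x| <= c) ->
  mu.-integrable setT (EFin \o (fun x => \1_(ballRn k%:R) x * b x)).
Proof.
move=> mb bc; apply: le_integrable (integrable_bounded_cube muL mb bc) => //.
  apply/measurable_EFinP; apply: measurable_funM => //; apply: measurable_indic.
  exact: measurable_ballRn.
move=> x _ /=; rewrite lee_fin indicE; have [xk|xk] := boolP (x \in _); last by rewrite mul0r normr0.
by rewrite mul1r cube1_in ?mulr1//; apply: ballRn_cubeRn; exact: set_mem.
Qed.

Lemma fourier_const_ge0 : 0 <= fourier_const R n.
Proof.
rewrite /fourier_const mulr_ge0 ?invr_ge0 ?mulr_ge0 ?exprn_ge0//; lra.
Qed.

Notation FT f k := (osc_transform mu (@fourier_phase R n) (truncated (fun=> 1) f (ballRn k%:R))).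

Lemma fourier_truncE (f : Rn R n -> R[i]) (k : nat) xi : fourier_trunc mu f k%:R xi = FT f k xi.
Proof.
rewrite /fourier_trunc cintegral_mkcond /osc_transform; congr cintegral.
apply/funext => x; rewrite /truncated sqrtr1 mulr1 mulrCA /fourier_phase/=.
by [].
Qed.

Let iball k : mu.-integrable setT (EFin \o (fun x => \1_(ballRn k%:R) x * (fun=> 1) x)).
Proof. by apply: (@integrable_indic_ball _ k 1) => // x _; rewrite normr1. Qed.

Let one_gt0 (x : Rn R n) : 0 < 1 :> R. Proof. by []. Qed.
Let one_ge0 (x : Rn R n) : 0 <= 1 :> R. Proof. by []. Qed.
Let m1 : measurable_fun setT (fun _ : Rn R n => 1 : R). Proof. by []. Qed.

Variable f : Rn R n -> R[i].
Hypothesis f2 : isL2 mu f.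

Let cmFT k : cmeasurable (FT f k).
Proof.
exact: (cmeasurable_osc_truncation (@measurable_fourier_phase R n) m1 one_ge0
  (fun k => measurable_ballRn k%:R) iball f2.1 f2.2).
Qed.

Lemma L2norm2_fourier_trunc_le k :
  (L2norm2 mu (fourier_trunc mu f k%:R) <= (2 * fourier_const R n)%:E * L2norm2 mu f)%E.
Proof.
have := osc_truncation_le (@measurable_fourier_phase R n) m1 one_gt0 m1 one_ge0
  (fun k => measurable_ballRn k%:R) iball fourier_const_ge0
  (fourier_truncation_energy_le muL) f2.1 f2.2 k.
rewrite /L2norm2; under eq_integral do rewrite mul1r -fourier_truncE.
exact.
Qed.

Let cmT k : cmeasurable (fourier_trunc mu f k%:R).
Proof.
rewrite (_ : fourier_trunc _ _ _ = FT f k); first exact: cmFT.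
by apply/funext => xi; exact: fourier_truncE.
Qed.

Let split1 k g : cmeasurable g ->
  (L2norm2 mu g <= 2%:E * L2norm2 mu (fun xi => fourier_trunc mu f k%:R xi - g xi)%R +
    2%:E * L2norm2 mu (fourier_trunc mu f k%:R))%E.
Proof.
move=> mg; have := integral_cnorm2_split mu measurableT m1 one_ge0 (cmT k) mg.
rewrite /L2norm2; under eq_integral do rewrite mul1r.
move=> /le_trans; apply; apply: leeD.
  by apply: lee_wpmul2l => //; under eq_integral do rewrite mul1r.
by apply: lee_wpmul2l => //; under eq_integral do rewrite mul1r.
Qed.

Lemma is_fourierL2_exists : exists g, is_fourierL2 mu f g.
Proof.
have [W mW WP] := osc_truncation_limit (@measurable_fourier_phase R n) m1 one_gt0 m1 one_ge0
  (@nondecreasing_ballRn R n) (fun k => measurable_ballRn k%:R) (@bigcup_ballRn R n) iball fourier_const_ge0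
  (fourier_truncation_energy_le muL) f2.1 f2.2.
have t0 := truncation_tail_cvg (fourier_const R n) (@nondecreasing_ballRn R n) (fun k => measurable_ballRn k%:R)
  (@bigcup_ballRn R n) f2.1 f2.2.
have WP' k : (L2norm2 mu (fun xi => fourier_trunc mu f k%:R xi - W xi)%R <=
    truncation_tail mu (fun k => ballRn k%:R) (fourier_const R n) f k +
    truncation_tail mu (fun k => ballRn k%:R) (fourier_const R n) f k)%E.
  by have := WP k; rewrite /L2norm2; under eq_integral do rewrite mul1r -fourier_truncE.
have fin2 : ((2 * fourier_const R n)%:E * L2norm2 mu f < +oo)%E.
  by apply: lte_mul_pinfty => //; [rewrite lee_fin mulr_ge0 ?fourier_const_ge0|exact: f2.2].
exists W; split.
  (* Square integrability of the limit: it is at finite distance from the truncation at index 0,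
     which itself has finite norm. *)
  split => //; apply: (le_lt_trans (split1 0 mW)).
  apply: lte_add_pinfty; apply: lte_mul_pinfty => //.
    apply: (le_lt_trans (WP' 0%N)).
    have := truncation_tail_le mu (fun k => measurable_ballRn k%:R) fourier_const_ge0 f2.1 0.
    by move=> tl; apply: lte_add_pinfty; exact: (le_lt_trans tl).
  exact: (le_lt_trans (L2norm2_fourier_trunc_le 0)).
apply: cvge0_squeeze WP' _.
  by move=> k; apply: integral_ge0 => x _; rewrite lee_fin cnorm2_ge0.
by rewrite -(adde0 0%E); apply: cvgeD.
Qed.

(** The truncations are bounded with constant 2 [fourier_const]; comparing g with them costs another
    factor 2 plus an error that tends to 0. *)
Lemma is_fourierL2_le g : is_fourierL2 mu f g ->
  (L2norm2 mu g <= (4 * fourier_const R n)%:E * L2norm2 mu f)%E.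
Proof.
move=> [[mg g2] gl].
have fE : L2norm2 mu f = (fine (L2norm2 mu f))%:E.
  rewrite fineK// ge0_fin_numE; first exact: f2.2.
  by apply: integral_ge0 => x _; rewrite lee_fin cnorm2_ge0.
rewrite fE -EFinM; apply: (lee_cvg0 gl) => k; apply: (le_trans (split1 k mg)).
apply: leeD2l; rewrite [in leRHS]EFinM -fE (_ : 4 * fourier_const R n = 2 * (2 * fourier_const R n)); last by ring.
rewrite (EFinM 2) -muleA; apply: lee_wpmul2l => //; exact: L2norm2_fourier_trunc_le.
Qed.

End Fourier_transform.

(** * Existence and bound of the smoothing operator *)

Section smoothing_operator.
Variables (R : realType) (n : nat) (mu : {sigma_finite_measure set (Rn R n) -> \bar R}).
Hypothesis muL : is_lebesgue_Rn mu.
Variables (a : mpoly.mpoly n R) (s : R).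
Hypothesis s12 : 1 / 2 < s.
Notation leb := (@lebesgue_measure R).
Notation Z := (measurableTypeR R * Rn R n)%type.

Lemma st_integralE (I : set (measurableTypeR R)) (B : set (Rn R n)) (G : Z -> \bar R) :
  measurable I -> measurable B -> measurable_fun setT G -> (forall z, (0 <= G z)%E) ->
  (\int[leb]_(t in I) \int[mu]_(x in B) G (t, x) = \int[leb \x mu]_(z in I `*` B) G z)%E.
Proof.
move=> mI mB mG G0; rewrite [RHS]integral_mkcond fubini_tonelli1; last 2 first.
- apply/(measurable_restrictT _ _).1; first exact: measurableX.
  exact: measurable_funTS.
- by move=> z; rewrite patchE; case: ifP.
rewrite [LHS]integral_mkcond; apply: eq_integral => t _; rewrite patchE /fubini_F.
case: ifPn => tI; last first.
  rewrite integral0_eq// => x _; rewrite patchE ifF//; apply/negbTE; apply/negP.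
  by rewrite in_setX (negbTE tI).
rewrite [LHS]integral_mkcond; apply: eq_integral => x _.
by rewrite !patchE in_setX tI.
Qed.

Let s0 : 0 <= s. Proof. by apply: le_trans (ltW s12); rewrite divr_ge0. Qed.

Definition weight (z : Z) : R := jbr_pow s z.2 ^+ 2.

Let mw : measurable_fun setT weight.
Proof.
apply: measurable_funX.
by apply: (measurable_fun_snd_comp (f := jbr_pow s)); exact: measurable_jbr_pow.
Qed.

Let w_gt0 z : 0 < weight z. Proof. exact: jbr_pow_gt0. Qed.
Let w_ge0 z : 0 <= weight z. Proof. exact: ltW. Qed.

Let iball k : mu.-integrable setT (EFin \o (fun x => \1_(ballRn k%:R) x * grad_norm a x)).
Proof.
have [c cP] := grad_norm_bounded a k%:R.
exact: (integrable_indic_ball muL (measurable_grad_norm a) cP).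
Qed.

Let smoothing_const_ge0 : 0 <= smoothing_const a s.
Proof.
apply: mulr_ge0; first exact: exprn_ge0.
by apply: sumr_ge0 => j _; exact: smoothing_const_at_ge0.
Qed.

Let pin : R := (2 * pi) ^- n.

Let pin_ge0 : 0 <= pin.
Proof. by rewrite invr_ge0 exprn_ge0// mulr_ge0// pi_ge0. Qed.

Let pin_le1 : pin <= 1.
Proof.
rewrite invf_le1; first by rewrite exprn_ege1//; have := pi_ge2 R; lra.
by rewrite exprn_gt0// mulr_gt0// pi_gt0.
Qed.

Variable g : Rn R n -> R[i].
Hypothesis g2 : isL2 mu g.

(** The normalisation (2 pi)^-n is moved into the density by linearity; being at most 1, it does not
    increase the norm. *)
Let g' x : R[i] := pin%:C * g x.

Let cnorm2_g' x : cnorm2 (g' x) = pin ^+ 2 * cnorm2 (g x).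
Proof. by rewrite /g' /cnorm2; case: (g x) => u v /=; ring. Qed.

Let mg' : cmeasurable g'.
Proof.
have [mr mi] := g2.1; split.
  rewrite (_ : (fun x => _) = fun x => pin * complex.Re (g x)); first exact: measurable_funM.
  by apply/funext => x; rewrite /g'; case: (g x) => u v /=; ring.
rewrite (_ : (fun x => _) = fun x => pin * complex.Im (g x)); first exact: measurable_funM.
by apply/funext => x; rewrite /g'; case: (g x) => u v /=; ring.
Qed.

Let g'_le : (L2norm2 mu g' <= L2norm2 mu g)%E.
Proof.
apply: ge0_le_integral => //.
- by move=> x _; rewrite lee_fin cnorm2_ge0.
- by apply/measurable_EFinP; exact: measurable_cnorm2.
- by apply/measurable_EFinP; apply: measurable_cnorm2; exact: g2.1.
- move=> x _; rewrite lee_fin cnorm2_g' ler_piMl ?cnorm2_ge0//.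
  by rewrite exprn_ile1// pin_ge0.
Qed.

Let g'2 : (\int[mu]_x (cnorm2 (g' x))%:E < +oo)%E.
Proof. exact: le_lt_trans g'_le g2.2. Qed.

Notation ST k := (osc_transform mu (smoothing_phase a) (truncated (grad_norm a) g' (ballRn k%:R))).

Lemma smoothing_truncE (k : nat) t x : smoothing_trunc mu a g k%:R t x = ST k (t, x).
Proof.
have ic := cintegrable_truncated (measurable_grad_norm a) (@grad_norm_ge0 _ _ a) iball g2.1 g2.2
  (measurable_ballRn k%:R) (@subset_refl _ (ballRn k%:R)).
rewrite (_ : truncated _ g' _ = fun y => pin%:C * truncated (grad_norm a) g (ballRn k%:R) y); last first.
  by apply/funext => y; rewrite /truncated /g' mulrCA.
rewrite osc_transformZ//; last exact: measurable_smoothing_phase.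
rewrite /smoothing_trunc; congr (_ * _); rewrite cintegral_mkcond /osc_transform.
congr cintegral; apply/funext => y; rewrite /truncated /smoothing_phase/= cexpiD rmorphM/=.
ring.
Qed.

Let ball2 (K : nat) : set Z := `[- K%:R, K%:R]%classic `*` ballRn K%:R.

Let mball2 K : measurable (ball2 K).
Proof. by apply: measurableX; [exact: measurable_itv|exact: measurable_ballRn]. Qed.

Let cmST k : cmeasurable (ST k).
Proof.
exact: (cmeasurable_osc_truncation (@measurable_smoothing_phase _ _ a) (measurable_grad_norm a) (@grad_norm_ge0 _ _ a)
  (fun k => measurable_ballRn k%:R) iball mg' g'2).
Qed.

Let st_distE (w : Z -> R[i]) (k K : nat) : cmeasurable w ->
  (\int[leb]_(t in `[(- (K%:R : R))%R, (K%:R : R)]%classic)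
     \int[mu]_(x in ballRn K%:R) (cnorm2 (smoothing_trunc mu a g k%:R t x - w (t, x)))%:E =
   \int[leb \x mu]_(z in ball2 K) (cnorm2 (ST k z - w z))%:E)%E.
Proof.
move=> mwz; have mG : measurable_fun setT (fun z : Z => (cnorm2 (ST k z - w z))%:E).
  by apply/measurable_EFinP; apply: measurable_cnorm2; exact: cmeasurableB.
have G0 (z : Z) : (0 <= (cnorm2 (ST k z - w z))%:E)%E by rewrite lee_fin cnorm2_ge0.
have mI : measurable (`[- K%:R, K%:R]%classic : set (measurableTypeR R)) by exact: measurable_itv.
apply: etrans (st_integralE mI (measurable_ballRn K%:R) mG G0).
by apply: eq_integral => t _; apply: eq_integral => x _; rewrite smoothing_truncE.
Qed.

(** Completeness gives a limit in the weighted norm, whereas the definition asks for local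
    convergence. On a bounded ball the weight is bounded below, so the former implies the latter. *)
Lemma smoothing_limit_exists : exists w : R * Rn R n -> R[i], cmeasurable w /\
  forall K : nat, (fun k : nat =>
     (\int[lebesgue_measure]_(t in `[(- (K%:R : R))%R, (K%:R : R)]%classic)
        \int[mu]_(x in ballRn K%:R)
           (cnorm2 (smoothing_trunc mu a g k%:R t x - w (t, x)))%:E)%E) @ \oo --> 0%E.
Proof.
have [W mW WP] := osc_truncation_limit (@measurable_smoothing_phase _ _ a) mw w_gt0
  (measurable_grad_norm a) (@grad_norm_ge0 _ _ a)
  (@nondecreasing_ballRn R n) (fun k => measurable_ballRn k%:R) (@bigcup_ballRn R n) iball smoothing_const_ge0
  (smoothing_truncation_energy_le muL a s12) mg' g'2.
have t0 := truncation_tail_cvg (smoothing_const a s) (@nondecreasing_ballRn R n) (fun k => measurable_ballRn k%:R)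
  (@bigcup_ballRn R n) mg' g'2.
exists W; split; first exact: mW.
(* The minimum of the weight over the ball of radius K. *)
move=> K; pose c : R := (1 + K%:R ^+ 2) `^ (- s).
have c0 : 0 < c by rewrite powR_gt0// ltr_pwDl// sqr_ge0.
pose tl k := truncation_tail mu (fun k => ballRn k%:R) (smoothing_const a s) g' k.
have mcn k : measurable_fun setT (fun z => cnorm2 (ST k z - W z)).
  by apply: measurable_cnorm2; exact: cmeasurableB.
apply: (@cvge0_squeeze _ _ (fun k => c^-1%:E * (tl k + tl k)))%E.
- by move=> k; apply: integral_ge0 => t _; apply: integral_ge0 => x _; rewrite lee_fin cnorm2_ge0.
- move=> k; rewrite (st_distE k K mW).
  apply: (@le_trans _ _ (c^-1%:E * \int[leb \x mu]_z (weight z * cnorm2 (ST k z - W z))%:E)%E); last first.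
    by apply: lee_wpmul2l; [rewrite lee_fin invr_ge0 ltW|exact: WP].
  rewrite -ge0_integralZl//; last 3 first.
  + by apply/measurable_EFinP; exact: measurable_funM.
  + by move=> z _; rewrite lee_fin mulr_ge0 ?cnorm2_ge0.
  + by rewrite lee_fin invr_ge0 ltW.
  apply: (@le_trans _ _ (\int[leb \x mu]_(z in ball2 K) (c^-1%:E * (weight z * cnorm2 (ST k z - W z))%:E))%E).
    apply: ge0_le_integral => //.
    * by move=> z _; rewrite lee_fin cnorm2_ge0.
    * by apply/measurable_EFinP; exact: measurable_funTS.
    * by apply: measurable_funTS; apply: measurable_funeM; apply/measurable_EFinP; exact: measurable_funM.
    * move=> [t x] [_ /= xK]; rewrite -EFinM lee_fin mulrA ler_peMl ?cnorm2_ge0//.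
      by rewrite mulrC ler_pdivlMr// mul1r; exact: jbr_pow_ge.
  apply: ge0_subset_integral => //.
  + by apply: measurable_funeM; apply/measurable_EFinP; exact: measurable_funM.
  + by move=> z _; rewrite -EFinM lee_fin; apply: mulr_ge0; [rewrite invr_ge0 ltW|rewrite mulr_ge0 ?cnorm2_ge0].
rewrite -(mule0 c^-1%:E); apply: cvgeZl => //.
by rewrite -(adde0 0%E); apply: cvgeD.
Qed.

(** The reverse passage: the weight is at most 1, so on each bounded region local convergence
    controls the weighted error. The truncations obey a bound independent of the region, which is
    then exhausted. The 4 is a 2 from comparing w with a truncation times a 2 from separating real
    and imaginary parts. *)
Lemma weighted_st_norm2_le (w : R * Rn R n -> R[i]) : cmeasurable w ->
  (forall K : nat, (fun k : nat =>
     (\int[lebesgue_measure]_(t in `[(- (K%:R : R))%R, (K%:R : R)]%classic)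
        \int[mu]_(x in ballRn K%:R)
           (cnorm2 (smoothing_trunc mu a g k%:R t x - w (t, x)))%:E)%E) @ \oo --> 0%E) ->
  (weighted_st_norm2 mu s w <= (4 * smoothing_const a s)%:E * L2norm2 mu g)%E.
Proof.
move=> mww wl.
have mw' : cmeasurable (w : Z -> R[i]) by exact: mww.
have gE : L2norm2 mu g = (fine (L2norm2 mu g))%:E.
  rewrite fineK// ge0_fin_numE; first exact: g2.2.
  by apply: integral_ge0 => x _; rewrite lee_fin cnorm2_ge0.
have mG : measurable_fun setT (fun z : Z => (weight z * cnorm2 (w z))%:E).
  by apply/measurable_EFinP; apply: measurable_funM => //; exact: measurable_cnorm2.
have G0 (z : Z) : (0 <= (weight z * cnorm2 (w z))%:E)%E.
  by rewrite lee_fin mulr_ge0 ?cnorm2_ge0.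
have -> : weighted_st_norm2 mu s w = (\int[leb \x mu]_z (weight z * cnorm2 (w z))%:E)%E.
  by rewrite fubini_tonelli1.
apply: (@ge0_integral_exhaustion_le _ _ _ (leb \x mu)%E ball2) => //.
- move=> k l kl; apply/subsetPset => -[t x] /= [+ xk]; rewrite /= !in_itv/= -!ler_norml => tk.
  split => /=; last by move: xk; apply/subsetPset; exact: nondecreasing_ballRn.
  by rewrite in_itv/= -ler_norml (le_trans tk)// ler_nat.
- apply/seteqP; split => // -[t x] _.
  have [k _ xk] : (\bigcup_k @ballRn R n k%:R) x by rewrite bigcup_ballRn.
  exists (maxn k (Num.truncn `|t|).+1) => //; split => /=.
    rewrite in_itv/= -ler_norml; apply: (le_trans (ltW (truncnS_gt _))).
    by rewrite ler_nat leq_maxr.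
  by apply: (le_trans xk); rewrite ler_nat leq_maxl.
move=> K; rewrite gE -EFinM; apply: (lee_cvg0 (wl K)) => k.
rewrite (st_distE k K mw').
apply: (le_trans (integral_cnorm2_split (leb \x mu)%E (mball2 K) mw w_ge0 (cmST k) mw')).
apply: leeD.
  apply: lee_wpmul2l => //.
  apply: ge0_le_integral => //.
  - by move=> z _; rewrite lee_fin mulr_ge0 ?cnorm2_ge0.
  - apply/measurable_EFinP; apply: measurable_funTS; apply: measurable_funM => //.
    by apply: measurable_cnorm2; exact: cmeasurableB.
  - apply/measurable_EFinP; apply: measurable_funTS.
    by apply: measurable_cnorm2; exact: cmeasurableB.
  - by move=> z _; rewrite lee_fin ler_piMl ?cnorm2_ge0// jbr_pow_le1.
have := osc_truncation_le (@measurable_smoothing_phase _ _ a) mw w_gt0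
  (measurable_grad_norm a) (@grad_norm_ge0 _ _ a) (fun k => measurable_ballRn k%:R) iball smoothing_const_ge0
  (smoothing_truncation_energy_le muL a s12) mg' g'2 k.
move=> h; rewrite (_ : 4 * smoothing_const a s * fine (L2norm2 mu g) =
  2 * (2 * smoothing_const a s * fine (L2norm2 mu g))); last by ring.
rewrite [in leRHS](EFinM 2); apply: lee_wpmul2l => //.
rewrite EFinM -gE; apply: (@le_trans _ _ ((2 * smoothing_const a s)%:E * L2norm2 mu g')%E); last first.
  by apply: lee_wpmul2l => //; rewrite lee_fin mulr_ge0.
apply: le_trans h; apply: ge0_subset_integral => //.
- apply/measurable_EFinP; apply: measurable_funM => //; exact: measurable_cnorm2.
- by move=> z _; rewrite lee_fin mulr_ge0 ?cnorm2_ge0.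
Qed.

End smoothing_operator.

Theorem theorem3p3 (R : realType) (n : nat)
    (mu : {measure set (Rn R n) -> \bar R}) (s : R) (a : mpoly.mpoly n R) :
  (0 < n)%N -> 1 / 2 < s -> is_lebesgue_Rn mu ->
  exists C : R, 0 < C /\
    forall phi : Rn R n -> R[i], isL2 mu phi ->
      (exists w, is_smoothing_op mu a phi w) /\
      forall w, is_smoothing_op mu a phi w ->
        (weighted_st_norm2 mu s w <= (C ^+ 2)%:E * L2norm2 mu phi)%E.
Proof.
move=> _ s12 muL.
(* Only now is the given measure replaced by an equal one with sigma-finite structure, as all the
   sections above suppose. *)
have [mu' mu'E] := sigma_finite_measureP (lebesgue_Rn_sigma_finite muL).
have muE : mu = mu' by apply: eq_measure; apply/funext => A; rewrite mu'E.
rewrite muE in muL *.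
have Cs0 : 0 <= smoothing_const a s.
  apply: mulr_ge0; first exact: exprn_ge0.
  by apply: sumr_ge0 => j _; exact: smoothing_const_at_ge0.
pose D := 4 * smoothing_const a s * (4 * fourier_const R n).
have D0 : 0 <= D by apply: mulr_ge0; apply: mulr_ge0 => //; exact: fourier_const_ge0.
(* The norms are squared, so C^2 >= D is wanted; 1 + D achieves it and is positive even when D =
   0. *)
exists (1 + D); split; first by rewrite ltr_pwDl.
move=> phi phi2; split.
  have [g fg] := is_fourierL2_exists muL phi2.
  have [w [mw wl]] := smoothing_limit_exists muL a s12 fg.1.
  by exists w, g.
move=> w [g [fg [mw wl]]].
apply: (le_trans (weighted_st_norm2_le muL s12 fg.1 mw wl)).
apply: (@le_trans _ _ (D%:E * L2norm2 mu' phi)%E).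
  rewrite /D (EFinM (4 * _)) -muleA; apply: lee_wpmul2l; last exact: is_fourierL2_le.
  by rewrite lee_fin mulr_ge0.
apply: lee_wpmul2r.
  by apply: integral_ge0 => x _; rewrite lee_fin cnorm2_ge0.
by rewrite lee_fin; nra.
Qed.
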